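(* Assume $\mathsf{LUH}(\kappa)$, and let the ring $T$ and the left $T$-module $G=Z^2\bigl((F_T)^\bullet\bigr)$ be constructed from $\kappa$ as described in the context. Then $T$ is left and right coherent, and $G$ is strongly Gorenstein projective but not Gorenstein flat. In particular, $$G\in\mathcal{GP}(T)\setminus\mathcal{GF}(T).$$ Therefore $G\notin\mathcal{PGF}(T)$ and $\mathcal{PGF}(T)\subsetneq\mathcal{GP}(T)$.
   Context: Set theory. $\mathcal P_\kappa(Y)=\{a\subseteq Y: |a|<\kappa\}$. A filter is $\kappa$-complete if closed under intersections of fewer than $\kappa$ members. An ultrafilter on $\mathcal P_\kappa(Y)$ is fine if for every $y\in Y$ it contains $\{a: y\in a\}$. $\mathsf{LUH}(\kappa)$ means: (LUH1) $\kappa$ is uncountable and there is a nonprincipal $\kappa$-complete ultrafilter on $\kappa$; (LUH2) there is an $\aleph_1$-complete fine ultrafilter on $\mathcal P_\kappa(2^\kappa)$. Construction. Fix a nonprincipal $\kappa$-complete ultrafilter $\mathcal U$ on $X:=\kappa$; put $\mathcal I:=\mathcal P(X)\setminus\mathcal U$, $R:=(\mathbb F_2)^X$ (pointwise operations), $\mathfrak m:=\{r\in R: \{x: r(x)\ne0\}\in\mathcal I\}$ (an ideal), $S:=R/\mathfrak m$. Choose a resolution $\cdots\to F^{-2}\to F^{-1}\to F^0\to S\to0$ of $S$ by free left $R$-modules with differentials $d_F^{n}:F^n\to F^{n+1}$; let $F^\bullet$ be the complex with $S$ deleted ($F^n=0$ for $n>0$, $d_F^0=0$). Put $F_\oplus:=\bigoplus_{n\le0}F^n$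 and $\partial:F_\oplus\to F_\oplus$, $(x_n)_{n\le0}\mapsto(d_F^{n-1}(x_{n-1}))_{n\le0}$. Let $B:=R[\varepsilon]/(\varepsilon^2)$ and let $\Delta$ be the $B$-endomorphism of $B\otimes_RF_\oplus$ given by $\Delta(b\otimes x)=b\varepsilon\otimes x+b\otimes\partial(x)$. Let $(F_B)^\bullet$ be the complex with $(F_B)^i=B\otimes_RF_\oplus$ and differential $\Delta$ for every $i\in\mathbb Z$. Regard $R$ as a $B$-$R$-bimodule, with left action through $B\to R$, $\varepsilon\mapsto0$, and right action by multiplication. Put $$T:=\begin{pmatrix}R&0\\ {}_BR_R&B\end{pmatrix},\qquad e_B:=\begin{pmatrix}0&0\\0&1\end{pmatrix},$$ with matrix multiplication, and identify $B$ with $e_BTe_B$. Let $(F_T)^\bullet:=Te_B\otimes_B(F_B)^\bullet$, i.e. $(F_T)^n=Te_B\otimes_B(F_B)^n$ with differential $1\otimes\Delta$. $Z^n$ denotes the kernel of the $n$-th differential. Homological algebra. Rings are associative with identity, modules unital. A ring $A$ is left coherent if every finitely generated left ideal is finitely presented; right coherent if $A^{\mathrm{op}}$ is left coherent. A complex $P^\bullet$ of projective left $A$-modules is totally acyclic if it is acyclic and $\operatorname{Hom}_A(P^\bullet,Q)$ is acyclic for every projective left $A$-module $Q$. A complex $Y^\bullet$ of flat left $A$-modules is $F$-totally acyclic if it is acyclic and $E\otimes_AY^\bullet$ is acyclic for every injective right $A$-module $E$. $\mathcal{GP}(A)$ (Gorenstein projective), $\mathcal{GF}(A)$ (Gorenstein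 flat), $\mathcal{PGF}(A)$ (projectively coresolved Gorenstein flat) are the classes of left $A$-modules that are cocycles of, respectively, a totally acyclic complex of projectives, an $F$-totally acyclic complex of flats, an $F$-totally acyclic complex of projectives. A left $A$-module $G$ is strongly Gorenstein projective if there is an exact sequence $0\to G\to P\to G\to0$ with $P$ projective that remains exact under $\operatorname{Hom}_A(-,Q')$ for every projective left $A$-module $Q'$. *)

(* Defs.v *)
From HB Require Import structures.
From mathcomp Require Import all_boot all_algebra.
From mathcomp Require Import ring_quotient qpoly freeg.
From mathcomp Require Import boolp classical_sets functions cardinality filter.

Set Warnings "-redundant-canonical-projection".
Set Implicit Arguments.
Unset Strict Implicit.
Unset Printing Implicit Defensive.

Import GRing.Theory.
Local Open Scope ring_scope.
Local Open Scope quotient_scope.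

(* Left modules over A are [lmodType A]; right modules over A are
   [lmodType A^c], so that [a *: e] stands for e.a in a right module. *)

Section Submodules.
Variables (A : pzRingType) (M : lmodType A) (N : submodClosed M).

Record submod : Type := Submod { submod_val :> M; _ : submod_val \in N }.

HB.instance Definition _ := [isSub for submod_val].
HB.instance Definition _ := [Choice of submod by <:].
HB.instance Definition _ := [SubChoice_isSubLmodule of submod by <:].

End Submodules.

Section Quotients.
Variables (A : pzRingType) (M : lmodType A) (N : submodClosed M).

Definition submod_pred : {pred M} := N.

Lemma submod_pred_zmod_closed : zmod_closed submod_pred.
Proof.
split; first exact: (rpred0 N).
move=> x y Nx Ny; rewrite -scaleN1r.
by apply: (@rpredD _ N) => //; apply: rpredZ.
Qed.

HB.instance Definition _ :=
  GRing.isZmodClosed.Build M submod_pred submod_pred_zmod_closed.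

Definition quotmod : Type := Quotient.quot submod_pred.
HB.instance Definition _ := GRing.Zmodule.on quotmod.

Definition quotmod_pi (x : M) : quotmod := \pi_(Quotient.quot submod_pred) x.

Definition quotmod_scale (a : A) (x : quotmod) : quotmod :=
  quotmod_pi (a *: repr (x : Quotient.quot submod_pred)).

Lemma quotmod_piP (x y : M) : quotmod_pi x = quotmod_pi y <-> x - y \in N.
Proof.
split=> [/eqP|Nxy]; first by rewrite /quotmod_pi -Quotient.idealrBE.
by apply/eqP; rewrite /quotmod_pi -Quotient.idealrBE.
Qed.

Lemma quotmod_piK (x : quotmod) :
  quotmod_pi (repr (x : Quotient.quot submod_pred)) = x.
Proof. exact: reprK. Qed.

Lemma quotmod_piD (x y : M) :
  quotmod_pi (x + y) = quotmod_pi x + quotmod_pi y.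
Proof. by rewrite /quotmod_pi raddfD. Qed.

Lemma quotmod_scale_pi (a : A) (x : M) :
  quotmod_scale a (quotmod_pi x) = quotmod_pi (a *: x).
Proof.
apply/quotmod_piP; rewrite -scalerBr; apply: rpredZ.
by apply/quotmod_piP; rewrite quotmod_piK.
Qed.

Let scaleA a b (x : quotmod) :
  quotmod_scale a (quotmod_scale b x) = quotmod_scale (a * b) x.
Proof. by rewrite -[x]quotmod_piK !quotmod_scale_pi scalerA. Qed.
Let scale1 : left_id 1 quotmod_scale.
Proof. by move=> x; rewrite -[x]quotmod_piK !quotmod_scale_pi scale1r. Qed.
Let scaleDr : right_distributive quotmod_scale +%R.
Proof.
move=> a x y; rewrite -[x]quotmod_piK -[y]quotmod_piK.
by rewrite -quotmod_piD !quotmod_scale_pi scalerDr quotmod_piD.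
Qed.
Let scaleDl (x : quotmod) : {morph quotmod_scale^~ x : a b / a + b}.
Proof.
move=> a b; rewrite -[x]quotmod_piK.
by rewrite !quotmod_scale_pi scalerDl quotmod_piD.
Qed.

HB.instance Definition _ := GRing.Zmodule_isLmodule.Build A quotmod
  scaleA scale1 scaleDr scaleDl.

End Quotients.

Section Kernels.
Variables (A : pzRingType) (M N : lmodType A) (f : {linear M -> N}).

Definition ker_pred : {pred M} := [pred x | f x == 0].

Lemma ker_predE x : (x \in ker_pred) = (f x == 0).
Proof. by []. Qed.

Lemma ker_pred_closed : subsemimod_closed ker_pred.
Proof.
split; [split=> [|x y] | move=> a x]; rewrite !ker_predE.
- by rewrite raddf0.
- by move=> /eqP fx /eqP fy; rewrite raddfD /= fx fy addr0.
- by move=> /eqP fx; rewrite linearZ_LR /= fx scaler0.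
Qed.

HB.instance Definition _ :=
  GRing.isSubmodClosed.Build A M ker_pred ker_pred_closed.

Definition kermod : lmodType A := submod ker_pred.

End Kernels.

Section TensorProduct.
Variables (A : pzRingType) (E : lmodType A^c) (Y : lmodType A).
Local Notation FG := {freeg (E * Y) / int}.
Local Notation gen e y := (<< (e, y) >> : FG).

Inductive tensor_rel : FG -> Prop :=
| tensor_relDl e e' y : tensor_rel (gen (e + e') y - gen e y - gen e' y)
| tensor_relDr e y y' : tensor_rel (gen e (y + y') - gen e y - gen e y')
| tensor_relZ (a : A) e y :
    tensor_rel (gen ((a : A^c) *: e) y - gen e (a *: y))
| tensor_rel0 : tensor_rel 0
| tensor_relB u v : tensor_rel u -> tensor_rel v -> tensor_rel (u - v).

Definition tensor_pred : {pred FG} := [pred u | `[< tensor_rel u >]].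

Lemma tensor_predP u : reflect (tensor_rel u) (u \in tensor_pred).
Proof. exact: asboolP. Qed.

Lemma tensor_pred_closed : zmod_closed tensor_pred.
Proof.
split; first by apply/tensor_predP; exact: tensor_rel0.
move=> u v /tensor_predP ru /tensor_predP rv.
by apply/tensor_predP; exact: tensor_relB.
Qed.

HB.instance Definition _ :=
  GRing.isZmodClosed.Build FG tensor_pred tensor_pred_closed.

Definition tensor : Type := Quotient.quot tensor_pred.
HB.instance Definition _ := GRing.Zmodule.on tensor.

Definition tensor_pi (u : FG) : tensor := \pi_(Quotient.quot tensor_pred) u.
Definition tens (e : E) (y : Y) : tensor := tensor_pi (gen e y).

Lemma tensor_piP u v : tensor_pi u = tensor_pi v <-> tensor_rel (u - v).
Proof.
split=> [/eqP|ruv].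
  by rewrite /tensor_pi -Quotient.idealrBE => /tensor_predP.
by apply/eqP; rewrite /tensor_pi -Quotient.idealrBE; apply/tensor_predP.
Qed.

Lemma tensor_piK (t : tensor) :
  tensor_pi (repr (t : Quotient.quot tensor_pred)) = t.
Proof. exact: reprK. Qed.

Lemma tensor_piB u v : tensor_pi (u - v) = tensor_pi u - tensor_pi v.
Proof. by rewrite /tensor_pi raddfB. Qed.

Lemma tensDl e e' y : tens (e + e') y = tens e y + tens e' y.
Proof.
apply/eqP; rewrite -subr_eq0 opprD addrA -!tensor_piB; apply/eqP.
rewrite -[0](raddf0 \pi_(Quotient.quot tensor_pred)).
by apply/tensor_piP; rewrite subr0; exact: tensor_relDl.
Qed.

Lemma tensDr e y y' : tens e (y + y') = tens e y + tens e y'.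
Proof.
apply/eqP; rewrite -subr_eq0 opprD addrA -!tensor_piB; apply/eqP.
rewrite -[0](raddf0 \pi_(Quotient.quot tensor_pred)).
by apply/tensor_piP; rewrite subr0; exact: tensor_relDr.
Qed.

Lemma tensZ (a : A) e y : tens ((a : A^c) *: e) y = tens e (a *: y).
Proof. by apply/tensor_piP; exact: tensor_relZ. Qed.

Lemma tensor_ind (P : tensor -> Prop) :
  (forall u v, P u -> P v -> P (u - v)) -> (forall e y, P (tens e y)) ->
  forall t, P t.
Proof.
move=> PB Pt t; rewrite -[t]tensor_piK.
move: (repr _) => u.
have P0 : P 0 by rewrite -(subrr (tens 0 0)); exact: PB.
have PN v : P v -> P (- v) by move=> Pv; rewrite -[- v]add0r; exact: PB.
have PD v w : P v -> P w -> P (v + w).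
  by move=> Pv Pw; rewrite -[w]opprK; apply: PB => //; apply: PN.
rewrite -(freeg_sumE u) /tensor_pi raddf_sum /=.
elim/big_ind: _ => // -[e y] _.
set c := coeff _ _.
have -> : << c *g (e, y) >> = gen e y *~ c.
  by rewrite freegU_mulz intz.
rewrite raddfMz -/(tens e y).
have Pn n : P (tens e y *+ n).
  by elim: n => [|n IHn]; rewrite ?mulr0n // mulrS; exact: PD.
by case: c => n; [exact: Pn | apply: PN; exact: Pn].
Qed.

Section Lift.
Variables (V : zmodType) (f : E -> Y -> V).

Definition tensor_lift (t : tensor) : V :=
  fglift (fun p => f p.1 p.2 : zmodule V)
    (repr (t : Quotient.quot tensor_pred)).

Hypothesis fDl : forall e e' y, f (e + e') y = f e y + f e' y.
Hypothesis fDr : forall e y y', f e (y + y') = f e y + f e y'.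
Hypothesis fZ : forall (a : A) e y, f ((a : A^c) *: e) y = f e (a *: y).

Let fl : FG -> V := fglift (fun p => f p.1 p.2 : zmodule V).

Let flB u v : fl (u - v) = fl u - fl v.
Proof.
exact: (@lift_is_additive _ _ (zmodule V) (fun p => f p.1 p.2 : zmodule V) u v).
Qed.

Let fl_gen e y : fl (gen e y) = f e y.
Proof. by rewrite /fl liftU scale1r. Qed.

Let fl_rel u : tensor_rel u -> fl u = 0.
Proof.
elim=> [e e' y|e y y'|a e y||v w _ IHv _ IHw].
- by rewrite !flB !fl_gen fDl addrAC addrK subrr.
- by rewrite !flB !fl_gen fDr addrAC addrK subrr.
- by rewrite flB !fl_gen fZ subrr.
- by rewrite -(subrr (0 : FG)) flB subrr.
- by rewrite flB IHv IHw subrr.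
Qed.

Lemma tensor_lift_pi u : tensor_lift (tensor_pi u) = fl u.
Proof.
apply/eqP; rewrite -subr_eq0 -[X in X - _]/(fl _) -flB; apply/eqP/fl_rel.
by apply/tensor_piP; rewrite tensor_piK.
Qed.

Lemma tensor_lift_tens e y : tensor_lift (tens e y) = f e y.
Proof. by rewrite tensor_lift_pi fl_gen. Qed.

Lemma tensor_lift_zmod_morphism : zmod_morphism tensor_lift.
Proof.
move=> t u; rewrite -[t]tensor_piK -[u]tensor_piK -tensor_piB.
by rewrite !tensor_lift_pi flB.
Qed.

End Lift.

Lemma tensor_ext (V : zmodType) (f g : {additive tensor -> V}) :
  (forall e y, f (tens e y) = g (tens e y)) -> f =1 g.
Proof.
move=> fg; apply: tensor_ind => [u v fgu fgv|//].
by rewrite !raddfB fgu fgv.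
Qed.

End TensorProduct.

Section TensorMap.
Variables (A : pzRingType) (E E' : lmodType A^c) (Y Y' : lmodType A).
Variables (f : {linear E -> E'}) (g : {linear Y -> Y'}).

Definition tensor_map : tensor E Y -> tensor E' Y' :=
  tensor_lift (fun e y => tens (f e) (g y)).

Let fg e y := tens (f e) (g y).
Let fgDl e e' y : fg (e + e') y = fg e y + fg e' y.
Proof. by rewrite /fg raddfD tensDl. Qed.
Let fgDr e y y' : fg e (y + y') = fg e y + fg e y'.
Proof. by rewrite /fg raddfD tensDr. Qed.
Let fgZ (a : A) e y : fg ((a : A^c) *: e) y = fg e (a *: y).
Proof. by rewrite /fg !linearZ_LR tensZ. Qed.

HB.instance Definition _ := GRing.isZmodMorphism.Build _ _ tensor_map
  (tensor_lift_zmod_morphism fgDl fgDr fgZ).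

Lemma tensor_mapE e y : tensor_map (tens e y) = tens (f e) (g y).
Proof. exact: (tensor_lift_tens fgDl fgDr fgZ). Qed.

End TensorMap.

Record bimod (C A : pzRingType) := Bimod {
  bimod_sort :> zmodType;
  lact : C -> bimod_sort -> bimod_sort;
  ract : bimod_sort -> A -> bimod_sort;
  lactA : forall c d x, lact c (lact d x) = lact (c * d) x;
  lact1 : forall x, lact 1 x = x;
  lactDr : forall c x y, lact c (x + y) = lact c x + lact c y;
  lactDl : forall x c d, lact (c + d) x = lact c x + lact d x;
  ractA : forall x a b, ract (ract x a) b = ract x (a * b);
  ract1 : forall x, ract x 1 = x;
  ractDl : forall a x y, ract (x + y) a = ract x a + ract y a;
  ractDr : forall x a b, ract x (a + b) = ract x a + ract x b;
  lractA : forall c x a, lact c (ract x a) = ract (lact c x) a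
}.

Section Bimodules.
Variables (C A : pzRingType) (M : bimod C A).

Definition lmod_of_bimod : Type := M.
HB.instance Definition _ := GRing.Zmodule.on lmod_of_bimod.
HB.instance Definition _ := GRing.Zmodule_isLmodule.Build C lmod_of_bimod
  (@lactA _ _ M) (@lact1 _ _ M) (@lactDr _ _ M) (@lactDl _ _ M).

Definition rmod_of_bimod : Type := M.
HB.instance Definition _ := GRing.Zmodule.on rmod_of_bimod.
Let rscaleA (a b : A^c) (x : rmod_of_bimod) :
  ract (ract (x : M) b) a = ract (x : M) (a * b).
Proof. by rewrite ractA. Qed.
HB.instance Definition _ := GRing.Zmodule_isLmodule.Build A^c rmod_of_bimod
  rscaleA (@ract1 _ _ M) (@ractDl _ _ M) (@ractDr _ _ M).

Definition lact_fun (c : C) (x : rmod_of_bimod) : rmod_of_bimod :=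
  lact c (x : M).

Let lact_fun_linear c : linear (lact_fun c).
Proof.
move=> a x y; rewrite /lact_fun lactDr.
by rewrite [a *: x]/(ract (x : M) a) lractA.
Qed.
HB.instance Definition _ c :=
  GRing.isLinear.Build A^c rmod_of_bimod rmod_of_bimod _ (lact_fun c)
    (lact_fun_linear c).

Variable Y : lmodType A.

Definition bitensor : Type := tensor rmod_of_bimod Y.
HB.instance Definition _ := GRing.Zmodule.on bitensor.

Definition bitensor_scale (c : C) (t : bitensor) : bitensor :=
  tensor_map (lact_fun c) (@idfun Y) t.

Let scaleDr : right_distributive bitensor_scale +%R.
Proof. by move=> c t u; rewrite /bitensor_scale raddfD. Qed.
Let scaleB c t u : bitensor_scale c (t - u) =
  bitensor_scale c t - bitensor_scale c u.
Proof. by rewrite /bitensor_scale raddfB. Qed.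
Let scaleE c (x : rmod_of_bimod) y :
  bitensor_scale c (tens x y) = tens (lact_fun c x) y.
Proof. exact: tensor_mapE. Qed.
Let scaleA a b t :
  bitensor_scale a (bitensor_scale b t) = bitensor_scale (a * b) t.
Proof.
elim/tensor_ind: t => [t u IHt IHu|x y]; first by rewrite !scaleB IHt IHu.
by rewrite !scaleE /lact_fun lactA.
Qed.
Let scale1 : left_id 1 bitensor_scale.
Proof.
elim/tensor_ind => [t u IHt IHu|x y]; first by rewrite scaleB IHt IHu.
by rewrite scaleE /lact_fun lact1.
Qed.
Let scaleDl t : {morph bitensor_scale^~ t : a b / a + b}.
Proof.
move=> a b; elim/tensor_ind: t => [t u IHt IHu|x y].
  by rewrite !scaleB IHt IHu opprD addrACA.
by rewrite !scaleE /lact_fun lactDl tensDl.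
Qed.

HB.instance Definition _ := GRing.Zmodule_isLmodule.Build C bitensor
  scaleA scale1 scaleDr scaleDl.

Definition bitens (x : M) (y : Y) : bitensor := tens (x : rmod_of_bimod) y.

Lemma bitensZ c x y : c *: bitens x y = bitens (lact c x) y.
Proof. exact: scaleE. Qed.

Lemma bitensDl x x' y : bitens (x + x') y = bitens x y + bitens x' y.
Proof. exact: tensDl. Qed.

Lemma bitensDr x y y' : bitens x (y + y') = bitens x y + bitens x y'.
Proof. exact: tensDr. Qed.

Lemma bitens0l y : bitens 0 y = 0.
Proof. by apply: (addrI (bitens 0 y)); rewrite -bitensDl !addr0. Qed.

Lemma bitens0r x : bitens x 0 = 0.
Proof. by apply: (addrI (bitens x 0)); rewrite -bitensDr !addr0. Qed.

Lemma bitens_ract x a y : bitens (ract x a) y = bitens x (a *: y).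
Proof. exact: (@tensZ A rmod_of_bimod Y a x y). Qed.

Lemma bitens_ind (P : bitensor -> Prop) :
  (forall u v, P u -> P v -> P (u - v)) -> (forall x y, P (bitens x y)) ->
  forall t, P t.
Proof. by move=> PB Pt; apply: tensor_ind. Qed.

End Bimodules.

Section BitensorMap.
Variables (C A : pzRingType) (M M' : bimod C A) (Y Y' : lmodType A).
Variables (f : {linear rmod_of_bimod M -> rmod_of_bimod M'}).
Variables (g : {linear Y -> Y'}).
Hypothesis f_lact : forall c x, f (lact c (x : M)) = lact c (f x : M').

Definition bitensor_map : bitensor M Y -> bitensor M' Y' := tensor_map f g.

Let bitensor_mapB : zmod_morphism bitensor_map.
Proof. by move=> t u; rewrite /bitensor_map raddfB. Qed.
HB.instance Definition _ := GRing.isZmodMorphism.Build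
  (bitensor M Y) (bitensor M' Y') bitensor_map bitensor_mapB.

Lemma bitensor_mapE x y : bitensor_map (bitens x y) = bitens (f x) (g y).
Proof. exact: tensor_mapE. Qed.

Lemma bitensor_map_scalable : scalable bitensor_map.
Proof.
move=> c; elim/bitens_ind => [t u IHt IHu|x y].
  by rewrite scalerBr raddfB [in RHS]raddfB scalerBr /= IHt IHu.
by rewrite bitensZ !bitensor_mapE bitensZ f_lact.
Qed.

Definition bitensor_lin : {linear bitensor M Y -> bitensor M' Y'} :=
  HB.pack bitensor_map
    (GRing.isScalable.Build C (bitensor M Y) (bitensor M' Y') _ bitensor_map
       bitensor_map_scalable).

Lemma bitensor_linE x y : bitensor_lin (bitens x y) = bitens (f x) (g y).
Proof. exact: bitensor_mapE. Qed.

End BitensorMap.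

Section DirectSum.
Variables (A : pzRingType) (I : Type) (F : I -> lmodType A).

Record dsum : Type := Dsum {
  dsum_fun :> forall i, F i;
  dsum_finite : finite_set [set i | dsum_fun i != 0]%classic
}.

HB.instance Definition _ := gen_eqMixin dsum.
HB.instance Definition _ := gen_choiceMixin dsum.

Lemma dsumP (x y : dsum) : (forall i, x i = y i) -> x = y.
Proof.
case: x y => [x fx] [y fy] /= xy.
have {xy} exy : x = y by exact: functional_extensionality_dep.
by rewrite {}exy in fx *; congr Dsum; exact: Prop_irrelevance.
Qed.

Let fin0 : finite_set [set i | (0 : F i) != 0]%classic.
Proof. by apply: sub_finite_set (finite_set0 I) => i /=; rewrite eqxx. Qed.
Definition dsum0 : dsum := @Dsum (fun=> 0) fin0.

Let finD (x y : dsum) : finite_set [set i | x i + y i != 0]%classic.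
Proof.
have : finite_set ([set i | x i != 0] `|` [set i | y i != 0])%classic.
  by rewrite finite_setU; split; exact: dsum_finite.
apply: sub_finite_set => i /=; have [->|] := eqVneq (x i) 0; last by left.
by rewrite add0r; right.
Qed.
Definition dsum_add (x y : dsum) : dsum := Dsum (finD x y).

Let finZ (a : A) (x : dsum) : finite_set [set i | a *: x i != 0]%classic.
Proof.
apply: sub_finite_set (dsum_finite x) => i /=; apply: contraNneq => ->.
by rewrite scaler0.
Qed.
Definition dsum_scale (a : A) (x : dsum) : dsum := Dsum (finZ a x).
Definition dsum_opp (x : dsum) : dsum := dsum_scale (-1) x.

Let addA : associative dsum_add.
Proof. by move=> x y z; apply: dsumP => i /=; rewrite addrA. Qed.
Let addC : commutative dsum_add.
Proof. by move=> x y; apply: dsumP => i /=; rewrite addrC. Qed.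
Let add0 : left_id dsum0 dsum_add.
Proof. by move=> x; apply: dsumP => i /=; rewrite add0r. Qed.
Let addN : left_inverse dsum0 dsum_opp dsum_add.
Proof. by move=> x; apply: dsumP => i /=; rewrite scaleN1r addNr. Qed.
HB.instance Definition _ := GRing.isZmodule.Build dsum addA addC add0 addN.

Let scaleA a b (x : dsum) :
  dsum_scale a (dsum_scale b x) = dsum_scale (a * b) x.
Proof. by apply: dsumP => i /=; rewrite scalerA. Qed.
Let scale1 : left_id 1 dsum_scale.
Proof. by move=> x; apply: dsumP => i /=; rewrite scale1r. Qed.
Let scaleDr : right_distributive dsum_scale +%R.
Proof. by move=> a x y; apply: dsumP => i /=; rewrite scalerDr. Qed.
Let scaleDl (x : dsum) : {morph dsum_scale^~ x : a b / a + b}.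
Proof. by move=> a b; apply: dsumP => i /=; rewrite scalerDl. Qed.
HB.instance Definition _ := GRing.Zmodule_isLmodule.Build A dsum
  scaleA scale1 scaleDr scaleDl.

End DirectSum.

Section ModuleNotions.
Variable A : pzRingType.

Definition is_surj (U V : Type) (f : U -> V) : Prop :=
  forall v, exists u, f u = v.

Definition exact_at (U V W : zmodType) (f : U -> V) (g : V -> W) : Prop :=
  forall v, g v = 0 <-> exists u, f u = v.

Definition iso_mod (M N : lmodType A) : Prop :=
  exists f : {linear M -> N}, bijective f.

Definition is_basis (M : lmodType A) (b : set M) : Prop :=
  (forall x : M, exists (s : seq M) (c : M -> A),
     (forall u, u \in s -> b u) /\ x = \sum_(u <- s) c u *: u) /\
  (forall (s : seq M) (c : M -> A), uniq s -> (forall u, u \in s -> b u) ->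
     \sum_(u <- s) c u *: u = 0 -> forall u, u \in s -> c u = 0).

Definition is_free (M : lmodType A) : Prop := exists b : set M, is_basis b.

Definition is_projective (P : lmodType A) : Prop :=
  forall (M N : lmodType A) (p : {linear M -> N}) (f : {linear P -> N}),
    is_surj p -> exists g : {linear P -> M}, forall x, p (g x) = f x.

Definition is_injective (E : lmodType A) : Prop :=
  forall (M N : lmodType A) (i : {linear M -> N}) (f : {linear M -> E}),
    injective i -> exists g : {linear N -> E}, forall x, g (i x) = f x.

Definition is_flat (Y : lmodType A) : Prop :=
  forall (E E' : lmodType A^c) (i : {linear E -> E'}),
    injective i -> injective (tensor_map i (@idfun Y)).

Definition fin_generated (M : lmodType A) : Prop :=
  exists n (g : {linear 'rV[A]_n -> M}), is_surj g.

Definition fin_presented (M : lmodType A) : Prop :=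
  exists m n (f : {linear 'rV[A]_m -> 'rV[A]_n}) (g : {linear 'rV[A]_n -> M}),
    exact_at f g /\ is_surj g.

End ModuleNotions.

Definition left_coherent (A : pzRingType) : Prop :=
  forall J : submodClosed A^o,
    fin_generated (submod J) -> fin_presented (submod J).

Definition right_coherent (A : pzRingType) : Prop := left_coherent A^c.

Record complex (A : pzRingType) := Complex {
  cobj :> int -> lmodType A;
  cdiff : forall n, {linear cobj n -> cobj (n + 1)};
  cdiffK : forall n x, cdiff (n + 1) (cdiff n x) = 0
}.

Section GorensteinClasses.
Variable A : pzRingType.

Definition cocycle (Y : complex A) (n : int) : lmodType A := kermod (cdiff Y n).

(* Exactness in degree n + 1, for every n : int. *)
Definition acyclic (Y : complex A) : Prop :=
  forall n, exact_at (cdiff Y n) (cdiff Y (n + 1)).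

Definition hom_acyclic (Y : complex A) (Q : lmodType A) : Prop :=
  forall n (h : {linear Y (n + 1) -> Q}),
    (forall x, h (cdiff Y n x) = 0) <->
    exists k : {linear Y (n + 1 + 1) -> Q},
      forall x, k (cdiff Y (n + 1) x) = h x.

Definition tensor_acyclic (E : lmodType A^c) (Y : complex A) : Prop :=
  forall n, exact_at (tensor_map (@idfun E) (cdiff Y n))
                     (tensor_map (@idfun E) (cdiff Y (n + 1))).

Definition totally_acyclic (P : complex A) : Prop :=
  (forall n, is_projective (P n)) /\ acyclic P /\
  forall Q : lmodType A, is_projective Q -> hom_acyclic P Q.

(* Termwise flatness is required separately: by is_flat in GF, and through
   projectivity in PGF. *)
Definition F_totally_acyclic (Y : complex A) : Prop :=
  acyclic Y /\
  forall E : lmodType A^c, is_injective E -> tensor_acyclic E Y.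

Definition GP (M : lmodType A) : Prop :=
  exists (P : complex A) (n : int),
    totally_acyclic P /\ iso_mod M (cocycle P n).

Definition GF (M : lmodType A) : Prop :=
  exists (Y : complex A) (n : int),
    (forall n, is_flat (Y n)) /\ F_totally_acyclic Y /\
    iso_mod M (cocycle Y n).

Definition PGF (M : lmodType A) : Prop :=
  exists (P : complex A) (n : int),
    (forall n, is_projective (P n)) /\ F_totally_acyclic P /\
    iso_mod M (cocycle P n).

Definition strongly_GP (G : lmodType A) : Prop :=
  exists (P : lmodType A) (i : {linear G -> P}) (p : {linear P -> G}),
    is_projective P /\ injective i /\ exact_at i p /\ is_surj p /\
    forall Q : lmodType A, is_projective Q ->
      (forall h h' : {linear G -> Q},
         (forall x, h (p x) = h' (p x)) -> h =1 h') /\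
      (forall h : {linear P -> Q}, (forall x, h (i x) = 0) <->
         exists k : {linear G -> Q}, forall x, k (p x) = h x) /\
      (forall h : {linear G -> Q}, exists k : {linear P -> Q},
         forall x, k (i x) = h x).

End GorensteinClasses.

Section TriangularRing.
Variables (A C : pzRingType) (M : bimod C A).

(* (a, m, c) is the lower triangular matrix with diagonal entries a, c and
   lower left entry m. *)
Definition tri : Type := (A * M * C)%type.
HB.instance Definition _ := GRing.Zmodule.on tri.

Definition tri1 : tri := (1, 0, 1).
Definition tri_mul (s t : tri) : tri :=
  let: (a, m, c) := s in let: (a', m', c') := t in
  (a * a', ract m a' + lact c m', c * c').

Let lact0 c : lact c (0 : M) = 0.
Proof. by apply: (addrI (lact c 0)); rewrite -lactDr !addr0. Qed.
Let ract0 a : ract (0 : M) a = 0.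
Proof. by apply: (addrI (ract 0 a)); rewrite -ractDl !addr0. Qed.

Let mulA : associative tri_mul.
Proof.
move=> [[a m] c] [[a' m'] c'] [[a'' m''] c''] /=; rewrite !mulrA.
by rewrite ractDl lactDr ractA lactA lractA addrA.
Qed.
Let mul1 : left_id tri1 tri_mul.
Proof. by move=> [[a m] c] /=; rewrite !mul1r lact1 ract0 add0r. Qed.
Let mulr1' : right_id tri1 tri_mul.
Proof. by move=> [[a m] c] /=; rewrite !mulr1 ract1 lact0 addr0. Qed.
Let mulDl : left_distributive tri_mul +%R.
Proof.
move=> [[a m] c] [[a' m'] c'] [[a'' m''] c'']; congr (_, _, _) => /=.
- exact: mulrDl.
- by rewrite ractDl lactDl addrACA.
- exact: mulrDl.
Qed.
Let mulDr : right_distributive tri_mul +%R.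
Proof.
move=> [[a m] c] [[a' m'] c'] [[a'' m''] c'']; congr (_, _, _) => /=.
- exact: mulrDr.
- by rewrite ractDr lactDr addrACA.
- exact: mulrDr.
Qed.
HB.instance Definition _ := GRing.Zmodule_isPzRing.Build tri
  mulA mul1 mulr1' mulDl mulDr.

(* The idempotent e_B. *)
Definition tri_e : tri := (0, 0, 1).

(* The identification of B with e_B T e_B. *)
Definition tri_inc (c : C) : tri := (0, 0, c).

Lemma tri_incM c d : tri_inc (c * d) = tri_inc c * tri_inc d.
Proof. by congr (_, _, _); rewrite ?mulr0 //= ract0 lact0 addr0. Qed.
Lemma tri_incD c d : tri_inc (c + d) = tri_inc c + tri_inc d.
Proof. by congr (_, _, _); rewrite addr0. Qed.

Definition tri_Te_pred : {pred tri^o} :=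
  [pred t | `[< exists s : tri, t = s * tri_e >]].

Lemma tri_Te_predP t : reflect (exists s, t = s * tri_e) (t \in tri_Te_pred).
Proof. exact: asboolP. Qed.

Lemma tri_Te_pred_closed : subsemimod_closed tri_Te_pred.
Proof.
split; [split=> [|x y] | move=> a x].
- by apply/tri_Te_predP; exists 0; rewrite mul0r.
- move=> /tri_Te_predP[s ->] /tri_Te_predP[t ->].
  by apply/tri_Te_predP; exists (s + t); rewrite mulrDl.
- move=> /tri_Te_predP[s ->].
  by apply/tri_Te_predP; exists (a * s); rewrite -mulrA.
Qed.
HB.instance Definition _ :=
  GRing.isSubmodClosed.Build tri tri^o tri_Te_pred tri_Te_pred_closed.

Definition tri_Te : lmodType tri := submod tri_Te_pred.

Let Te_ract_subproof (x : tri_Te) (c : C) :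
  (val x : tri) * tri_inc c \in tri_Te_pred.
Proof.
apply/tri_Te_predP; exists (val x * tri_inc c).
by rewrite -mulrA -tri_incM mulr1.
Qed.
Definition tri_Te_ract (x : tri_Te) (c : C) : tri_Te :=
  Submod (Te_ract_subproof x c).

End TriangularRing.

Section TriangularBimodule.
Variables (A C : pzRingType) (M : bimod C A).
Local Notation T := (tri M).

Let Te_eq (x y : tri_Te M) : (val x : T) = val y -> x = y.
Proof. exact: val_inj. Qed.

Let ractA' (x : tri_Te M) c d :
  tri_Te_ract (tri_Te_ract x c) d = tri_Te_ract x (c * d).
Proof. by apply: Te_eq; rewrite /= tri_incM mulrA. Qed.
Let ract1' (x : tri_Te M) : tri_Te_ract x 1 = x.
Proof.
apply: Te_eq => /=; have /tri_Te_predP[s ->] := valP x.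
by rewrite -mulrA -tri_incM mulr1.
Qed.
Let ractDl' c (x y : tri_Te M) :
  tri_Te_ract (x + y) c = tri_Te_ract x c + tri_Te_ract y c.
Proof. by apply: Te_eq; rewrite /= mulrDl. Qed.
Let ractDr' (x : tri_Te M) c d :
  tri_Te_ract x (c + d) = tri_Te_ract x c + tri_Te_ract x d.
Proof. by apply: Te_eq; rewrite /= tri_incD mulrDr. Qed.
Let lractA' (t : T) (x : tri_Te M) c :
  t *: tri_Te_ract x c = tri_Te_ract (t *: x) c.
Proof. by apply: Te_eq; rewrite /= -mulrA. Qed.

(* T e_B as a (T, B)-bimodule, B acting through its identification with
   e_B T e_B. *)
Definition tri_Te_bimod : bimod T C :=
  @Bimod T C (tri_Te M) *:%R (@tri_Te_ract _ _ M)
    (@scalerA _ _) (@scale1r _ _) (@scalerDr _ _) (@scalerDl _ _)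
    ractA' ract1' ractDl' ractDr' lractA'.

End TriangularBimodule.

Section DualNumbers.
Variable R : comNzRingType.

Definition dual : comNzRingType := {poly %/ ('X^2 : {poly R})}.

Definition eps : dual := 'qX : {poly %/ ('X^2 : {poly R})}.

Definition dual_const (r : R) : dual := qpolyC ('X^2 : {poly R}) r.

(* The ring morphism B -> R sending eps to 0. *)
Definition dual_aug (b : dual) : R := (b : {poly %/ ('X^2 : {poly R})})`_0.

End DualNumbers.

Section DualNumbersTheory.
Variable R : comNzRingType.
Local Notation B := (dual R).
Local Notation BX := {poly %/ ('X^2 : {poly R})}.

Lemma eps2 : eps R * eps R = 0.
Proof.
rewrite /eps /qpolyX -in_qpolyM -expr2; apply: val_inj => /=.
by rewrite mk_monic_Xn Pdiv.RingMonic.rmodpp // monicXn.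
Qed.

Lemma dual_aug_zmod_morphism : zmod_morphism (@dual_aug R).
Proof. by move=> b c; exact: (coefB (b : BX) (c : BX) 0). Qed.

Lemma dual_aug_monoid_morphism : monoid_morphism (@dual_aug R).
Proof.
split; first exact: coef1.
move=> b c; rewrite /dual_aug.
have := poly_of_qpolyM (b : BX) (c : BX); rewrite {}[b * c]/((b : BX) * (c : BX)).
move: (polyn _) (polyn _) (polyn _) => p q r.
rewrite mk_monic_Xn => ->; rewrite -coef0M.
rewrite [in RHS](Pdiv.RingMonic.rdivp_eq (monicXn R 2) (_ * _)).
by rewrite coefD coefMXn /= add0r.
Qed.

HB.instance Definition _ :=
  GRing.isZmodMorphism.Build B R (@dual_aug R) dual_aug_zmod_morphism.
HB.instance Definition _ :=
  GRing.isMonoidMorphism.Build B R (@dual_aug R) dual_aug_monoid_morphism.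

HB.instance Definition _ := GRing.isZmodMorphism.Build R B (@dual_const R)
  (qpolyC_is_zmod_morphism ('X^2 : {poly R})).
HB.instance Definition _ := GRing.isMonoidMorphism.Build R B (@dual_const R)
  (qpolyC_is_monoid_morphism ('X^2 : {poly R})).

Let lscaleDl (x b c : B) : (b + c) * x = b * x + c * x.
Proof. exact: mulrDl. Qed.
Let rscaleA (x : B) a b :
  x * dual_const a * dual_const b = x * dual_const (a * b).
Proof. by rewrite rmorphM mulrA. Qed.
Let rscale1 (x : B) : x * dual_const 1 = x.
Proof. by rewrite rmorph1 mulr1. Qed.
Let rscaleDl a (x y : B) :
  (x + y) * dual_const a = x * dual_const a + y * dual_const a.
Proof. exact: mulrDl. Qed.
Let rscaleDr (x : B) a b :
  x * dual_const (a + b) = x * dual_const a + x * dual_const b.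
Proof. by rewrite rmorphD mulrDr. Qed.

(* B as a (B, R)-bimodule. *)
Definition dual_bimod : bimod B R :=
  @Bimod B R B *%R (fun b r => b * dual_const r)
    (@mulrA B) (@mul1r B) (@mulrDr B) lscaleDl
    rscaleA rscale1 rscaleDl rscaleDr (fun b x r => @mulrA B b x (dual_const r)).

Let alactA b c (x : R) : dual_aug b * (dual_aug c * x) = dual_aug (b * c) * x.
Proof. by rewrite rmorphM mulrA. Qed.
Let alact1 (x : R) : dual_aug 1 * x = x.
Proof. by rewrite rmorph1 mul1r. Qed.
Let alactDl (x : R) b c :
  dual_aug (b + c) * x = dual_aug b * x + dual_aug c * x.
Proof. by rewrite rmorphD mulrDl. Qed.

(* R as a (B, R)-bimodule, B acting through the augmentation. *)
Definition aug_bimod : bimod B R :=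
  @Bimod B R R (fun b x => dual_aug b * x) *%R
    alactA alact1 (fun b => @mulrDr R (dual_aug b)) alactDl
    (fun x a b => esym (mulrA x a b)) (@mulr1 R) (fun a x y => mulrDl x y a)
    (@mulrDr R) (fun b x r => mulrA (dual_aug b) x r).

Definition mul_eps (b : rmod_of_bimod dual_bimod) : rmod_of_bimod dual_bimod :=
  (b : B) * eps R.

Let mul_eps_linear : linear mul_eps.
Proof.
move=> a x y; rewrite /mul_eps [(a *: x + y : B) * _]mulrDl; congr (_ + _).
by rewrite [a *: x]/((x : B) * @dual_const R a) mulrAC.
Qed.
HB.instance Definition _ := GRing.isLinear.Build R^c
  (rmod_of_bimod dual_bimod) (rmod_of_bimod dual_bimod) _ mul_eps mul_eps_linear.

Lemma mul_eps_lact (b x : B) :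
  mul_eps (lact b (x : dual_bimod)) = lact b (mul_eps x : dual_bimod).
Proof. by rewrite /mul_eps /= mulrA. Qed.

End DualNumbersTheory.

Section SetTheory.
Local Open Scope classical_set_scope.
Local Open Scope card_scope.

Definition card_lt (S T : Type) (a : set S) (b : set T) : Prop := ~~ (b #<= a).

Definition Pk (X Y : Type) : Type := {a : set Y | card_lt a [set: X]}.

(* X is a set of cardinality kappa. *)
Definition kappa_complete (X T : Type) (F : set_system T) : Prop :=
  forall G : set (set T), G `<=` F -> card_lt G [set: X] ->
    F (\bigcap_(a in G) a).

Definition aleph1_complete (T : Type) (F : set_system T) : Prop :=
  forall G : set (set T), G `<=` F -> countable G -> F (\bigcap_(a in G) a).

Definition nonprincipal (T : Type) (F : set_system T) : Prop :=
  forall x : T, F <> principal_filter x.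

Definition fine_filter (X Y : Type) (F : set_system (Pk X Y)) : Prop :=
  forall y : Y, F [set a : Pk X Y | sval a y].

Definition LUH1 (X : Type) : Prop :=
  ~ countable [set: X] /\
  exists U : set_system X,
    UltraFilter U /\ nonprincipal U /\ kappa_complete X U.

(* The power set [set X] has cardinality 2^kappa. *)
Definition LUH2 (X : Type) : Prop :=
  exists V : set_system (Pk X (set X)),
    UltraFilter V /\ aleph1_complete V /\ fine_filter V.

Definition LUH (X : Type) : Prop := LUH1 X /\ LUH2 X.

End SetTheory.

Record free_resolution (A : pzRingType) (S : lmodType A) := FreeResolution {
  (* [res_obj k] is F^{-k} *)
  res_obj :> nat -> lmodType A;
  res_free : forall k, is_free (res_obj k);
  res_d : forall k, {linear res_obj k.+1 -> res_obj k};
  res_aug : {linear res_obj 0%N -> S};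
  res_aug_surj : is_surj res_aug;
  res_exact0 : exact_at (res_d 0) res_aug;
  res_exactS : forall k, exact_at (res_d k.+1) (res_d k)
}.

Section Construction.
Variable X : pointedType.

Definition ringR : comNzRingType := (X -> 'F_2)%type.
Definition ringB : comNzRingType := dual ringR.
Definition ringT : pzRingType := tri (aug_bimod ringR).

Variables (U : set_system X) (hU : UltraFilter U).

Definition idealI : set_system X := (~` U)%classic.

Definition m_pred : {pred ringR^o} :=
  [pred r : ringR | `[< idealI [set x | r x != 0]%classic >]].

Lemma m_predP (r : ringR) :
  reflect (idealI [set x | r x != 0]%classic) (r \in m_pred).
Proof. exact: asboolP. Qed.

Lemma idealI_setC (a : set X) : idealI a <-> U (~` a)%classic.
Proof.
split=> [|UCa Ua]; first by have [] := in_ultra_setVsetC a hU.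
have : U (a `&` ~` a)%classic by exact: filterI.
by rewrite setICr; exact: filter_not_empty.
Qed.

Lemma idealIS (a b : set X) : (a `<=` b)%classic -> idealI b -> idealI a.
Proof. by move=> ab nUb Ua; apply: nUb; exact: filterS Ua. Qed.

Lemma m_pred_closed : subsemimod_closed m_pred.
Proof.
split; [split=> [|r s] | move=> a r].
- apply/m_predP/idealI_setC.
  by apply: filterS filterT => x _ /negP; apply; apply/eqP.
- move=> /m_predP/idealI_setC Ur /m_predP/idealI_setC Us.
  apply/m_predP/idealI_setC; apply: filterS (filterI Ur Us) => x.
  move=> [/negP/negbNE/eqP rx /negP/negbNE/eqP sx] /negP; apply; apply/eqP.
  by rewrite [LHS]/(r x + s x) rx sx; exact: addr0.
- move=> /m_predP Ir; apply/m_predP; apply: idealIS Ir => x /=.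
  move=> /negP ax; apply/negP => /eqP rx; apply: ax; apply/eqP.
  by rewrite [LHS]/(a x * r x) rx; exact: mulr0.
Qed.

Definition ideal_m : submodClosed ringR^o :=
  HB.pack m_pred (GRing.isSubmodClosed.Build ringR ringR^o m_pred m_pred_closed).

Definition modS : lmodType ringR := quotmod ideal_m.

Variable F : free_resolution modS.

Definition Fsum : lmodType ringR := dsum F.

Let partial_finite (x : Fsum) :
  finite_set [set k | res_d F k (x k.+1) != 0]%classic.
Proof.
apply: (@sub_finite_set _ _ (predn @` [set k | x k != 0])%classic).
  move=> k /= dx0; exists k.+1 => //=; apply: contraNneq dx0 => ->.
  by rewrite raddf0.
exact/finite_image/dsum_finite.
Qed.

(* In nonpositive degree -k, the component of partial x is d(x_(-k-1)). *)
Definition partial (x : Fsum) : Fsum := Dsum (partial_finite x).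

Let partial_linear : linear partial.
Proof. by move=> a x y; apply: dsumP => k /=; rewrite linearP. Qed.
HB.instance Definition _ :=
  GRing.isLinear.Build ringR Fsum Fsum _ partial partial_linear.

Lemma partialK x : partial (partial x) = 0.
Proof. by apply: dsumP => k /=; apply/res_exactS; exists (x k.+2). Qed.

Definition FB_obj : lmodType ringB := bitensor (dual_bimod ringR) Fsum.

Definition Delta : {linear FB_obj -> FB_obj} :=
  (bitensor_lin (f := @mul_eps ringR) (@idfun Fsum) (@mul_eps_lact ringR)
   \+ bitensor_lin (f := @idfun (rmod_of_bimod (dual_bimod ringR))) partial
        (fun _ _ => erefl))%R.

Lemma DeltaE (b : ringB) (x : Fsum) :
  Delta (bitens (b : dual_bimod ringR) x) =
  bitens (b * eps ringR : dual_bimod ringR) x +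
  bitens (b : dual_bimod ringR) (partial x).
Proof. by rewrite /Delta /= !bitensor_mapE. Qed.

Lemma ringB_char2 : 1 + 1 = 0 :> ringB.
Proof.
have R2 : 1 + 1 = 0 :> ringR by apply: funext => x; apply/val_inj.
by rewrite -(rmorph1 (@dual_const ringR)) -rmorphD R2 rmorph0.
Qed.

Lemma DeltaK t : Delta (Delta t) = 0.
Proof.
elim/bitens_ind: t => [t u IHt IHu|b x]; first by rewrite !linearB IHt IHu subrr.
rewrite DeltaE linearD !DeltaE partialK bitens0r addr0 -mulrA eps2 mulr0.
rewrite bitens0l add0r -bitensDl.
have -> : b * eps ringR + b * eps ringR = 0 :> ringB.
  by rewrite -mulrDr -[eps _]mulr1 -mulrDr ringB_char2 !mulr0.
exact: bitens0l.
Qed.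

Definition FB : complex ringB :=
  @Complex ringB (fun _ => FB_obj) (fun _ => Delta) (fun _ => DeltaK).

Definition Te_bimod : bimod ringT ringB := tri_Te_bimod (aug_bimod ringR).

Definition FT_obj (n : int) : lmodType ringT := bitensor Te_bimod (FB n).

Definition FT_diff (n : int) : {linear FT_obj n -> FT_obj (n + 1)} :=
  bitensor_lin (f := @idfun (rmod_of_bimod Te_bimod)) (cdiff FB n)
    (fun _ _ => erefl).

Lemma FT_diffK n t : FT_diff (n + 1) (FT_diff n t) = 0.
Proof.
elim/bitens_ind: t => [t u IHt IHu|x y]; first by rewrite !linearB IHt IHu subrr.
by rewrite !bitensor_linE cdiffK bitens0r.
Qed.

Definition FT : complex ringT := Complex FT_diffK.

Definition modG : lmodType ringT := cocycle FT 2.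

End Construction.

(* Main.v *)
Require Import Defs.
From HB Require Import structures.
From mathcomp Require Import all_boot all_algebra.
From mathcomp Require Import boolp classical_sets functions cardinality filter.
From mathcomp Require Import qpoly.

(** Why the theorem holds.

    Let J be the ideal of T generated by the matrix unit m (lower left entry)
    and by eps (lower right entry).  Then J^2 = 0 and T/J = R x R.

    Coherence.  T is the ring of all functions on X with values in one ring
    with 16 elements.  A finite tuple of elements of T therefore takes finitely
    many values, and its syzygies are glued from finitely many pointwise ones
    ([fibred_left_coherent]); the same holds for the opposite ring.

    G is strongly Gorenstein projective.  F_T consists of one projective module
    with one endomorphism Delta, exact at every place ([FT_Delta_exact]), so
    only the exactness of Hom(F_T, Q) for Q projective is in question.  If N is
    a U-null subset of X, then its indicator kills S, so it acts on the
    resolution by a null-homotopic map, and hence on F_T: there is s_N with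
    Delta s_N + s_N Delta = 1_N.  For h with h Delta = 0 this gives
    1_N h = (h s_N) Delta.  The second half of LUH provides an aleph_1-complete
    ultrafilter W on a set of U-null sets N such that each point of X lies in
    W-almost all N ([null_cover]).  Maps to a free T-module have W-limits: the
    fibres of T are finite, so limits exist pointwise, and supports stay finite
    because W is aleph_1-complete ([free_lim_ex]).  The limit k of the maps
    h s_N satisfies k Delta = lim 1_N h = h ([FT_Delta_hom_free]).

    G is not Gorenstein flat.  The right T-module E = (R, R) is injective, as R
    is a power of F_2, and E (x) Y = e_B Y / eps e_B Y.  Exactness of E (x) Y
    for an acyclic complex Y of flat modules forces every element of a cocycle
    module M that is killed by eps to lie in J M, up to its component in e_A M
    ([cocycle_eps_exact]).  But e_B G = G, m G = 0, and on G the quotient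
    ker eps / im eps is the homology of the complex F, which is S and is not
    zero ([modG_not_eps_exact]).

    PGF(T) is contained in GP(T).  Let P be an F-totally acyclic complex of
    projectives over T.  Tensoring with E shows that P/JP is an acyclic complex
    of projectives over R x R, the ring of all functions from X + X to F_2
    ([bar_acyclic]).  Over such a ring Hom(V, Q) is exact for every acyclic
    complex V of projectives and every module Q ([complex_hom_exact]): a
    countably generated submodule of a free module is projective
    ([countable_splitting]), V is a union of subcomplexes with countably
    generated quotients, and the countable steps are glued by Zorn's lemma
    ([solution_ex]).  As J^2 = 0, exactness of Hom(P, Q) for Q killed by J
    implies it for all Q ([radical_hom_exact]). *)

Set Implicit Arguments.
Unset Strict Implicit.
Unset Printing Implicit Defensive.

Import GRing.Theory.
Local Open Scope ring_scope.

(** * Linear maps, direct sums and projective modules *)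

Section LinearMaps.
Variable A : pzRingType.

Definition mklin (M N : lmodType A) (f : M -> N) (Hf : linear f) :
  {linear M -> N} := HB.pack f (GRing.isLinear.Build A M N *:%R f Hf).

Lemma lin_factor (M N Q : lmodType A) (p : {linear M -> N})
    (h : {linear M -> Q}) :
  is_surj p -> (forall x, p x = 0 -> h x = 0) ->
  exists k : {linear N -> Q}, forall x, k (p x) = h x.
Proof.
move=> /choice[g pg] ph.
have hg x : h (g (p x)) = h x.
  apply/eqP; rewrite -subr_eq0 -raddfB; apply/eqP/ph.
  by rewrite raddfB /= pg subrr.
have kl : linear (h \o g).
  move=> a u v /=; rewrite -[in LHS](pg u) -[in LHS](pg v) -linearP hg.
  by rewrite linearP.
by exists (mklin kl).
Qed.

Variables (M : lmodType A) (N : submodClosed M).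

Lemma quotmod_pi_linear : linear (@quotmod_pi A M N).
Proof. by move=> a x y; rewrite quotmod_piD -quotmod_scale_pi. Qed.

Definition pi_lin : {linear M -> quotmod N} := mklin quotmod_pi_linear.

Lemma pi_lin_surj : is_surj pi_lin.
Proof. by move=> y; exists (repr (y : Quotient.quot (submod_pred N))); exact: quotmod_piK. Qed.

Lemma pi_lin_eq0 x : pi_lin x = 0 <-> x \in N.
Proof.
rewrite -(raddf0 pi_lin); rewrite /= quotmod_piP subr0; exact: iff_refl.
Qed.

Lemma submod_val_linear : linear (@submod_val A M N).
Proof. by []. Qed.

Definition sub_lin : {linear submod N -> M} := mklin submod_val_linear.

Lemma sub_lift (L : lmodType A) (f : {linear L -> M}) :
  (forall x, f x \in N) -> exists g : {linear L -> submod N}, forall x, val (g x) = f x.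
Proof.
move=> fN.
have gl : linear (fun x => Submod (fN x) : submod N).
  by move=> a x y; apply: val_inj; rewrite /= linearP.
by exists (mklin gl).
Qed.

End LinearMaps.

Section RestrictScalars.
Variables (A A' : pzRingType) (f : {rmorphism A -> A'}) (M : lmodType A').

(** The morphism is an argument of the type, so that the scaling of a
    restricted module can be read off from its type. *)
Definition resmod of {rmorphism A -> A'} : Type := M.
HB.instance Definition _ := GRing.Zmodule.on (resmod f).

Definition res_scale (a : A) (x : resmod f) : resmod f := f a *: (x : M).

Let res_scaleA a b x : res_scale a (res_scale b x) = res_scale (a * b) x.
Proof. by rewrite /res_scale scalerA rmorphM. Qed.
Let res_scale1 : left_id 1 res_scale.
Proof. by move=> x; rewrite /res_scale rmorph1 scale1r. Qed.
Let res_scaleDr : right_distributive res_scale +%R.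
Proof. by move=> a x y; exact: scalerDr. Qed.
Let res_scaleDl x : {morph res_scale^~ x : a b / a + b}.
Proof. by move=> a b; rewrite /res_scale rmorphD scalerDl. Qed.
HB.instance Definition _ := GRing.Zmodule_isLmodule.Build A (resmod f)
  res_scaleA res_scale1 res_scaleDr res_scaleDl.

Lemma resZ (a : A) (x : resmod f) : a *: x = f a *: (x : M) :> M.
Proof. by []. Qed.

End RestrictScalars.

Section DirectSums.
Variables (A : pzRingType) (I : choiceType) (F : I -> lmodType A).
Local Notation D := (dsum F).

Lemma dsumDE (x y : D) i : (x + y) i = x i + y i. Proof. by []. Qed.
Lemma dsumZE a (x : D) i : (a *: x) i = a *: x i. Proof. by []. Qed.
Lemma dsum0E i : (0 : D) i = 0. Proof. by []. Qed.
Lemma dsum_proj_linear i : linear (fun x : D => x i). Proof. by []. Qed.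
Definition dsum_proj i : {linear D -> F i} := mklin (dsum_proj_linear i).

Let in_fin i (a : F i) :
  finite_set [set j | dfwith (fun j => 0 : F j) a j != 0]%classic.
Proof.
apply: (@sub_finite_set _ _ [set i]%classic); last exact: finite_set1.
move=> j /=; have [<-//|ij] := eqVneq i j.
by rewrite dfwith_out // eqxx.
Qed.

Definition dsum_in_fun i (a : F i) : D := Dsum (in_fin a).

Lemma dsum_in_linear i : linear (@dsum_in_fun i).
Proof.
move=> a x y; apply: dsumP => j; rewrite dsumDE dsumZE /=.
have [<-|ij] := eqVneq i j; first by rewrite !dfwith_in.
by rewrite !dfwith_out // scaler0 addr0.
Qed.
Definition dsum_in i : {linear F i -> D} := mklin (@dsum_in_linear i).

Lemma dsum_in_in i (a : F i) : dsum_in i a i = a.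
Proof. exact: dfwith_in. Qed.

Lemma dsum_in_out i j (a : F i) : i != j -> dsum_in i a j = 0.
Proof. exact: dfwith_out. Qed.

Lemma dsum_sumE (s : seq I) (G : I -> D) i :
  (\sum_(j <- s) G j) i = \sum_(j <- s) G j i.
Proof. exact: (raddf_sum (dsum_proj i)). Qed.

Lemma dsum_sum_supp (s : seq I) (x : D) :
  uniq s -> (forall i, x i != 0 -> i \in s) -> x = \sum_(i <- s) dsum_in i (x i).
Proof.
move=> us xs; apply: dsumP => i; rewrite dsum_sumE.
have [si|si] := boolP (i \in s).
  rewrite (bigD1_seq i) //= dfwith_in big1_seq ?addr0 // => j /andP[ji _].
  exact: dsum_in_out.
rewrite big1_seq; first by apply/eqP; apply: contraNT si => /xs.
move=> j /andP[_ sj]; apply: dsum_in_out.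
by apply: contraNneq si => <-.
Qed.

Lemma dsum_supp (x : D) : exists2 s : seq I, uniq s &
  forall i, (x i != 0) = (i \in s).
Proof.
have /finite_seqP[s es] := dsum_finite x.
exists (undup s); first exact: undup_uniq.
move=> i; rewrite mem_undup; apply/idP/idP.
  by move=> xi; have : [set i | x i != 0]%classic i by []; rewrite es.
by move=> si; have : [set` s]%classic i by []; rewrite -es.
Qed.

Lemma dsum_ind (P : D -> Prop) : P 0 -> (forall x y, P x -> P y -> P (x + y)) ->
  (forall i (a : F i), P (dsum_in i a)) -> forall x, P x.
Proof.
move=> P0 PD Pin x; have [s us xs] := dsum_supp x.
have -> : x = \sum_(i <- s) dsum_in i (x i).
  by apply: dsum_sum_supp => // i; rewrite xs.
by apply: (big_ind P).
Qed.

Lemma dsum_ext (M : lmodType A) (f g : {linear D -> M}) :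
  (forall i a, f (dsum_in i a) = g (dsum_in i a)) -> f =1 g.
Proof.
move=> fg; apply: dsum_ind => [|x y fx fy|//]; first by rewrite !linear0.
by rewrite !linearD fx fy.
Qed.

Lemma dsum_lift_ex (M : lmodType A) (g : forall i, {linear F i -> M}) :
  exists h : {linear D -> M}, forall i a, h (dsum_in i a) = g i a.
Proof.
have /choice[supp H] : forall x : D, exists s : seq I,
    uniq s /\ forall i, (x i != 0) = (i \in s).
  by move=> x; have [s] := dsum_supp x; exists s.
have supp_uniq x : uniq (supp x) by case: (H x).
have suppP (x : D) i : (x i != 0) = (i \in supp x) by case: (H x).
pose h (x : D) := \sum_(i <- supp x) g i (x i).
have hE (s : seq I) x : uniq s -> {subset supp x <= s} -> h x = \sum_(i <- s) g i (x i).
  move=> us xs; rewrite /h.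
  have -> : \sum_(i <- s) g i (x i) = \sum_(i <- s | i \in supp x) g i (x i).
    rewrite [LHS](bigID (mem (supp x))) /= [X in _ + X]big1 ?addr0 //.
    by move=> i; rewrite -suppP negbK => /eqP ->; rewrite raddf0.
  rewrite -[RHS]big_filter; apply: perm_big; apply: uniq_perm => //.
    exact: filter_uniq.
  by move=> i; rewrite mem_filter andb_idr // => /xs.
have hl : linear h.
  move=> a x y; pose s := undup (supp x ++ supp y ++ supp (a *: x + y)).
  have us : uniq s by exact: undup_uniq.
  rewrite !(hE s) // => [|i|i|i]; try by rewrite mem_undup !mem_cat => ->; rewrite ?orbT.
  rewrite scaler_sumr -big_split; apply: eq_bigr => i _ /=.
  by rewrite linearP.
exists (mklin hl) => i a /=; rewrite (hE [:: i]) //.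
  by rewrite big_seq1 dsum_in_in.
move=> j; rewrite -suppP inE; apply: contraNT => ji.
by rewrite dsum_in_out // eq_sym.
Qed.

Definition dsum_lift (M : lmodType A) (g : forall i, {linear F i -> M}) :=
  projT1 (cid (dsum_lift_ex g)).

Lemma dsum_lift_in (M : lmodType A) (g : forall i, {linear F i -> M}) i a :
  dsum_lift g (dsum_in i a) = g i a.
Proof. exact: (projT2 (cid (dsum_lift_ex g))). Qed.

Lemma dsum_projective : (forall i, is_projective (F i)) -> is_projective D.
Proof.
move=> projF M N p f ps.
have H i : exists g : {linear F i -> M}, forall a, p (g a) = f (dsum_in i a).
  by have [g] := projF i M N p (f \o dsum_in i) ps; exists g.
pose g i := projT1 (cid (H i)).
exists (dsum_lift g); apply: (@dsum_ext _ (p \o dsum_lift g) f) => i a /=.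
by rewrite dsum_lift_in /g; case: cid.
Qed.

End DirectSums.

Section FreeModules.
Variables (A : pzRingType).

Lemma scale_lin_linear (M : lmodType A) (m : M) : linear (fun a : A^o => (a : A) *: m).
Proof. by move=> a x y; rewrite scalerDl scalerA. Qed.
Definition scale_lin (M : lmodType A) (m : M) : {linear A^o -> M} :=
  mklin (scale_lin_linear m).

Lemma regular_projective : is_projective (A^o : lmodType A).
Proof.
move=> M N p f ps; have [m pm] := ps (f 1).
exists (scale_lin m) => x; rewrite /= linearZ /= pm -linearZ.
by congr (f _); exact: mulr1.
Qed.

Definition frm (L : choiceType) : lmodType A := dsum (fun _ : L => A^o : lmodType A).

Section Basis.
Variable L : choiceType.

Definition fvec (l : L) : frm L := dsum_in (fun _ : L => A^o : lmodType A) l (1 : A).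

Lemma dsum_in_fvec (l : L) (a : A) :
  dsum_in (fun _ : L => A^o : lmodType A) l a = a *: fvec l.
Proof. by rewrite /fvec -linearZ; congr (dsum_in _ _ _); rewrite [RHS]mulr1. Qed.

Definition fr_lift (M : lmodType A) (k : L -> M) : {linear frm L -> M} :=
  dsum_lift (fun l => scale_lin (k l)).

Lemma fr_lift_fvec (M : lmodType A) (k : L -> M) l : fr_lift k (fvec l) = k l.
Proof. by rewrite /fr_lift /fvec dsum_lift_in /= scale1r. Qed.

Lemma frm_ind (P : frm L -> Prop) : P 0 -> (forall x y, P x -> P y -> P (x + y)) ->
  (forall a l, P (a *: fvec l)) -> forall x, P x.
Proof. by move=> P0 PD Pb; apply: dsum_ind => // l a; rewrite dsum_in_fvec. Qed.

Lemma frm_ext (M : lmodType A) (f g : {linear frm L -> M}) :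
  (forall l, f (fvec l) = g (fvec l)) -> f =1 g.
Proof.
move=> fg; apply: frm_ind => [|x y fx fy|a l]; first by rewrite !linear0.
  by rewrite !linearD fx fy.
by rewrite !linearZ fg.
Qed.

Lemma fr_sum (s : seq L) (x : frm L) :
  uniq s -> (forall l, x l != 0 -> l \in s) -> x = \sum_(l <- s) (x l : A) *: fvec l.
Proof.
move=> us xs; rewrite [LHS](dsum_sum_supp us xs).
by apply: eq_bigr => l _; rewrite dsum_in_fvec.
Qed.

Lemma fvecE l m : fvec l m = if l == m then 1 else 0.
Proof.
by rewrite /fvec; case: eqVneq => [<-|?]; [rewrite dsum_in_in|rewrite dsum_in_out].
Qed.

Lemma frm_projective : is_projective (frm L).
Proof. by apply: dsum_projective => l; exact: regular_projective. Qed.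

End Basis.

Lemma projective_retract (P : lmodType A) : is_projective P ->
  exists (i : {linear P -> frm P}) (r : {linear frm P -> P}), forall x, r (i x) = x.
Proof.
move=> projP; pose r := fr_lift (@id P).
have rs : is_surj r by move=> x; exists (fvec x); rewrite fr_lift_fvec.
by have [i ri] := projP _ _ r idfun rs; exists i, r.
Qed.

Lemma iso_projective (P P' : lmodType A) (f : {linear P -> P'}) : bijective f ->
  is_projective P -> is_projective P'.
Proof.
move=> [g fg gf] projP M N p h ps.
have [k pk] := projP _ _ p (h \o f) ps.
have gl : linear g by move=> a x y; apply: (can_inj fg); rewrite linearP !gf.
by exists (k \o mklin gl) => x /=; rewrite pk /= gf.
Qed.

(** The members of a basis, as a subtype, index a free module isomorphic to M. *)
Lemma free_projective (M : lmodType A) : is_free M -> is_projective M.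
Proof.
move=> [b [gen ind]]; pose L := {u : M | `[< b u >]}.
pose f : {linear frm L -> M} := fr_lift (fun l : L => sval l).
apply: (iso_projective (f := f)) (@frm_projective L).
have f_inj0 z : f z = 0 -> z = 0.
  move=> fz.
  have [s us zs] := dsum_supp z.
  have ez : z = \sum_(l <- s) (z l : A) *: fvec l.
    by apply: fr_sum => // l; rewrite zs.
  pose c (u : M) : A := if insub u is Some l then z (l : L) else 0.
  have cE (l : L) : c (sval l) = z l.
    by rewrite /c -[sval l]/(val l) valK.
  apply: dsumP => l; rewrite dsum0E.
  have [sl|] := boolP (l \in s); last by rewrite -zs negbK => /eqP.
  rewrite -cE; apply: (ind (map sval s) c).
  - by rewrite map_inj_uniq //; exact: val_inj.
  - by move=> u /mapP[m _ ->]; apply/asboolP; exact: (valP m).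
  - rewrite big_map; apply: etrans fz; rewrite [in RHS]ez linear_sum.
    apply: eq_bigr => m _ /=.
    by rewrite cE linearZ /= fr_lift_fvec.
  - by apply/mapP; exists l.
have f_inj : injective f.
  move=> x y fxy; apply/eqP; rewrite -subr_eq0; apply/eqP/f_inj0.
  by rewrite linearB fxy subrr.
have f_surj (x : M) : exists y, f y == x.
  have [s [c [sb ->]]] := gen x.
  pose g u : frm L := if insub u is Some l then fvec (l : L) else 0.
  exists (\sum_(u <- s) c u *: g u); rewrite raddf_sum; apply/eqP.
  apply: eq_big_seq => u /sb bu /=; rewrite linearZ /=; congr (_ *: _).
  rewrite /g; case: insubP => [l _ <-|]; first by rewrite fr_lift_fvec.
  by move/negP; case; apply/asboolP.
pose g x := xchoose (f_surj x).
have fg : cancel g f by move=> x; exact/eqP/(xchooseP (f_surj x)).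
by exists g => //; move=> x; apply: f_inj; rewrite fg.
Qed.

End FreeModules.

(** * Rings fibred over a set: coherence and limits of maps to free modules *)

Lemma infinite_seq (T : Type) (A : set T) : infinite_set A ->
  exists j : nat -> T, injective j /\ forall i, A (j i).
Proof.
elim/Ppointed: T => T in A *; first by rewrite emptyE => /(_ (finite_set0 _)).
move=> /infiniteP/pcard_leP/unsquash f; exists f; split.
  by move=> x y; apply: (@inj _ _ _ f); rewrite in_setT.
by move=> i; exact: (@funS _ _ _ _ f i I).
Qed.

(** [d x] is the idempotent that cuts out the fibre of A over x; gluing and
    separation say that A is the full product of its fibres. *)
Record fibred (X : Type) (A : pzRingType) (d : X -> A) : Prop := Fibred {
  fib_C : forall x a, d x * a = a * d x;
  fib_id : forall x, d x * d x = d x;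
  fib_orth : forall x y, x <> y -> d x * d y = 0;
  fib_glue : forall t : X -> A, exists a, forall x, d x * a = d x * t x;
  fib_sep : forall a, (forall x, d x * a = 0) -> a = 0
}.

(** One finite list represents the elements of every fibre, so the bound on the
    fibres is uniform in x. *)
Definition finite_fibres (X : Type) (A : pzRingType) (d : X -> A) : Prop :=
  exists s : seq A, forall x a, exists2 c, c \in s & d x * a = d x * c.

Section Coherence.
Variables (X : Type) (A : pzRingType) (d : X -> A).
Hypotheses (dF : fibred d) (dfin : finite_fibres d).

Lemma fibred_row_glue n (t : X -> 'rV[A]_n) :
  exists a : 'rV[A]_n, forall x, d x *: a = d x *: t x.
Proof.
have /choice[a aP] i := fib_glue dF (fun x => t x 0 i).
exists (\row_i a i) => x; apply/rowP => i; rewrite !mxE; exact: aP.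
Qed.

Lemma fibred_row_sep n (a b : 'rV[A]_n) :
  (forall x, d x *: a = d x *: b) -> a = b.
Proof.
move=> ab; apply/rowP => i; apply/eqP; rewrite -subr_eq0; apply/eqP.
apply: (fib_sep dF) => x; rewrite mulrBr.
by have /rowP/(_ i) := ab x; rewrite !mxE => ->; rewrite subrr.
Qed.

(** Over each point of X a syzygy of the generators is one of the finitely many
    tuples [c v] with entries in the list of representatives.  The submodule of
    syzygies is generated by the tuples [kv v], which equal [c v] where that is a
    syzygy and vanish elsewhere. *)
Lemma fibred_left_coherent : left_coherent A.
Proof.
move=> J [n [g gs]]; have [s sP] := dfin.
pose V := {ffun 'I_n -> 'I_(size s)}.
pose c (v : V) : 'rV[A]_n := \row_i s`_(v i).
have cP (y : 'rV[A]_n) x : exists v : V, d x *: y = d x *: c v.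
  have /choice[k kP] i : exists k : 'I_(size s), d x * y 0 i = d x * s`_k.
    have [e es ->] := sP x (y 0 i).
    by rewrite -index_mem in es; exists (Ordinal es); rewrite nth_index // -index_mem.
  exists [ffun i => k i]; apply/rowP => i.
  by rewrite !mxE ffunE; exact: kP.
(* Over x, the tuple c v if it is a syzygy there. *)
pose t v x : 'rV[A]_n := if `[< d x *: g (c v) = 0 >] then c v else 0.
have /choice[kv kvP] v := fibred_row_glue (t v).
have gkv v : g (kv v) = 0.
  apply: val_inj; apply: (fib_sep dF) => x.
  suff e : d x *: g (kv v) = 0 by exact: (congr1 val e).
  rewrite -linearZ_LR kvP /t; case: asboolP => [h|_]; first by rewrite linearZ_LR.
  by rewrite scaler0 linear0.
have [w [fs w_inj]] : exists w : V -> 'I_#|V|, cancel w enum_val /\ cancel enum_val w.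
  by exists enum_rank; split; [exact: enum_rankK | exact: enum_valK].
pose f (y : 'rV[A]_#|V|) : 'rV[A]_n := \sum_j y 0 j *: kv (enum_val j).
have fl : linear f.
  move=> a y z; rewrite /f scaler_sumr -big_split; apply: eq_bigr => j _ /=.
  by rewrite !mxE scalerDl scalerA.
exists #|V|, n, (mklin fl), g; split=> // y; split; last first.
  by move=> [u <-]; rewrite /= /f linear_sum big1 // => j _; rewrite linearZ_LR gkv scaler0.
move=> gy; have /choice[v vP] := cP y.
(* b u is the indicator of the set of points where y agrees with c u. *)
have /choice[b bP] u := fib_glue dF (fun x => if v x == u then 1 else 0).
exists (\row_j b (enum_val j)); apply: fibred_row_sep => x.
rewrite /= /f scaler_sumr (bigD1 (w (v x))) //= big1 => [|j jw].
  rewrite mxE fs addr0 scalerA bP eqxx mulr1 kvP /t.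
  case: asboolP => [_|[]]; first by rewrite vP.
  by rewrite -linearZ_LR -vP linearZ_LR gy scaler0.
rewrite mxE scalerA bP; case: eqP => [e|]; last by rewrite mulr0 scale0r.
by rewrite e w_inj eqxx in jw.
Qed.

End Coherence.

Lemma fibred_op (X : Type) (A : pzRingType) (d : X -> A) :
  fibred d -> fibred (d : X -> A^c).
Proof.
move=> dF; split.
- by move=> x a; rewrite /GRing.mul /=; apply/esym/(fib_C dF).
- exact: (fib_id dF).
- by move=> x y xy; apply: (fib_orth dF) => /esym.
- move=> t; have [a aP] := fib_glue dF t; exists a => x.
  by have := aP x; rewrite !(fib_C dF).
- by move=> a ax; apply: (fib_sep dF) => x; rewrite (fib_C dF); exact: ax.
Qed.

Lemma finite_fibres_op (X : Type) (A : pzRingType) (d : X -> A) :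
  fibred d -> finite_fibres d -> finite_fibres (d : X -> A^c).
Proof.
move=> dF [s sP]; exists s => x a; have [c cs ac] := sP x a; exists c => //.
by move: ac; rewrite !(fib_C dF).
Qed.

Section Limits.
Variables (X : Type) (A : pzRingType) (d : X -> A).
Hypotheses (dF : fibred d) (dfin : finite_fibres d).
Variables (Z : Type) (W : set_system Z) (hW : UltraFilter W).

Lemma ultra_seq (T : eqType) (s : seq T) (P : T -> set Z) :
  W [set a | exists2 c, c \in s & P c a]%classic -> exists c, W (P c).
Proof.
elim: s => [|c s IHs] Ws.
  have /filter_not_empty[] : W set0 by apply: filterS Ws => a [].
have [|nWc] := in_ultra_setVsetC (P c) hW; first by exists c.
apply: IHs; apply: filterS (filterI Ws nWc) => a [[e]].
by rewrite inE => /orP[/eqP-> //|es Pe _]; exists e.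
Qed.

(** Limits are taken fibre by fibre: over x, W-almost all values agree with t. *)
Definition ring_lim (q : Z -> A) (t : A) : Prop :=
  forall x, W [set a | d x * q a = d x * t]%classic.

Lemma ring_lim_ex q : exists t, ring_lim q t.
Proof.
have [s sP] := dfin.
have /choice[c cP] x : exists c, W [set a | d x * q a = d x * c]%classic.
  apply: (@ultra_seq _ s (fun c => [set a | d x * q a = d x * c]%classic)).
  by apply: filterS filterT => a _; exact: sP.
have [t tP] := fib_glue dF c; exists t => x.
by apply: filterS (cP x) => a /= ->; rewrite tP.
Qed.

Lemma ring_lim_uniq q t t' : ring_lim q t -> ring_lim q t' -> t = t'.
Proof.
move=> qt qt'; apply/eqP; rewrite -subr_eq0; apply/eqP/(fib_sep dF) => x.
have [a [/= e e']] := filter_ex (filterI (qt x) (qt' x)).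
by rewrite mulrBr -e -e' subrr.
Qed.

Hypothesis W1 : aleph1_complete W.
Variable L : choiceType.

Definition free_lim (q : Z -> frm A L) (y : frm A L) : Prop :=
  forall l, ring_lim (fun a => q a l) (y l).

Lemma free_lim_uniq q y y' : free_lim q y -> free_lim q y' -> y = y'.
Proof. by move=> qy qy'; apply: dsumP => l; exact: ring_lim_uniq (qy l) (qy' l). Qed.

(** If the coordinatewise limit had infinite support, countably many of its
    coordinates would be nonzero, each at some point; by aleph_1-completeness some
    single [q a] would agree with the limit at all these places, and so have
    infinite support. *)
Lemma free_lim_ex q : exists y, free_lim q y.
Proof.
have /choice[y yP] : forall l, exists t, ring_lim (fun a => q a l) t.
  by move=> l; exact: ring_lim_ex.
suff fy : finite_set [set l | (y l : A^o) != 0]%classic.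
  by exists (@Dsum A L (fun _ => A^o : lmodType A) y fy).
apply: contrapT => /infinite_seq[j [j_inj jP]].
have /choice[x xP] : forall i, exists x, d x * y (j i) <> 0.
  move=> i; apply/existsNP => /(fib_sep dF) yj.
  by have := jP i; rewrite /= yj eqxx.
pose S i : set Z := [set a | d (x i) * q a (j i) = d (x i) * y (j i)]%classic.
have : W (\bigcap_(B in range S) B)%classic.
  apply: W1; first by move=> _ [i _ <-]; exact: yP.
  exact: card_le_trans (card_image_le _ _) (countableP _).
move=> /filter_ex[a aP].
apply: infinite_nat.
apply: sub_finite_set (finite_preimage (in2W j_inj) (dsum_finite (q a))) => i _ /=.
apply/eqP => qa0; apply: (xP i); have /= <- := aP (S i) (ex_intro2 _ _ i I erefl).
by rewrite qa0 mulr0.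
Qed.

Lemma free_lim_linear (M : lmodType A) (h : Z -> {linear M -> frm A L}) :
  exists k : {linear M -> frm A L}, forall y, free_lim (fun a => h a y) (k y).
Proof.
have /choice[k kP] y := free_lim_ex (fun a => h a y).
suff kl : linear k by exists (mklin kl).
move=> a y z; apply: free_lim_uniq (kP _) _ => l x.
apply: filterS (filterI (kP y l x) (kP z l x)) => b [/= ey ez].
by rewrite linearP /= !mulrDr ez mulrA (fib_C dF) -mulrA ey mulrA -(fib_C dF) mulrA.
Qed.

End Limits.

(** * Dual numbers, triangular matrices and function rings *)

Section DualCoordinates.
Variable R : comNzRingType.
Local Notation B := (dual R).
Local Notation BX := {poly %/ ('X^2 : {poly R})}.

Definition dual_co1 (b : B) : R := (b : BX)`_1.

Lemma dual_co1B : zmod_morphism dual_co1.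
Proof. by move=> b c; exact: (coefB (b : BX) (c : BX) 1). Qed.
HB.instance Definition _ := GRing.isZmodMorphism.Build B R dual_co1 dual_co1B.

Lemma dual_co1M b c :
  dual_co1 (b * c) = dual_aug b * dual_co1 c + dual_co1 b * dual_aug c.
Proof.
rewrite /dual_aug /dual_co1.
have := poly_of_qpolyM (b : BX) (c : BX); rewrite {}[b * c]/((b : BX) * (c : BX)).
move: (polyn _) (polyn _) (polyn _) => p q r.
rewrite mk_monic_Xn => ->.
transitivity ((q * p)`_1); last first.
  by rewrite coefM 2!big_ord_recl big_ord0 addr0.
rewrite [in RHS](Pdiv.RingMonic.rdivp_eq (monicXn R 2) (_ * _)).
by rewrite coefD coefMXn /= add0r.
Qed.

Local Notation aug := (@dual_aug R).
Local Notation co1 := dual_co1.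
Local Notation cst := (@dual_const R).

Lemma dual_aug_const r : aug (cst r) = r.
Proof. by rewrite /dual_aug /dual_const /= coefC. Qed.

Lemma dual_co1_const r : co1 (cst r) = 0.
Proof. by rewrite /dual_co1 /dual_const /= coefC. Qed.

Lemma eps_val : (eps R : BX) = 'X :> {poly R}.
Proof.
rewrite /eps /= mk_monic_Xn Pdiv.CommonRing.rmodp_small ?monicXn //.
by rewrite size_polyX size_polyXn.
Qed.

Lemma dual_aug_eps : aug (eps R) = 0.
Proof. by rewrite /dual_aug eps_val coefX. Qed.

Lemma dual_co1_eps : co1 (eps R) = 1.
Proof. by rewrite /dual_co1 eps_val coefX. Qed.

Lemma dual_eq (b c : B) : aug b = aug c -> co1 b = co1 c -> b = c.
Proof.
move=> e0 e1; apply: val_inj; apply/polyP => -[//|[//|i]].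
by rewrite !nth_default // -ltnS;
  apply: leq_trans (size_mk_monic _) _; rewrite mk_monic_Xn size_polyXn.
Qed.

Lemma dual_decomp (b : B) :
  b = cst (aug b) + cst (co1 b) * eps R.
Proof.
apply: dual_eq; rewrite raddfD /= ?rmorphM /= ?dual_co1M.
  by rewrite !dual_aug_const dual_aug_eps mulr0 addr0.
by rewrite !dual_aug_const !dual_co1_const dual_co1_eps mulr1 mul0r addr0 add0r.
Qed.

End DualCoordinates.

Section TriangularCalculus.
Variable R : comNzRingType.
Local Notation B := (dual R).
Local Notation T := (tri (aug_bimod R)).
Local Notation aug := (@dual_aug R).
Local Notation cst := (@dual_const R).

(** A triple typed as a matrix, with entries typed in R and B. *)
Definition mk_tri (a m : R) (c : B) : T := (a, m, c).
Definition tri_const (r : R) : T := mk_tri r 0 (cst r).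
Definition tri_diag (r : R * R) : T := mk_tri r.1 0 (cst r.2).
(** The quotient map T -> T/J = R x R; [tri_diag] is a section of it. *)
Definition tri_top (t : T) : R * R := (t.1.1, aug t.2).
Definition tri_eA : T := mk_tri 1 0 0.
Definition tri_eB : T := mk_tri 0 0 1.
Definition tri_m : T := mk_tri 0 1 0.
Definition tri_eps : T := mk_tri 0 0 (eps R).

Lemma mk_triM a m c a' m' c' :
  mk_tri a m c * mk_tri a' m' c' = mk_tri (a * a') (m * a' + aug c * m') (c * c').
Proof. by []. Qed.

Lemma mk_triD a m c a' m' c' :
  mk_tri a m c + mk_tri a' m' c' = mk_tri (a + a') (m + m') (c + c').
Proof. by []. Qed.

Lemma mk_triB a m c a' m' c' :
  mk_tri a m c - mk_tri a' m' c' = mk_tri (a - a') (m - m') (c - c').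
Proof. by []. Qed.

Lemma tri_diag_zmod : zmod_morphism tri_diag.
Proof. by move=> x y; rewrite /tri_diag mk_triB subr0 /= raddfB. Qed.
Lemma tri_diag_monoid : monoid_morphism tri_diag.
Proof.
split=> [|x y]; first by rewrite /tri_diag rmorph1.
by rewrite /tri_diag mk_triM mul0r mulr0 addr0 /= rmorphM.
Qed.
HB.instance Definition _ := GRing.isZmodMorphism.Build _ _ tri_diag tri_diag_zmod.
HB.instance Definition _ := GRing.isMonoidMorphism.Build _ _ tri_diag tri_diag_monoid.

Lemma tri_const_zmod : zmod_morphism tri_const.
Proof. by move=> x y; rewrite /tri_const mk_triB subr0 raddfB. Qed.
Lemma tri_const_monoid : monoid_morphism tri_const.
Proof.
split=> [|x y]; first by rewrite /tri_const rmorph1.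
by rewrite /tri_const mk_triM mul0r mulr0 addr0 /= rmorphM.
Qed.
HB.instance Definition _ := GRing.isZmodMorphism.Build _ _ tri_const tri_const_zmod.
HB.instance Definition _ := GRing.isMonoidMorphism.Build _ _ tri_const tri_const_monoid.

Lemma tri_top_zmod : zmod_morphism tri_top.
Proof. by move=> [[a m] c] [[a' m'] c']; congr (_, _); rewrite /= raddfB. Qed.
Lemma tri_top_monoid : monoid_morphism tri_top.
Proof.
split=> [|[[a m] c] [[a' m'] c']]; congr (_, _); rewrite /= ?rmorph1 //.
by rewrite rmorphM.
Qed.
HB.instance Definition _ := GRing.isZmodMorphism.Build _ _ tri_top tri_top_zmod.
HB.instance Definition _ := GRing.isMonoidMorphism.Build _ _ tri_top tri_top_monoid.

Lemma tri_const_C r (t : T) : tri_const r * t = t * tri_const r.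
Proof.
case: t => [[a m] c]; rewrite [(a, m, c)]/(mk_tri a m c) !mk_triM.
by rewrite mul0r mulr0 !add0r addr0 dual_aug_const mulrC (mulrC r) (mulrC _ c).
Qed.

Lemma tri_eE : tri_e (aug_bimod R) = tri_eB. Proof. by []. Qed.

Lemma tri_incE b : tri_inc (aug_bimod R) b = mk_tri 0 0 b.
Proof. by []. Qed.

Lemma tri_inc_const b r :
  tri_inc (aug_bimod R) (b * cst r) = tri_inc _ b * tri_const r.
Proof. by rewrite !tri_incE !mk_triM !mul0r mulr0 addr0. Qed.

Lemma Te_valE (t : tri_Te (aug_bimod R)) : val t = mk_tri 0 0 (val t : T).2.
Proof.
have /tri_Te_predP[[[a m] c] ->] := valP t.
rewrite tri_eE [(a, m, c)]/(mk_tri a m c) mk_triM.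
by rewrite !mulr0 add0r mulr1.
Qed.

Lemma Te_valD (t t' : tri_Te (aug_bimod R)) : val (t + t') = (val t : T) + val t'.
Proof. by []. Qed.

Lemma Te_valZ a (t : tri_Te (aug_bimod R)) : val (a *: t) = a * (val t : T).
Proof. by []. Qed.

(** T e_B is free of rank one over B on the right, with basis [Te_e]; this is its
    coordinate. *)
Definition Te_co (t : tri_Te (aug_bimod R)) : B := (val t : T).2.

Lemma Te_coD t t' : Te_co (t + t') = Te_co t + Te_co t'.
Proof. by []. Qed.

Lemma Te_co_ract t b : Te_co (tri_Te_ract t b) = Te_co t * b.
Proof. by rewrite /Te_co /= (Te_valE t). Qed.

Lemma Te_const (t : tri_Te (aug_bimod R)) r :
  tri_Te_ract t (cst r) = tri_const r *: t.
Proof.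
apply: val_inj; rewrite /= (Te_valE t) tri_incE [RHS]mk_triM mk_triM.
by rewrite !mulr0 !addr0 mulrC.
Qed.

Lemma Te_e_subproof : tri_e (aug_bimod R) \in @tri_Te_pred _ _ (aug_bimod R).
Proof. by apply/tri_Te_predP; exists 1; rewrite mul1r. Qed.
Definition Te_e : tri_Te_bimod (aug_bimod R) := Submod Te_e_subproof.

Lemma Te_ract_e (t : tri_Te (aug_bimod R)) : tri_Te_ract Te_e (Te_co t) = t.
Proof.
apply: val_inj; rewrite [RHS]Te_valE /= tri_incE tri_eE mk_triM.
by rewrite !mulr0 addr0 mul1r.
Qed.

Lemma Te_inc_e (t : tri_Te (aug_bimod R)) (b : B) :
  (val t * tri_inc _ b) *: (Te_e : tri_Te (aug_bimod R)) = tri_Te_ract t b.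
Proof.
apply: val_inj; transitivity (val t * tri_inc (aug_bimod R) b * tri_inc _ 1 : T) => //.
by rewrite -mulrA -tri_incM mulr1.
Qed.

End TriangularCalculus.

Lemma F2_cases (u : 'F_2) : u = 0 \/ u = 1.
Proof. by case: u => -[|[|//]] i; [left | right]; apply: val_inj. Qed.

Section FunctionRings.
Variable X : pointedType.
Local Notation R := (ringR X).
Local Notation T := (ringT X).

Definition dirac (x : X) : R := fun y => if y == x then 1 else 0.

Lemma ringRM (f g : R) y : (f * g) y = f y * g y. Proof. by []. Qed.

Lemma diracM x (f : R) : dirac x * f = (fun y => if y == x then f x else 0).
Proof.
apply: funext => y; rewrite ringRM /dirac.
by case: eqP => [->|_]; rewrite ?mul1r ?mul0r.
Qed.

Lemma diracP x (f g : R) : dirac x * f = dirac x * g <-> f x = g x.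
Proof.
rewrite !diracM; split=> [/(congr1 (fun h => h x))|->//].
by rewrite !eqxx.
Qed.

Lemma dirac_id x : dirac x * dirac x = dirac x.
Proof. by rewrite diracM /dirac eqxx. Qed.

Lemma dirac_orth x y : x <> y -> dirac x * dirac y = 0.
Proof.
move=> xy; rewrite diracM; apply: funext => z; rewrite /dirac.
by case: eqP => // _; case: eqP.
Qed.

Lemma dirac_sep (f : R) : (forall x, dirac x * f = 0) -> f = 0.
Proof. by move=> f0; apply: funext => x; apply/diracP; rewrite f0 mulr0. Qed.

(** The fibres of R are fields with two elements. *)
Lemma dirac_two x (f : R) : dirac x * f = 0 \/ dirac x * f = dirac x.
Proof.
have [fx|fx] := F2_cases (f x); [left | right].
  by rewrite -[RHS](mulr0 (dirac x)); apply/diracP.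
by rewrite -[RHS](mulr1 (dirac x)); apply/diracP.
Qed.

(** The point idempotents of R x R, seen as the ring of functions on X + X. *)
Definition dirac2 (x : X + X) : R * R :=
  match x with inl y => (dirac y, 0) | inr y => (0, dirac y) end.

Lemma dirac2_fibred : fibred dirac2.
Proof.
split.
- by move=> x a; rewrite mulrC.
- by case=> x; congr (_, _); rewrite ?mulr0 ?dirac_id.
- by move=> [x|x] [y|y] xy; congr (_, _);
    rewrite ?mulr0 ?mul0r ?dirac_orth // => e; apply: xy; rewrite e.
- move=> t; exists (fun x => (t (inl x)).1 x, fun x => (t (inr x)).2 x).
  by case=> x; congr (_, _); rewrite /= ?mul0r //; exact/diracP.
- move=> a a0; rewrite [a]surjective_pairing; congr (_, _); apply: dirac_sep => x.
    by have /(congr1 fst) := a0 (inl x).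
  by have /(congr1 snd) := a0 (inr x).
Qed.

Lemma dirac2_two x a : dirac2 x * a = 0 \/ dirac2 x * a = dirac2 x.
Proof.
case: x a => x [a b]; [case: (dirac_two x a) | case: (dirac_two x b)] => e;
  [left | right | left | right]; congr (_, _); by rewrite //= mul0r.
Qed.

Definition diracT (x : X) : T := tri_const (dirac x).

Lemma diracTM x (a m : R) (c : ringB X) :
  diracT x * mk_tri a m c =
  mk_tri (dirac x * a) (dirac x * m) (dual_const (dirac x) * c).
Proof. by rewrite mk_triM mul0r add0r dual_aug_const. Qed.

Lemma dual_dirac_eq x (b c : ringB X) :
  dual_aug b x = dual_aug c x -> dual_co1 b x = dual_co1 c x ->
  dual_const (dirac x) * b = dual_const (dirac x) * c.
Proof.
move=> e0 e1; apply: dual_eq; rewrite ?rmorphM ?dual_co1M /=.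
  by rewrite !dual_aug_const; exact/diracP.
rewrite !dual_aug_const !dual_co1_const !mul0r !addr0; exact/diracP.
Qed.

Let mkB (a b : R) : ringB X := dual_const a + dual_const b * eps R.
Let mkB_aug a b : dual_aug (mkB a b) = a.
Proof. by rewrite raddfD /= rmorphM /= !dual_aug_const dual_aug_eps mulr0 addr0. Qed.
Let mkB_co1 a b : dual_co1 (mkB a b) = b.
Proof.
rewrite raddfD /= dual_co1M !dual_aug_const !dual_co1_const dual_co1_eps.
by rewrite mulr1 mul0r addr0 add0r.
Qed.

Lemma diracT_fibred : fibred diracT.
Proof.
split.
- by move=> x a; exact: tri_const_C.
- by move=> x; rewrite -rmorphM dirac_id.
- by move=> x y xy; rewrite -rmorphM dirac_orth // rmorph0.
- move=> t; exists (mk_tri (fun x => (t x).1.1 x) (fun x => (t x).1.2 x)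
    (mkB (fun x => dual_aug (t x).2 x) (fun x => dual_co1 (t x).2 x))).
  move=> x; case e : (t x) => [[a m] c]; rewrite [(a, m, c)]/(mk_tri a m c) !diracTM.
  congr mk_tri; [by apply/diracP; rewrite e | by apply/diracP; rewrite e |].
  by apply: dual_dirac_eq; rewrite ?mkB_aug ?mkB_co1 e.
- move=> [[a m] c]; rewrite [(a, m, c)]/(mk_tri a m c) => h.
  have {}h x : mk_tri (dirac x * a) (dirac x * m) (dual_const (dirac x) * c) = 0.
    by rewrite -diracTM h.
  congr (_, _, _).
  - by apply: dirac_sep => x; have [] := h x.
  - by apply: dirac_sep => x; have [] := h x.
  - apply: dual_eq; rewrite raddf0; apply: dirac_sep => x.
      have /(congr1 (fun t : T => dual_aug t.2)) /= := h x.
      by rewrite rmorphM /= dual_aug_const raddf0.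
    have /(congr1 (fun t : T => dual_co1 t.2)) /= := h x.
    by rewrite dual_co1M dual_aug_const dual_co1_const mul0r addr0 raddf0.
Qed.

(** Constant matrices represent every fibre. *)
Lemma diracT_fin : finite_fibres diracT.
Proof.
pose k (u : 'F_2) : R := fun _ => u.
pose f (v : 'F_2 * 'F_2 * 'F_2 * 'F_2) : T :=
  mk_tri (k v.1.1.1) (k v.1.1.2) (mkB (k v.1.2) (k v.2)).
exists [seq f v | v <- enum {: 'F_2 * 'F_2 * 'F_2 * 'F_2}] => x [[a m] c].
exists (f (a x, m x, dual_aug c x, dual_co1 c x)); first by rewrite map_f // mem_enum.
rewrite [(a, m, c)]/(mk_tri a m c) !diracTM; congr mk_tri; try exact/diracP.
by apply: dual_dirac_eq; rewrite ?mkB_aug ?mkB_co1.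
Qed.

Lemma ringT_coherent : left_coherent T /\ right_coherent T.
Proof.
split; first exact: fibred_left_coherent diracT_fibred diracT_fin.
apply: (fibred_left_coherent (d := diracT : X -> T^c)).
  exact: fibred_op diracT_fibred.
exact: finite_fibres_op diracT_fibred diracT_fin.
Qed.

End FunctionRings.

(** * A complete ultrafilter of null sets *)

Section Smallness.
Local Open Scope classical_set_scope.
Local Open Scope card_scope.
Variables (X : pointedType) (U : set_system X) (hU : UltraFilter U).
Hypotheses (hU_np : nonprincipal U) (hU_complete : kappa_complete X U).

Lemma ultra_setC1 x : U (~` [set x]).
Proof.
have [Ux|//] := in_ultra_setVsetC [set x] hU.
case: (hU_np (x := x)); apply/predeqP => B; split.
  move=> UB; rewrite principal_filterP.
  by have [y [By <-]] := filter_ex (filterI UB Ux).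
by rewrite principal_filterP => Bx; apply: filterS Ux => y /= ->.
Qed.

(** The complement of such a set is an intersection of fewer than kappa
    complements of points, all of which lie in U. *)
Lemma small_null (a : set X) : card_lt a [set: X] -> ~ U a.
Proof.
move=> ca Ua.
pose G := [set ~` [set x] | x in a].
have : U (\bigcap_(B in G) B).
  apply: hU_complete; first by move=> _ [x _ <-]; exact: ultra_setC1.
  apply: contra ca => XG; apply: card_le_trans XG (card_image_le _ _).
move=> UG; have [x [ax Gx]] := filter_ex (filterI Ua UG).
by apply: (Gx (~` [set x])) => //; exists x.
Qed.

(** N a is the set of points whose singleton belongs to a.  It has fewer than
    kappa elements, hence is null, and fineness at the singleton of x puts x in
    almost every N a. *)
Lemma null_cover : LUH2 X ->
  exists (Z : Type) (W : set_system Z) (N : Z -> set X),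
    [/\ UltraFilter W, aleph1_complete W, forall a, ~ U (N a) &
        forall x, W [set a | N a x]].
Proof.
move=> [V [hV [V1 Vfine]]].
exists (Pk X (set X)), V, (fun a x => sval a [set x]); split=> // a.
  apply: small_null; apply: contra (svalP a) => le.
  apply: card_le_trans le _.
  have f_inj : set_inj [set x | sval a [set x]] (fun x => [set x]).
    by move=> x y _ _ e; have : [set x] x by []; rewrite e.
  rewrite -(card_le_eql (inj_card_eq f_inj)).
  by apply: subset_card_le => _ [x ax <-].
Qed.

End Smallness.

(** * The complex F_T: Hom into projective modules *)

Lemma addrBB (V : zmodType) (a b c d : V) : a - b + (c - d) = a + c - (b + d).
Proof. by rewrite opprD addrACA. Qed.

Lemma projective_exact_lift (A : pzRingType) (P M N K : lmodType A)
    (f : {linear M -> N}) (g : {linear N -> K}) (h : {linear P -> N}) :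
  is_projective P -> exact_at f g -> (forall x, g (h x) = 0) ->
  exists k : {linear P -> M}, forall x, f (k x) = h x.
Proof.
move=> projP fg gh.
have [f' f'E] : exists f' : {linear M -> kermod g}, forall x, val (f' x) = f x.
  by apply: sub_lift => x; rewrite inE; apply/eqP/fg; exists x.
have [h' h'E] : exists h' : {linear P -> kermod g}, forall x, val (h' x) = h x.
  by apply: sub_lift => x; rewrite inE; apply/eqP.
have fs : is_surj f'.
  move=> y; have /fg[x xy] : g (val y) = 0 by apply/eqP; exact: (valP y).
  by exists x; apply: val_inj; rewrite f'E.
have [k kP] := projP _ _ f' h' fs; exists k => x.
by rewrite -f'E kP h'E.
Qed.

Section Homotopy.
Variables (R : comNzRingType) (S : lmodType R) (F : free_resolution S) (r : R).
Hypothesis rS : forall s : S, r *: s = 0.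

Lemma mulr_lin_linear (M : lmodType R) : linear (fun x : M => r *: x).
Proof. by move=> a x y; rewrite scalerDr !scalerA mulrC. Qed.
Definition mulr_lin (M : lmodType R) : {linear M -> M} := mklin (@mulr_lin_linear M).

Local Notation d := (res_d F).

Lemma res_dd k x : d k (d k.+1 x) = 0.
Proof. by apply/(@res_exactS _ _ F k); exists x. Qed.

Let Inv k (s : {linear F k -> F k.+1}) := forall x, d k (s (d k x)) = r *: d k x.

Let base : {s : {linear F 0 -> F 1} | forall x, d 0 (s x) = r *: x}.
Proof.
apply: cid; have [|k kP] := @projective_exact_lift _ _ _ _ _ (d 0) (res_aug F)
  (mulr_lin (F 0)) (free_projective (res_free F 0)) (@res_exact0 _ _ F).
  by move=> x /=; rewrite linearZ_LR rS.
by exists k.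
Qed.

Let step k (s : {s : {linear F k -> F k.+1} | Inv s}) :
  {s' : {linear F k.+1 -> F k.+2} |
    forall x, d k.+1 (s' x) + sval s (d k x) = r *: x}.
Proof.
case: s => s sI; apply: cid => /=.
have [|t tP] := @projective_exact_lift _ _ _ _ _ (d k.+1) (d k)
  (mulr_lin (F k.+1) \- (s \o d k)) (free_projective (res_free F k.+1))
  (@res_exactS _ _ F k).
  by move=> x /=; rewrite linearB linearZ_LR /= sI subrr.
by exists t => x; rewrite tP /= subrK.
Qed.

Let step_inv k s x : d k.+1 (sval (@step k s) (d k.+1 x)) = r *: d k.+1 x.
Proof. by case: (step s) => t /= /(_ (d k.+1 x)); rewrite res_dd linear0 addr0. Qed.

Let base_inv : Inv (sval base).
Proof. by move=> x; case: base => s /= ->. Qed.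

(** A homotopy from multiplication by r to zero.  Each component carries the
    identity [Inv] that makes the lifting problem for the next one solvable. *)
Fixpoint hseq k : {s : {linear F k -> F k.+1} | Inv s} :=
  match k with
  | 0 => exist _ (sval base) base_inv
  | j.+1 => exist _ (sval (step (hseq j))) (@step_inv j (hseq j))
  end.

Lemma hseq0 x : d 0 (sval (hseq 0) x) = r *: x.
Proof. by rewrite /=; case: base. Qed.

Lemma hseqS k x : d k.+1 (sval (hseq k.+1) x) + sval (hseq k) (d k x) = r *: x.
Proof. by rewrite /=; case: (step _). Qed.

Definition hsum_fun (y : dsum F) : forall k, F k :=
  fun k => match k with 0 => 0 | j.+1 => sval (hseq j) (y j) end.

Let hsum_fin (y : dsum F) : finite_set [set k | hsum_fun y k != 0]%classic.
Proof.
apply: (@sub_finite_set _ _ (succn @` [set k | y k != 0])%classic).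
  move=> [|k] /=; first by rewrite eqxx.
  move=> yk; exists k => //=; apply: contraNneq yk => ->; exact/eqP/linear0.
exact/finite_image/dsum_finite.
Qed.

Let hsum_linear : linear (fun y => Dsum (hsum_fin y)).
Proof.
move=> a x y; apply: dsumP => -[|k] /=; first by rewrite scaler0 addr0.
by rewrite linearP.
Qed.

Definition hsum : {linear dsum F -> dsum F} := mklin hsum_linear.

End Homotopy.

Section TotalComplex.
Variables (X : pointedType) (U : set_system X) (hU : UltraFilter U).
Variable F : free_resolution (modS hU).
Local Notation R := (ringR X).
Local Notation B := (ringB X).
Local Notation T := (ringT X).
Local Notation aug := (@dual_aug R).
Local Notation cst := (@dual_const R).

(** Multiplication by r lifts the zero map of S, and two lifts of one map to a
    projective resolution are homotopic. *)
Lemma partial_homotopy (r : R) : (forall s : modS hU, r *: s = 0) ->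
  exists s : {linear Fsum F -> Fsum F},
    forall x, partial (s x) + s (partial x) = r *: x.
Proof.
move=> rS; exists (hsum F rS) => x; apply: dsumP => -[|k].
  exact: etrans (addr0 _) (hseq0 rS (x 0%N)).
by have := hseqS rS (x k.+1); rewrite /hsum /=.
Qed.

(** Every term of F_T is this module and every differential is [FT_Delta], by
    conversion; so degrees can be forgotten in most arguments. *)
Definition FT_term : lmodType T := bitensor (Te_bimod X) (FB_obj F).
Definition FT_Delta : {linear FT_term -> FT_term} :=
  bitensor_lin (f := @idfun (rmod_of_bimod (Te_bimod X))) (Delta F)
    (fun _ _ => erefl).

Lemma FT_Delta_tens (t : Te_bimod X) w : FT_Delta (bitens t w) = bitens t (Delta F w).
Proof. exact: bitensor_linE. Qed.

Lemma Fsum2 (x : Fsum F) : x + x = 0.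
Proof.
rewrite -[x]scale1r -scalerDl; apply: etrans (scale0r x); congr (_ *: x).
by apply: funext => y; apply: val_inj.
Qed.

(** Extending s to B (x) F_sum contributes eps (x) s twice, which cancels in
    characteristic 2. *)
Lemma Delta_homotopy (r : R) (s : {linear Fsum F -> Fsum F}) :
  (forall x, partial (s x) + s (partial x) = r *: x) ->
  exists S : {linear FB_obj F -> FB_obj F},
    forall x, Delta F (S x) + S (Delta F x) = cst r *: x.
Proof.
move=> sP; pose S := bitensor_lin (f := @idfun (rmod_of_bimod (dual_bimod R))) s
  (fun _ _ => erefl).
exists S; elim/bitens_ind => [u v IHu IHv|b x].
  by rewrite scalerBr -IHu -IHv !linearB addrBB.
have SE c y : S (bitens (c : dual_bimod R) y) = bitens (c : dual_bimod R) (s y).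
  exact: bitensor_linE.
rewrite SE !DeltaE linearD !SE addrACA -bitensDr Fsum2.
rewrite bitens0r add0r -bitensDr sP -bitens_ract bitensZ /=.
by congr bitens; rewrite mulrC.
Qed.

Lemma FT_Delta_homotopy (r : R) (s : {linear Fsum F -> Fsum F}) :
  (forall x, partial (s x) + s (partial x) = r *: x) ->
  exists S : {linear FT_term -> FT_term},
    forall x, FT_Delta (S x) + S (FT_Delta x) = tri_const r *: x.
Proof.
move=> /Delta_homotopy[S SP].
pose S' := bitensor_lin (f := @idfun (rmod_of_bimod (Te_bimod X))) S
  (fun _ _ => erefl).
exists S'; elim/bitens_ind => [u v IHu IHv|t w].
  by rewrite scalerBr -IHu -IHv !linearB addrBB.
have SE t' w' : S' (bitens (t' : Te_bimod X) w') = bitens (t' : Te_bimod X) (S w').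
  exact: bitensor_linE.
rewrite SE !FT_Delta_tens SE -bitensDr SP -bitens_ract bitensZ.
by rewrite [X in bitens X _]Te_const.
Qed.

Lemma FT_DeltaK x : FT_Delta (FT_Delta x) = 0.
Proof. exact: (FT_diffK (F := F) (n := 0) x). Qed.

Definition indic (N : set X) : R := fun x => if `[< N x >] then 1 else 0.

Lemma indic_null (N : set X) : ~ U N -> forall s : modS hU, indic N *: s = 0.
Proof.
move=> nUN s; have [y <-] := @pi_lin_surj _ _ (ideal_m hU) s.
rewrite -linearZ; apply/pi_lin_eq0/m_predP; apply: idealIS nUN => x /=.
rewrite -[X in X != 0]/(indic N x * y x) /indic.
by case: asboolP => // _; rewrite mul0r eqxx.
Qed.

Lemma dirac_indic (N : set X) x : N x -> dirac x * indic N = dirac x.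
Proof.
move=> Nx; rewrite -[RHS]mulr1; apply/diracP; rewrite /indic.
by case: asboolP.
Qed.

Section HomExact.
Variables (Z : Type) (W : set_system Z) (N : Z -> set X).
Hypotheses (hW : UltraFilter W) (W1 : aleph1_complete W).
Hypotheses (Nnull : forall a, ~ U (N a)).
Hypothesis Ncover : forall x, W [set a | N a x]%classic.

(** A point x lies in almost every N a, where cutting down to N a changes nothing
    over x. *)
Lemma free_lim_indic (L : choiceType) (y : frm T L) :
  free_lim (@diracT X) W (fun a => tri_const (indic (N a)) *: y) y.
Proof.
move=> l x; apply: filterS (Ncover x) => a Nx.
suff : diracT x * (tri_const (indic (N a)) * (y l : T)) = diracT x * y l by [].
by rewrite mulrA -rmorphM dirac_indic.
Qed.

(** With s_a a homotopy from 1_(N a) to zero, h s_a Delta = 1_(N a) h, and the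
    limit of the right-hand side is h. *)
Lemma FT_Delta_hom_free (L : choiceType) (h : {linear FT_term -> frm T L}) :
  (forall x, h (FT_Delta x) = 0) -> exists k : {linear FT_term -> frm T L},
    forall x, k (FT_Delta x) = h x.
Proof.
move=> hD.
have /choice[S SP] a : exists S : {linear FT_term -> FT_term},
    forall x, FT_Delta (S x) + S (FT_Delta x) = tri_const (indic (N a)) *: x.
  by have [s /FT_Delta_homotopy] := partial_homotopy (indic_null (Nnull (a := a))).
have [k kP] := free_lim_linear (@diracT_fibred X) (@diracT_fin X) hW W1
  (fun a => h \o S a).
exists k => x; apply: (free_lim_uniq (@diracT_fibred X) hW (kP (FT_Delta x))).
suff -> : (fun a => (h \o S a) (FT_Delta x)) = fun a => tri_const (indic (N a)) *: h x.
  exact: free_lim_indic.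
by apply: funext => a; rewrite -linearZ_LR -SP linearD hD add0r.
Qed.

Lemma FT_Delta_hom_projective (Q : lmodType T) (h : {linear FT_term -> Q}) :
  is_projective Q -> (forall x, h (FT_Delta x) = 0) -> exists k : {linear FT_term -> Q},
    forall x, k (FT_Delta x) = h x.
Proof.
move=> /projective_retract[i [r ri]] hD.
have [|k kP] := @FT_Delta_hom_free _ (i \o h); first by move=> x /=; rewrite hD linear0.
by exists (r \o k) => x /=; rewrite kP /= ri.
Qed.

End HomExact.

End TotalComplex.

(** * The complex F_T: exactness and projectivity *)

Section TensorLiftBimod.
Variables (C A : pzRingType) (M : bimod C A) (Y : lmodType A) (V : zmodType).
Variable f : M -> Y -> V.
Hypothesis fDl : forall e e' y, f (e + e') y = f e y + f e' y.
Hypothesis fDr : forall e y y', f e (y + y') = f e y + f e y'.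
Hypothesis fZ : forall a e y, f (ract e a) y = f e (a *: y).

Lemma bitens_lift : exists g : {additive bitensor M Y -> V},
  forall x y, g (bitens x y) = f x y.
Proof.
pose f' (e : rmod_of_bimod M) (y : Y) := f e y.
have gB := @tensor_lift_zmod_morphism A (rmod_of_bimod M) Y V f' fDl fDr fZ.
pose g : {additive bitensor M Y -> V} := HB.pack (tensor_lift f')
  (GRing.isZmodMorphism.Build (bitensor M Y) V (tensor_lift f') gB).
by exists g => x y; apply: (tensor_lift_tens (f := f')).
Qed.

End TensorLiftBimod.

Section TotalComplexExact.
Variables (X : pointedType) (U : set_system X) (hU : UltraFilter U).
Variable F : free_resolution (modS hU).
Local Notation R := (ringR X).
Local Notation B := (ringB X).
Local Notation T := (ringT X).
Local Notation aug := (@dual_aug R).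
Local Notation co1 := (@dual_co1 R).
Local Notation cst := (@dual_const R).
Local Notation FT_term := (FT_term F).
Local Notation FBo := (FB_obj F).
Local Notation Fs := (Fsum F).
Local Notation D := (Delta F).
Local Notation FT_Delta := (FT_Delta F).
Local Notation bb b x := (bitens (b : dual_bimod R) x).

(** As an R-module B (x) F_sum is F_sum + eps F_sum, and Delta maps the first
    summand isomorphically to the second up to the differential of F.  Reading the
    eps-coordinate back in the first summand is a contraction, though it is not
    B-linear. *)
Lemma contraction_ex : exists tau : {additive FBo -> FBo},
  forall x, D (tau x) + tau (D x) = x.
Proof.
have [tau tauE] : exists tau : {additive FBo -> FBo},
    forall b x, tau (bb b x) = bb (cst (co1 b)) x.
  apply: (@bitens_lift _ _ (dual_bimod R) _ _ (fun b x => bb (cst (co1 b)) x)).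
  - by move=> b c x; rewrite !raddfD; exact: bitensDl.
  - by move=> b x y; exact: bitensDr.
  - move=> r b x; rewrite -bitens_ract /= dual_co1M dual_co1_const mulr0 add0r.
    by rewrite dual_aug_const rmorphM.
exists tau; elim/bitens_ind => [u v IHu IHv|b x].
  by rewrite [tau (u - v)]raddfB [D (u - v)]linearB [tau (_ - _)]raddfB
     [D (tau u - _)]linearB addrBB IHu IHv.
rewrite DeltaE [tau (_ + _)]raddfD !tauE DeltaE addrACA -bitensDr Fsum2 bitens0r addr0.
rewrite -bitensDl; congr bitens; rewrite [RHS]dual_decomp addrC; congr (cst _ + _).
by rewrite dual_co1M dual_aug_eps dual_co1_eps mulr0 mulr1 addr0.
Qed.

Lemma Delta_exact x : D x = 0 -> exists y, D y = x.
Proof.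
have [tau tauP] := contraction_ex => Dx; exists (tau x).
by rewrite -[RHS]tauP Dx raddf0 addr0.
Qed.

(** T e_B (x)_B N is N as a group, since T e_B is free on [Te_e]. *)
Lemma FT_term_unit : exists th : {additive FT_term -> FBo},
  (forall u, bitens (Te_e R) (th u) = u) /\ (forall t w, th (bitens t w) =
     Te_co t *: w).
Proof.
have [th thE] : exists th : {additive FT_term -> FBo}, forall t w,
    th (bitens t w) = Te_co t *: w.
  apply: (@bitens_lift _ _ (Te_bimod X) _ _ (fun t w => Te_co t *: w)).
  - by move=> t t' w; rewrite Te_coD scalerDl.
  - by move=> t w w'; rewrite scalerDr.
  - by move=> b t w; rewrite scalerA Te_co_ract.
exists th; split=> //; elim/bitens_ind => [u v IHu IHv|t w].
  rewrite raddfB -[in RHS]IHu -[in RHS]IHv; apply/eqP; rewrite eq_sym subr_eq.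
  by rewrite -bitensDr subrK.
by rewrite thE -bitens_ract [X in bitens X]Te_ract_e.
Qed.

Lemma FT_Delta_exact x : FT_Delta x = 0 -> exists y, FT_Delta y = x.
Proof.
have [th [th_inv thE]] := FT_term_unit => Dx.
have thD u : th (FT_Delta u) = D (th u).
  elim/bitens_ind: u => [u v IHu IHv|t w]; last by rewrite FT_Delta_tens !thE linearZ_LR.
  by rewrite [FT_Delta _]linearB !raddfB /= IHu IHv.
have [|y Dy] := @Delta_exact (th x); first by rewrite -thD Dx raddf0.
by exists (bitens (Te_e R) y); rewrite FT_Delta_tens Dy th_inv.
Qed.

Lemma FT_acyclic : acyclic (FT F).
Proof.
move=> n x; split; first exact: FT_Delta_exact.
by move=> [y <-]; exact: FT_DeltaK.
Qed.

(** A T-linear map from T e_B (x) B (x) F_sum is determined by its values on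
    e (x) 1 (x) x, which form an R-linear map when R acts on T-modules through
    the scalar matrices; so it can be lifted along with that map. *)
Lemma FT_term_projective : is_projective FT_term.
Proof.
move=> M N p f ps.
pose c := [the {rmorphism R -> T} of @tri_const R].
pose rM : lmodType R := resmod M c; pose rN : lmodType R := resmod N c.
have pl : linear (p : rM -> rN) by move=> a x y; exact: linearP.
pose f0 (x : Fs) : rN := f (bitens (Te_e R) (bb 1 x)).
have e_const r w : tri_const r *: bitens (Te_e R) w = bitens (Te_e R) (cst r *: w) :> FT_term.
  by rewrite -bitens_ract bitensZ [X in _ = bitens X _]Te_const.
have f0l : linear f0.
  move=> r x y; rewrite /f0 !bitensDr linearD; congr (_ + _).
  rewrite resZ -linearZ_LR e_const; congr (f (bitens _ _)).
  by rewrite -bitens_ract bitensZ /= mulr1 mul1r.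
have [g0 pg0] := dsum_projective (fun k => free_projective (res_free F k))
  (mklin f0l) (p := mklin pl) ps.
have {}pg0 x : p (g0 x) = f0 x by exact: pg0.
have gZ r x : g0 (r *: x) = tri_const r *: (g0 x : M) by exact: linearZ_LR.
have [g1 g1E] : exists g1 : {additive FBo -> M},
    forall b x, g1 (bb b x) = tri_inc _ b *: (g0 x : M).
  apply: (@bitens_lift _ _ (dual_bimod R) _ _ (fun b x => tri_inc _ b *: (g0 x : M))).
  - by move=> b b' x; rewrite tri_incD; exact: scalerDl.
  - by move=> b x x'; rewrite [g0 _]linearD; exact: scalerDr.
  - by move=> r b x; rewrite gZ scalerA -tri_inc_const.
have g1Z (b : B) w : g1 (b *: w) = tri_inc _ b *: g1 w.
  elim/bitens_ind: w => [u v IHu IHv|b' x].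
    have -> : b *: (u - v : FBo) = b *: (u : FBo) - b *: (v : FBo) by exact: scalerBr.
    by rewrite !raddfB /= IHu IHv ?scalerBr.
  by rewrite bitensZ !g1E scalerA -tri_incM.
have [g2 g2E] : exists g2 : {additive FT_term -> M},
    forall t w, g2 (bitens t w) = (val (t : tri_Te _) : T) *: g1 w.
  apply: (@bitens_lift _ _ (Te_bimod X) _ _
    (fun t w => (val (t : tri_Te _) : T) *: g1 w)).
  - by move=> t t' w; rewrite [X in X *: _ = _]Te_valD scalerDl.
  - by move=> t w w'; rewrite raddfD; exact: scalerDr.
  - by move=> b t w; rewrite g1Z scalerA.
have g2l : linear g2.
  move=> a u v; rewrite raddfD /=; congr (_ + _).
  elim/bitens_ind: u => [u w IHu IHw|t w].
    have -> : a *: (u - w : FT_term) = a *: (u : FT_term) - a *: (w : FT_term) by exact: scalerBr.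
    by rewrite !raddfB /= IHu IHw ?scalerBr.
  by rewrite bitensZ !g2E [X in X *: _ = _]Te_valZ scalerA.
exists (mklin g2l); rewrite /=; elim/bitens_ind => [u v IHu IHv|t w].
  by rewrite !raddfB /= ?linearB IHu IHv.
rewrite g2E linearZ_LR; elim/bitens_ind: w => [u v IHu IHv|b x].
  have -> : bitens t (u - v) = bitens t u - bitens t v :> FT_term.
    by apply/eqP; rewrite eq_sym subr_eq -bitensDr subrK.
  by rewrite [f _]raddfB /= -IHu -IHv !raddfB /= ?linearB ?scalerBr.
rewrite g1E linearZ_LR pg0 /f0 scalerA -linearZ_LR; congr (f _).
rewrite bitensZ.
have -> : bb b x = b *: bb 1 x :> FBo by rewrite bitensZ /= mulr1.
rewrite -bitens_ract; congr bitens; exact: Te_inc_e.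
Qed.

Section StronglyGP.
Hypothesis FT_Delta_hom : forall (Q : lmodType T) (h : {linear FT_term -> Q}),
  is_projective Q -> (forall x, h (FT_Delta x) = 0) ->
  exists k : {linear FT_term -> Q}, forall x, k (FT_Delta x) = h x.

Lemma FT_totally_acyclic : totally_acyclic (FT F).
Proof.
split; first by move=> n; exact: FT_term_projective.
split; first exact: FT_acyclic.
move=> Q projQ n h; split=> [hD|[k kh] x]; first exact: FT_Delta_hom.
by rewrite -kh (FT_diffK (F := F)) linear0.
Qed.

Lemma modG_GP : GP (modG F).
Proof.
exists (FT F), 2; split; first exact: FT_totally_acyclic.
by exists idfun; exists idfun.
Qed.

(** The sequence 0 -> G -> F_T -> G -> 0 with second map Delta.  A map on G
    extends to F_T because its composite with Delta is a cocycle of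
    Hom(F_T, Q), hence has the form k Delta. *)
Lemma modG_strongly_GP : strongly_GP (modG F).
Proof.
have [p pE] : exists p : {linear FT_term -> modG F}, forall x, val (p x) = FT_Delta x.
  by apply: sub_lift => x; rewrite inE; apply/eqP; exact: FT_DeltaK.
pose i : {linear modG F -> FT_term} := sub_lin _.
have iE x : i x = val x by [].
have ip x : i (p x) = FT_Delta x by rewrite iE pE.
have Di x : FT_Delta (i x) = 0.
  by case: x => x Dx; have := Dx; rewrite ker_predE => /eqP.
have i_inj : injective i by exact: val_inj.
have ker_p x : p x = 0 -> exists y, i y = x.
  move=> px; have Dx : FT_Delta x = 0 by rewrite -ip px linear0.
  by have [y <-] := FT_Delta_exact Dx; exists (p y).
have p_surj : is_surj p.
  move=> y; have [x xy] := FT_Delta_exact (Di y); exists x; apply: i_inj.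
  by rewrite ip.
have pi y : p (i y) = 0 by apply: i_inj; rewrite ip Di linear0.
exists FT_term, i, p; split; first exact: FT_term_projective.
split=> //; split; first by move=> x; split=> [/ker_p //|[y <-]].
split=> // Q projQ; split; [|split].
- by move=> h h' hh' y; have [x <-] := p_surj y.
- move=> h; split=> [hi|[k kh] y]; last by rewrite -kh pi linear0.
  by apply: lin_factor => // x /ker_p[y <-].
- move=> h; have [|k kP] := @FT_Delta_hom _ (h \o p) projQ.
    by move=> x; rewrite -ip; exact: etrans (congr1 h (pi (p x))) (linear0 h).
  exists k => y; have [x <-] := p_surj y.
  by rewrite ip kP.
Qed.

End StronglyGP.

End TotalComplexExact.

(** * Tensor products with two right T-modules *)

Lemma addDB (V : zmodType) (a b : V) : a + b - a = b.
Proof. by rewrite addrAC subrr add0r. Qed.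

Section RightModules.
Variable R : comNzRingType.
Local Notation B := (dual R).
Local Notation T := (tri (aug_bimod R)).
Local Notation aug := (@dual_aug R).
Local Notation co1 := (@dual_co1 R).
Local Notation cst := (@dual_const R).
Local Notation eA := (tri_eA R).
Local Notation eB := (tri_eB R).
Local Notation tm := (tri_m R).
Local Notation teps := (tri_eps R).

Lemma tri_ind (P : T -> Prop) : (forall a m c, P (mk_tri a m c)) -> forall t, P t.
Proof. by move=> H [[a m] c]; exact: H. Qed.

(** The right T-module (R, R): row vectors multiplied by matrices, where B acts
    through the augmentation. *)
Definition row_mod : Type := (R * R)%type.
HB.instance Definition _ := GRing.Zmodule.on row_mod.
Definition row_scale (t : T^c) (e : row_mod) : row_mod :=
  (e.1 * (t : T).1.1 + e.2 * (t : T).1.2, e.2 * aug (t : T).2).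

Let row_scaleA (a b : T^c) e : row_scale a (row_scale b e) = row_scale (a * b) e.
Proof.
case: a b e => [[a m] c] [[a' m'] c'] [x y]; rewrite /row_scale /=.
congr (_, _); last by rewrite rmorphM mulrA.
by rewrite mulrDl mulrDr !mulrA addrA.
Qed.
Let row_scale1 : left_id 1 row_scale.
Proof. by move=> [x y]; rewrite /row_scale /= rmorph1 !mulr1 mulr0 addr0. Qed.
Let row_scaleDr : right_distributive row_scale +%R.
Proof.
move=> a [x y] [x' y']; congr (_, _); rewrite /= ?mulrDl //.
by rewrite addrACA.
Qed.
Let row_scaleDl e : {morph row_scale^~ e : a b / a + b}.
Proof.
move=> [[a m] c] [[a' m'] c']; congr (_, _) => /=; rewrite ?raddfD /= ?mulrDr //.
by rewrite addrACA.
Qed.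
HB.instance Definition _ := GRing.Zmodule_isLmodule.Build T^c row_mod
  row_scaleA row_scale1 row_scaleDr row_scaleDl.

Lemma row_modZ a m c x y :
  (mk_tri a m c : T^c) *: ((x, y) : row_mod) = (x * a + y * m, y * aug c) :> row_mod.
Proof. by []. Qed.

(** The right T-module (0, R), isomorphic to the right ideal eps T. *)
Definition end_mod : Type := R.
HB.instance Definition _ := GRing.Zmodule.on end_mod.
Definition end_scale (t : T^c) (e : end_mod) : end_mod := (e : R) * aug (t : T).2.

Let end_scaleA (a b : T^c) e : end_scale a (end_scale b e) = end_scale (a * b) e.
Proof.
by case: a b => [[a m] c] [[a' m'] c']; rewrite /end_scale /= rmorphM mulrA.
Qed.
Let end_scale1 : left_id 1 end_scale.
Proof. by move=> x; rewrite /end_scale /= rmorph1 mulr1. Qed.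
Let end_scaleDr : right_distributive end_scale +%R.
Proof. by move=> a x y; exact: mulrDl. Qed.
Let end_scaleDl e : {morph end_scale^~ e : a b / a + b}.
Proof.
by move=> [[a m] c] [[a' m'] c']; rewrite /end_scale /= raddfD /= mulrDr.
Qed.
HB.instance Definition _ := GRing.Zmodule_isLmodule.Build T^c end_mod
  end_scaleA end_scale1 end_scaleDr end_scaleDl.

Lemma end_modZ a m c (x : end_mod) :
  (mk_tri a m c : T^c) *: x = (x : R) * aug c :> end_mod.
Proof. by []. Qed.

Lemma mk_tri_eq a m c a' m' c' : a = a' -> m = m' -> c = c' ->
  mk_tri a m c = mk_tri a' m' c' :> T.
Proof. by move=> -> -> ->. Qed.

Lemma teps_mull (t : T) : t * teps = teps * mk_tri 0 0 t.2.
Proof.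
elim/tri_ind: t => a m c; rewrite !mk_triM; apply: mk_tri_eq; rewrite ?mulr0 //=.
by rewrite mulrC.
Qed.

Lemma tm_mull (t : T) : t * tm = tm * mk_tri (aug t.2) 0 0.
Proof.
elim/tri_ind: t => a m c; rewrite !mk_triM.
by apply: mk_tri_eq; rewrite ?mulr0 ?mul0r //= ?mulr1 ?mul1r ?add0r ?addr0.
Qed.

Lemma tri_char2 : 1 + 1 = 0 :> R -> 1 + 1 = 0 :> T^c.
Proof.
move=> R2; transitivity (tri_const (1 + 1 : R)); last by rewrite R2 rmorph0.
by rewrite rmorphD rmorph1.
Qed.

Lemma row_mod_fst a m c (e : row_mod) :
  ((mk_tri a m c : T^c) *: e).1 = e.1 * a + e.2 * m.
Proof. by []. Qed.

Lemma row_mod_eta (e : row_mod) : e = (e.1, ((tm : T^c) *: e).1).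
Proof. by case: e => x y; rewrite row_mod_fst /= mulr0 add0r mulr1. Qed.

(** Since the second coordinate of a row is the first coordinate of the row times
    m, a map to (R, R) is determined by its first coordinate. *)
Lemma row_mod_hom (N : lmodType T^c) (g : N -> R) :
  (forall x y, g (x + y) = g x + g y) ->
  (forall a m c n, g ((mk_tri a m c : T^c) *: n) = g n * a + g ((tm : T^c) *: n) * m) ->
  linear (fun n => (g n, g ((tm : T^c) *: n)) : row_mod).
Proof.
move=> gD gZ t n n'; rewrite scalerDr !gD scalerA.
rewrite (_ : (tm : T^c) * t = (mk_tri (aug t.2) 0 0 : T^c) * tm); last exact: tm_mull.
rewrite -scalerA; elim/tri_ind: t => a m c; rewrite (gZ a m c) (gZ _ 0 0).
by congr (_, _); rewrite mulr0 addr0.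
Qed.

Lemma tri_inc_scale_e (b : B) :
  tri_inc _ b *: (Te_e R : tri_Te (aug_bimod R)) = tri_Te_ract (Te_e R) b.
Proof.
apply: val_inj; transitivity (tri_inc (aug_bimod R) b * tri_inc _ 1 : T) => //.
transitivity (tri_inc (aug_bimod R) 1 * tri_inc _ b : T) => //.
by rewrite -!tri_incM mulr1 mul1r.
Qed.

Lemma tm_scale_e : tm *: (Te_e R : tri_Te (aug_bimod R)) = 0.
Proof.
apply: val_inj; transitivity (tm * tri_e _ : T) => //.
by rewrite tri_eE mk_triM; apply: mk_tri_eq; rewrite ?mul0r ?mulr0 ?addr0.
Qed.

Lemma Te_co_e : Te_co (Te_e R) = 1.
Proof. by []. Qed.

Section Radical.
Variable Y : lmodType T.

Definition epsY_pred : {pred Y} := [pred y | `[< exists s, y = teps *: s >]].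
Lemma epsY_predP y : reflect (exists s, y = teps *: s) (y \in epsY_pred).
Proof. exact: asboolP. Qed.
Lemma epsY_closed : subsemimod_closed epsY_pred.
Proof.
split; [split=> [|x y] | move=> a x].
- by apply/epsY_predP; exists 0; rewrite scaler0.
- move=> /epsY_predP[s ->] /epsY_predP[t ->].
  by apply/epsY_predP; exists (s + t); rewrite scalerDr.
- move=> /epsY_predP[s ->]; apply/epsY_predP.
  by exists (mk_tri 0 0 a.2 *: s); rewrite !scalerA teps_mull.
Qed.
Definition eps_submod : submodClosed Y :=
  HB.pack epsY_pred (GRing.isSubmodClosed.Build T Y epsY_pred epsY_closed).

(** The submodule J Y. *)
Definition rad_pred : {pred Y} :=
  [pred y | `[< exists u s, y = tm *: u + teps *: s >]].
Lemma rad_predP y : reflect (exists u s, y = tm *: u + teps *: s) (y \in rad_pred).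
Proof. exact: asboolP. Qed.
Lemma rad_closed : subsemimod_closed rad_pred.
Proof.
split; [split=> [|x y] | move=> a x].
- by apply/rad_predP; exists 0, 0; rewrite !scaler0 addr0.
- move=> /rad_predP[u [s ->]] /rad_predP[v [t ->]].
  by apply/rad_predP; exists (u + v), (s + t); rewrite !scalerDr addrACA.
- move=> /rad_predP[u [s ->]]; apply/rad_predP.
  exists (mk_tri (aug a.2) 0 0 *: u), (mk_tri 0 0 a.2 *: s).
  by rewrite scalerDr !scalerA teps_mull tm_mull.
Qed.
Definition rad_submod : submodClosed Y :=
  HB.pack rad_pred (GRing.isSubmodClosed.Build T Y rad_pred rad_closed).

Lemma row_tens_unit (xi : tensor row_mod Y) :
  exists w, xi = tens ((0, 1) : row_mod) w.
Proof.
elim/tensor_ind: xi => [_ _ [u ->] [v ->]|[x y] w].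
  by exists (u - v); apply/eqP; rewrite subr_eq -tensDr subrK.
exists (mk_tri 0 x (cst y) *: w); rewrite -tensZ row_modZ.
by rewrite mulr0 add0r !mul1r dual_aug_const.
Qed.

(** (R, R) (x)_T Y is e_B Y / eps e_B Y: the row (r, s) pairs with y to the class
    of the matrix with bottom row (r, s) times y. *)
Lemma row_tens_eq0 (v : Y) : tens ((0, 1) : row_mod) v = 0 ->
  exists s, eB *: v = teps *: s.
Proof.
pose f (e : row_mod) (y : Y) : quotmod eps_submod :=
  quotmod_pi eps_submod (mk_tri 0 e.1 (cst e.2) *: y).
have fDl e e' y : f (e + e') y = f e y + f e' y.
  rewrite /f -quotmod_piD -scalerDl mk_triD; congr (quotmod_pi _ (_ *: _)).
  by apply: mk_tri_eq; rewrite ?addr0 //= raddfD.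
have fDr e y y' : f e (y + y') = f e y + f e y'.
  by rewrite /f -quotmod_piD -scalerDr.
have fZ (a : T) e y : f ((a : T^c) *: e) y = f e (a *: y).
  apply/quotmod_piP/epsY_predP; case: e => r s; elim/tri_ind: a => a m c.
  rewrite row_modZ scalerA -scalerBl /= mk_triM mk_triB.
  exists (mk_tri 0 0 (- cst (s * co1 c)) *: y); rewrite scalerA mk_triM; congr (_ *: _).
  apply: mk_tri_eq; rewrite ?mul0r ?mulr0 ?addr0 ?subrr //.
    by rewrite dual_aug_const subrr.
  rewrite [in X in _ - X](dual_decomp c) mulrDr rmorphM /= opprD addrA subrr add0r.
  by rewrite mulrN rmorphM /= mulrA mulrC.
move=> v0; have f0 : tensor_lift f 0 = 0.
  rewrite -[X in tensor_lift f X](subrr 0).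
  by rewrite (tensor_lift_zmod_morphism fDl fDr fZ) subrr.
have : pi_lin eps_submod (eB *: v) = 0.
  rewrite -[RHS]f0 -v0 (tensor_lift_tens fDl fDr fZ).
  by rewrite /f /= rmorph1.
by move=> /pi_lin_eq0/epsY_predP.
Qed.

(** (0, R) (x)_T Y is e_B Y modulo J Y. *)
Lemma end_tens_eq0 (v : Y) : tens (1 : end_mod) v = 0 ->
  exists u s, eB *: v = tm *: u + teps *: s.
Proof.
pose f (e : end_mod) (y : Y) : quotmod rad_submod :=
  quotmod_pi rad_submod (mk_tri 0 0 (cst e) *: y).
have fDl e e' y : f (e + e') y = f e y + f e' y.
  rewrite /f -quotmod_piD -scalerDl mk_triD; congr (quotmod_pi _ (_ *: _)).
  by apply: mk_tri_eq; rewrite ?addr0 //= raddfD.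
have fDr e y y' : f e (y + y') = f e y + f e y'.
  by rewrite /f -quotmod_piD -scalerDr.
have fZ (a : T) e y : f ((a : T^c) *: e) y = f e (a *: y).
  apply/quotmod_piP/rad_predP; elim/tri_ind: a => a m c.
  rewrite end_modZ scalerA -scalerBl /= mk_triM mk_triB.
  exists (mk_tri (- (e * m)) 0 0 *: y), (mk_tri 0 0 (- cst (e * co1 c)) *: y).
  rewrite !scalerA -scalerDl !mk_triM mk_triD; congr (_ *: _).
  apply: mk_tri_eq; rewrite ?mul0r ?mulr0 ?addr0 ?add0r ?subrr ?oppr0 //.
    by rewrite dual_aug_const mul1r.
  rewrite [in X in _ - X](dual_decomp c) mulrDr rmorphM /= opprD addrA subrr add0r.
  by rewrite mulrN rmorphM /= mulrA mulrC.
move=> v0; have f0 : tensor_lift f 0 = 0.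
  rewrite -[X in tensor_lift f X](subrr 0).
  by rewrite (tensor_lift_zmod_morphism fDl fDr fZ) subrr.
have : pi_lin rad_submod (eB *: v) = 0.
  rewrite -[RHS]f0 -v0 (tensor_lift_tens fDl fDr fZ).
  by rewrite /f /= rmorph1.
by move=> /pi_lin_eq0/rad_predP.
Qed.

End Radical.

(** This is the vanishing of Tor_1((R, R), Y), computed from the resolution that
    begins with eps T -> e_B T -> (R, R). *)
Definition eps_exact (Y : lmodType T) : Prop := forall y : Y, teps *: y = 0 ->
  exists u s, eB *: y = tm *: u + teps *: s.

(** The inclusion of (0, R) = eps T into T sends 1 (x) y to 1 (x) eps y = 0,
    so 1 (x) y = 0 by flatness. *)
Lemma flat_eps_exact (Y : lmodType T) : is_flat Y -> eps_exact Y.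
Proof.
move=> flatY y y0; apply: end_tens_eq0.
pose i (r : end_mod) : (T^c)^o := mk_tri 0 0 (cst r * eps R).
have il : linear i.
  move=> a r s; rewrite /i; elim/tri_ind: a => a m c.
  rewrite end_modZ; apply: etrans (_ : _ = mk_tri 0 0 (cst r * eps R) * mk_tri a m c
    + mk_tri 0 0 (cst s * eps R)) _ => //.
  rewrite mk_triM mk_triD; apply: mk_tri_eq; rewrite ?mul0r ?addr0 //.
    by rewrite rmorphM /= dual_aug_eps mulr0 mul0r addr0.
  rewrite raddfD /= mulrDl rmorphM /= [in RHS](dual_decomp c) mulrDr; congr (_ + _).
  rewrite [X in _ + X]mulrACA -!mulrA eps2 !mulr0 addr0; congr (_ * _).
  exact: mulrC.
have i_inj : injective i.
  move=> r s /(congr1 (fun t : T => co1 t.2)) /=; rewrite !dual_co1M !dual_aug_const dual_co1_eps.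
  by rewrite dual_aug_eps !mulr1 !mulr0 !addr0.
have := flatY _ _ (mklin il) i_inj (tens (1 : end_mod) y) 0; apply; rewrite tensor_mapE raddf0.
rewrite /= /i rmorph1 mul1r.
have -> : mk_tri 0 0 (eps R) = (teps : T^c) *: (1 : (T^c)^o) :> (T^c)^o.
  by rewrite [RHS]mul1r.
rewrite tensZ /= y0; apply: (addrI (tens (1 : (T^c)^o) 0)).
by rewrite -tensDr !addr0.
Qed.

Lemma row_tensor_acyclic_eps (Y : complex T) :
  tensor_acyclic (row_mod : lmodType T^c) Y ->
  forall n (v : Y (n + 1)) t, cdiff Y (n + 1) v = teps *: t ->
  exists w s, eB *: v = cdiff Y n w + teps *: s.
Proof.
move=> exY n v t dv.
have : tensor_map (@idfun row_mod) (cdiff Y (n + 1)) (tens ((0, 1) : row_mod) v) = 0.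
  rewrite tensor_mapE /= dv -tensZ row_modZ !mulr0 addr0 dual_aug_eps mulr0.
  by apply: (addrI (tens (0 : row_mod) t)); rewrite -tensDl !addr0.
move=> /exY[xi]; have [w ->] := row_tens_unit xi.
rewrite tensor_mapE /= => e.
have : tens ((0, 1) : row_mod) (v - cdiff Y n w) = 0.
  by apply: (addIr (tens ((0, 1) : row_mod) (cdiff Y n w))); rewrite -tensDr subrK add0r.
move=> /row_tens_eq0[s es]; exists (eB *: w), s.
rewrite -es linearZ_LR scalerBr; apply/esym; exact: subrKC.
Qed.

(** Write m = d u.  Then eps u is a cocycle, eps u = d v, and v is a cycle modulo
    eps; by exactness modulo eps it can be corrected so that eps u = d (eps t).
    Hence eps kills u - d t, whose component in e_B Y lies in J Y because the terms
    are [eps_exact]; applying d expresses that component of m through cocycles. *)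
Lemma cocycle_eps_exact (Y : complex T) : (forall n, eps_exact (Y n)) -> acyclic Y ->
  tensor_acyclic (row_mod : lmodType T^c) Y -> forall n, eps_exact (cocycle Y n).
Proof.
move=> flY exY /row_tensor_acyclic_eps acY n.
(* The elements u, v and w below live one, two and three degrees below n. *)
have -> : n = n - 3 + 1 + 1 + 1 by rewrite -!addrA -[X in n + X]/(0 : int) addr0.
move: (n - 3) => {}n [m dm] /(congr1 val)/= em.
have /exY[u du] : cdiff Y _ m = 0 by have := dm; rewrite ker_predE => /eqP.
have /exY[v dv] : cdiff Y _ (teps *: u) = 0 by rewrite linearZ_LR /= du em.
have [w [t et]] := acY _ _ _ dv.
have eBeps : eB * teps = teps.
  by rewrite mk_triM; apply: mk_tri_eq; rewrite ?mulr0 ?mul0r ?mul1r ?addr0.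
have : teps *: (u - cdiff Y _ t) = 0.
  rewrite scalerBr -linearZ_LR -[teps *: t]/(teps *: t).
  have <- : eB *: v - cdiff Y n w = teps *: t by rewrite et addDB.
  by rewrite linearB cdiffK subr0 linearZ_LR /= dv scalerA eBeps subrr.
move=> /flY[y1 [s ys]].
have cy (y : Y (n + 1 + 1)) : cdiff Y _ y \in ker_pred (cdiff Y (n + 1 + 1 + 1)).
  by rewrite inE cdiffK.
exists (Submod (cy y1)), (Submod (cy s)); apply: val_inj => /=.
rewrite -!linearZ_LR -linearD -ys linearZ_LR /= linearB cdiffK subr0 du.
by [].
Qed.

Lemma iso_eps_exact (M N : lmodType T) : iso_mod M N -> eps_exact N -> eps_exact M.
Proof.
move=> [f [g fg gf]] exN y ey.
have [|u [s us]] := exN (f y); first by rewrite -linearZ_LR ey linear0.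
exists (g u), (g s); apply: (can_inj fg).
by rewrite linearZ_LR us linearD !linearZ_LR /= !gf.
Qed.

Lemma frm_coords2 (L : choiceType) (y : frm T L) (a b c : T) (p q : T -> T) :
  (forall l, a * y l = b * p (y l) + c * q (y l)) ->
  exists u s, a *: y = b *: u + c *: s.
Proof.
move=> H; have [s us ys] := dsum_supp y.
exists (\sum_(l <- s) p (y l) *: fvec T l), (\sum_(l <- s) q (y l) *: fvec T l).
have -> : y = \sum_(l <- s) (y l : T) *: fvec T l by apply: fr_sum => // l; rewrite ys.
rewrite !scaler_sumr -big_split; apply: eq_bigr => l _ /=.
by rewrite -fr_sum // ?scalerA ?H ?scalerDl // => k; rewrite ys.
Qed.

(** For T itself eps t = 0 means that the lower right entry of t lies in eps B;
    the property passes to free modules by coordinates, and to retracts. *)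
Lemma projective_eps_exact (P : lmodType T) : is_projective P -> eps_exact P.
Proof.
move=> /projective_retract[i [r ri]] y ey.
have iy : teps *: i y = 0 by rewrite -linearZ_LR ey linear0.
have [|u [s us]] := @frm_coords2 _ (i y) eB tm teps (fun t => mk_tri t.1.2 0 0)
    (fun t => mk_tri 0 0 (cst (co1 t.2))).
  move=> l; have : teps * (i y l : T) = 0.
    by have := congr1 (dsum_proj (fun _ : P => T^o : lmodType T) l) iy.
  elim/tri_ind: (i y l : T) => a m c.
  rewrite !mk_triM mk_triD => /(congr1 (fun t : T => co1 t.2)) ec.
  apply: mk_tri_eq; rewrite /= ?mul0r ?mulr0 ?addr0 //.
    by rewrite add0r rmorph1.
  have c0 : aug c = 0.
    have e : co1 (eps R * c) = co1 0 by exact: ec.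
    by move: e; rewrite dual_co1M dual_co1_eps dual_aug_eps mul0r mul1r add0r raddf0.
  by rewrite mul1r add0r [LHS]dual_decomp c0 raddf0 add0r mulrC.
exists (r u), (r s).
by have := congr1 r us; rewrite linearD !linearZ_LR /= ri.
Qed.

Lemma projective_m_eps (P : lmodType T) (u t : P) : is_projective P ->
  tm *: u = teps *: t -> eA *: u = 0.
Proof.
move=> /projective_retract[i [r ri]] ut.
suff iu : eA *: i u = 0 by rewrite -[LHS]ri linearZ_LR iu linear0.
apply: dsumP => l; rewrite dsum0E dsumZE.
have : tm * (i u l : T) = teps * (i t l : T).
  have := congr1 (dsum_proj (fun _ : P => T^o : lmodType T) l \o i) ut.
  by rewrite /= !linearZ_LR.
rewrite -[_ *: _]/(eA * (i u l : T)).
elim/tri_ind: (i u l : T) => a m c; elim/tri_ind: (i t l : T) => a' m' c'.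
rewrite !mk_triM => /(congr1 (fun t : T => t.1.2)) e.
have {}e : 1 * a + aug 0 * m = 0 * a' + aug (eps R) * m' by exact: e.
have a0 : a = 0.
  by move: e; rewrite raddf0 dual_aug_eps !mul0r mul1r !addr0.
by rewrite a0 raddf0 mulr0 !mul0r addr0.
Qed.

End RightModules.

(** * The right module (R, R) is injective, and G is not Gorenstein flat *)

Section ExtendF2.
Variables (M N : zmodType) (i : {additive M -> N}) (phi : {additive M -> 'F_2}).
Hypotheses (N2 : forall n : N, n + n = 0) (i_inj : injective i).

(** If phi m0 = 1, a subgroup that is maximal among those containing i (ker phi)
    and missing i m0 has index 2; the extension is its characteristic map.  The
    empty set is admitted below only so that empty chains have a bound. *)
Lemma extend_F2 : exists psi : N -> 'F_2,
  (forall x y, psi (x + y) = psi x + psi y) /\ forall m, psi (i m) = phi m.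
Proof.
have [phi0|/existsNP[m0 /eqP phim0]] := pselect (forall m, phi m = 0).
  by exists (fun _ => 0); split=> [x y|m]; rewrite ?addr0 ?phi0.
have {}phim0 : phi m0 = 1 by have [e|//] := F2_cases (phi m0); rewrite e eqxx in phim0.
pose H0 : set N := [set i m | m in [set m | phi m = 0]]%classic.
pose P (A : set N) := (A = set0 \/
  [/\ H0 `<=` A, forall x y, A x -> A y -> A (x + y) & ~ A (i m0)])%classic.
have [A [PA Amax]] : exists A, P A /\ forall B, (A `<` B)%classic -> ~ P B.
  apply: Zorn_bigcup => C CP Ctot.
  have [C0|/existsNP[A0 /not_implyP[CA0 A0n]]] :=
      pselect (forall A, C A -> A = set0).
    by left; apply/seteqP; split=> // x [A CA]; rewrite (C0 _ CA).
  have [//|[H0A0 _ _]] := CP _ CA0.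
  right; split.
  - by move=> x H0x; exists A0 => //; exact: H0A0.
  - move=> x y [A CA Ax] [B CB By].
    have [AB|BA] := Ctot _ _ CA CB.
      exists B => //; have [B0|[_ + _]] := CP _ CB; first by rewrite B0 in By.
      by apply => //; exact: AB.
    exists A => //; have [A_0|[_ + _]] := CP _ CA; first by rewrite A_0 in Ax.
    by apply => //; exact: BA.
  - by move=> [A CA Am]; have [A_0|[_ _ /(_ Am)]//] := CP _ CA; rewrite A_0 in Am.
have H0P : P H0.
  right; split=> //.
  - move=> _ _ [m /= em <-] [n /= en <-]; exists (m + n); rewrite /= raddfD //=.
    by rewrite em en addr0.
  - by move=> [m /= em /i_inj mm0]; move: phim0; rewrite -mm0 em => /esym/eqP; rewrite oner_eq0.
have [A0|[H0A AD Am0]] := PA.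
  exfalso; apply: (Amax H0) => //; split; first by rewrite A0.
  by rewrite A0; move=> /(_ 0); apply; exists 0; rewrite /= raddf0.
have A0 : A 0 by apply: H0A; exists 0; rewrite /= raddf0.
have im02 : i m0 + i m0 = 0 by exact: N2.
have Acos n : ~ A n -> A (n + i m0).
  move=> nA; apply: contrapT => nA'.
  (* If n + i m0 is outside A, then A together with its coset by n is a larger
     subgroup that still misses i m0. *)
  pose A' : set N := (A `|` [set x | A (x + n)])%classic.
  apply: (Amax A').
    split; first by move=> x; left.
    by move=> /(_ n); move=> h; apply/nA/h; right; rewrite /= N2.
  right; split; first by move=> x /H0A; left.
    move=> x y [Ax|/= Ax] [Ay|/= Ay].
    - by left; exact: AD.
    - by right; rewrite /= -addrA; exact: AD.
    - by right; rewrite /= addrAC; exact: AD.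
    - by left; rewrite -[x + y]addr0 -(N2 n) addrACA; exact: AD.
  by move=> [//|]; rewrite /= addrC.
pose psi n : 'F_2 := if `[< A n >] then 0 else 1.
have psi0 n : A n -> psi n = 0 by rewrite /psi; case: asboolP.
have psi1 n : ~ A n -> psi n = 1 by rewrite /psi; case: asboolP.
have AB x y : A (x + y) -> A y -> A x.
  by move=> Axy Ay; rewrite -[x]addr0 -(N2 y) addrA; exact: AD.
exists psi; split.
- move=> x y; have [Ax|nAx] := pselect (A x); have [Ay|nAy] := pselect (A y).
  + by rewrite !psi0 ?addr0 //; exact: AD.
  + rewrite (psi0 x) // add0r !psi1 // => Axy; apply: nAy.
    by apply: (AB y x) => //; rewrite addrC.
  + rewrite (psi0 y) // addr0 !psi1 // => Axy; apply: nAx.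
    exact: AB Axy Ay.
  + rewrite (psi1 x) // (psi1 y) // psi0.
      by apply: val_inj.
    rewrite -[x + y]addr0 -im02 addrACA; apply: AD; exact: Acos.
- move=> m; have [e|e] := F2_cases (phi m); rewrite e.
    by apply: psi0; apply: H0A; exists m.
  apply: psi1 => Am; apply: Am0.
  have : A (i m0 + i m) by rewrite -raddfD; apply: H0A; exists (m0 + m) => //=;
    rewrite raddfD /= phim0 e; apply: val_inj.
  by move=> /AB; apply.
Qed.

End ExtendF2.

Section RowInjective.
Variable X : pointedType.
Local Notation R := (ringR X).
Local Notation T := (ringT X).
Local Notation eA := (tri_eA R).
Local Notation tm := (tri_m R).

Let row_mod_aux1 x : tm * mk_tri (dirac x) 0 0 = mk_tri 0 (dirac x) 0 :> T.
Proof.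
rewrite mk_triM; apply: mk_tri_eq; rewrite ?mul0r ?mulr0 //.
by rewrite mul1r addr0.
Qed.

Let row_mod_aux2 x (a m : R) (c : ringB X) : mk_tri a m c * mk_tri (dirac x) 0 0 =
  mk_tri (dirac x * a) 0 0 + mk_tri 0 (dirac x * m) 0 :> T.
Proof.
rewrite mk_triM mk_triD; apply: mk_tri_eq; rewrite ?addr0 ?mulr0 //.
  exact: mulrC.
by rewrite ?mulr0 ?addr0 ?add0r mulrC.
Qed.

Let row_mod_aux3 x (a b : R) : (a * dirac x + b * 0) x = a x.
Proof. by rewrite mulr0 addr0 mulrC diracM eqxx. Qed.

(** The first coordinate of a map to (R, R) is a family of additive maps to F_2
    indexed by X.  Each of them extends, and evaluating the extension after the
    idempotent of the point x makes the family R-linear again. *)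
Lemma row_mod_injective : is_injective (row_mod R : lmodType T^c).
Proof.
move=> M N i f i_inj.
have N2 (n : N) : n + n = 0.
  rewrite -[n]scale1r -scalerDl; have -> : 1 + 1 = 0 :> T^c; last exact: scale0r.
  have R2 : 1 + 1 = 0 :> R by apply: funext => x; apply: val_inj.
  exact: tri_char2.
pose phi x (m : M) : 'F_2 := (f m).1 x.
have phiB x : zmod_morphism (phi x) by move=> m n; rewrite /phi raddfB.
pose phi' x : {additive M -> 'F_2} :=
  HB.pack (phi x) (GRing.isZmodMorphism.Build _ _ (phi x) (phiB x)).
have /choice[psi psiP] x := extend_F2 (phi' x) N2 i_inj.
have psiD x := (psiP x).1.
have psiE x m : psi x (i m) = (f m).1 x := (psiP x).2 m.
pose u x : T := mk_tri (dirac x) 0 0.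
pose v x : T := mk_tri 0 (dirac x) 0.
pose act (t : T) (n : N) : N := (t : T^c) *: n.
have actM s t n : act s (act t n) = act (t * s) n by exact: scalerA.
have actD s t n : act (s + t) n = act s n + act t n by exact: scalerDl.
have actDr s n n' : act s (n + n') = act s n + act s n' by exact: scalerDr.
have act0 n : act 0 n = 0 by exact: scale0r.
have psi0 x : psi x 0 = 0 by apply: (addrI (psi x 0)); rewrite -psiD !addr0.
pose g1 (n : N) : R := fun x => psi x (act (u x) n).
have g1D m n : g1 (m + n) = g1 m + g1 n.
  by apply: funext => x; rewrite /g1 actDr psiD.
have cut x (a : R) (k : R -> T) : k (dirac x * a) = k (if a x == 0 then 0 else dirac x).
  congr k; case: eqP => ax; last have {}ax : a x = 1 by have [] := F2_cases (a x).
    by rewrite -[RHS](mulr0 (dirac x)); exact/diracP.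
  by rewrite -[RHS]mulr1; exact/diracP.
have g1Z a m c n : g1 (act (mk_tri a m c) n) = g1 n * a + g1 (act tm n) * m.
  apply: funext => x; rewrite [RHS]/(g1 n x * a x + g1 (act tm n) x * m x).
  rewrite /g1 (actM (u x) (mk_tri a m c) n) (actM (u x) tm n).
  have -> : tm * u x = v x by exact: row_mod_aux1.
  have -> : mk_tri a m c * u x =
      mk_tri (dirac x * a) 0 0 + mk_tri 0 (dirac x * m) 0 by exact: row_mod_aux2.
  rewrite (cut x a (fun b => mk_tri b 0 0)) (cut x m (fun b => mk_tri 0 b 0)).
  rewrite actD psiD; congr (_ + _).
    by have [->|->] := F2_cases (a x); rewrite /= ?mulr0 ?mulr1 // act0 psi0.
  by have [->|->] := F2_cases (m x); rewrite /= ?mulr0 ?mulr1 // act0 psi0.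
have gi m : (g1 (i m), g1 ((tm : T^c) *: i m)) = f m.
  have e1 n : g1 (i n) = (f n).1.
    apply: funext => x; rewrite /g1 /act -linearZ_LR psiE linearZ_LR row_mod_fst.
    exact: row_mod_aux3.
  by rewrite e1 -linearZ_LR e1 linearZ_LR -row_mod_eta.
by exists (mklin (row_mod_hom g1D g1Z)).
Qed.

End RowInjective.

Section NotGorensteinFlat.
Variables (X : pointedType) (U : set_system X) (hU : UltraFilter U).
Variable F : free_resolution (modS hU).
Local Notation R := (ringR X).
Local Notation B := (ringB X).
Local Notation T := (ringT X).
Local Notation aug := (@dual_aug R).
Local Notation co1 := (@dual_co1 R).
Local Notation cst := (@dual_const R).
Local Notation FT_term := (FT_term F).
Local Notation FBo := (FB_obj F).
Local Notation Fs := (Fsum F).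
Local Notation D := (Delta F).
Local Notation FT_Delta := (FT_Delta F).
Local Notation bb b x := (bitens (b : dual_bimod R) x).

(** The coordinates of B (x) F_sum = F_sum + eps F_sum. *)
Lemma Delta_coordinates : exists c0 c1 : {additive FBo -> Fs},
  [/\ forall t, c1 (D t) = c0 t + partial (c1 t),
      forall t, c1 (eps R *: t) = c0 t & forall x, c1 (bb (eps R) x) = x].
Proof.
have [c0 c0E] : exists c0 : {additive FBo -> Fs}, forall b x, c0 (bb b x) = aug b *: x.
  apply: (@bitens_lift _ _ (dual_bimod R) _ _ (fun b x => aug b *: x)).
  - by move=> b c x; rewrite raddfD; exact: scalerDl.
  - by move=> b x y; exact: scalerDr.
  - by move=> r b x; rewrite scalerA /= rmorphM /= dual_aug_const.
have [c1 c1E] : exists c1 : {additive FBo -> Fs}, forall b x, c1 (bb b x) = co1 b *: x.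
  apply: (@bitens_lift _ _ (dual_bimod R) _ _ (fun b x => co1 b *: x)).
  - by move=> b c x; rewrite raddfD; exact: scalerDl.
  - by move=> b x y; exact: scalerDr.
  - move=> r b x; rewrite scalerA /= dual_co1M dual_co1_const dual_aug_const.
    by rewrite mulr0 add0r.
exists c0, c1; split.
- elim/bitens_ind => [u v IHu IHv|b x].
    rewrite [D (u - v)]raddfB [c1 (_ - _)]raddfB /= IHu IHv.
    by rewrite [c0 (u - v)]raddfB [c1 (u - v)]raddfB [partial (_ - _)]raddfB addrBB.
  rewrite DeltaE [c1 _]raddfD /= !c1E c0E linearZ_LR; congr (_ *: _ + _).
  by rewrite dual_co1M dual_aug_eps dual_co1_eps mulr0 mulr1 addr0.
- elim/bitens_ind => [u v IHu IHv|b x].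
    have -> : eps R *: (u - v : FBo) = eps R *: (u : FBo) - eps R *: (v : FBo).
      exact: scalerBr.
    by rewrite [c1 _]raddfB /= IHu IHv [RHS]raddfB.
  rewrite bitensZ c1E c0E /= dual_co1M dual_aug_eps dual_co1_eps.
  by rewrite mul0r mul1r add0r.
- by move=> x; rewrite c1E dual_co1_eps scale1r.
Qed.

Lemma modS_neq0 : exists s : modS hU, s <> 0.
Proof.
exists (pi_lin (ideal_m hU) 1) => /pi_lin_eq0/m_predP; apply.
by apply: filterS filterT => x _; exact: (oner_neq0 'F_2).
Qed.

Lemma tri_inc_Te (b : B) (w : FBo) :
  tri_inc _ b *: (bitens (Te_e R) w : FT_term) = bitens (Te_e R) (b *: w).
Proof. by rewrite bitensZ -bitens_ract; congr bitens; exact: tri_inc_scale_e. Qed.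

(** Take y in F^0 above a nonzero element of S.  Then e (x) eps (x) y is a cocycle
    killed by eps.  If it were eps g with g a cocycle, the coordinates of g would
    give y = d z for some z, and y would vanish in S. *)
Lemma modG_not_eps_exact : ~ eps_exact (modG F : lmodType T).
Proof.
have [s s0] := modS_neq0; have [x0 x0s] := res_aug_surj F s.
pose y : Fs := dsum_in (F : nat -> lmodType R) 0%N x0.
have dy : partial y = 0.
  apply: dsumP => k; have yk : y k.+1 = 0 by exact: dsum_in_out.
  by apply: etrans (congr1 (res_d F k) yk) (linear0 _).
have [c0 [c1 [c1D c1e c1y]]] := Delta_coordinates.
have [th [th_inv thE]] := FT_term_unit F.
pose z0 : FT_term := bitens (Te_e R) (bb (eps R) y).
have Dz : FT_Delta z0 = 0.
  by rewrite FT_Delta_tens DeltaE dy bitens0r addr0 eps2 bitens0l bitens0r.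
have Gz : z0 \in ker_pred (FT_diff F 2) by rewrite ker_predE; apply/eqP.
pose z : modG F := Submod Gz.
move=> /(_ z)[].
  apply: val_inj; rewrite [LHS]tri_inc_Te bitensZ.
  by rewrite [X in bitens _ (bitens X _)]eps2 bitens0l bitens0r.
move=> [u Hu] [[g Gg]] /(congr1 val) e.
have {}e : tri_inc _ 1 *: z0 = tri_m R *: u + tri_inc _ (eps R) *: g by exact: e.
have mu : tri_m R *: u = 0.
  rewrite -(th_inv u) bitensZ; apply: etrans (bitens0l _ _).
  by congr bitens; exact: tm_scale_e.
move: e; rewrite mu add0r tri_inc_Te scale1r -{1}(th_inv g) tri_inc_Te.
move=> /(congr1 th); rewrite !thE Te_co_e !scale1r => /(congr1 c1).
rewrite c1y c1e => yg.
have Dg : D (th g) = 0.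
  have : FT_Delta g = 0 by move: Gg; rewrite ker_predE => /eqP.
  rewrite -{1}(th_inv g) FT_Delta_tens => /(congr1 th).
  by rewrite thE Te_co_e scale1r raddf0.
have := c1D (th g); rewrite Dg raddf0 -yg => /esym/eqP.
rewrite addr_eq0 -linearN => /eqP/(congr1 (fun x : Fs => x 0%N)).
rewrite [LHS]dsum_in_in => ex; apply: s0; rewrite -x0s.
by apply/(@res_exact0 _ _ F); eexists; exact: esym ex.
Qed.

Lemma GF_eps_exact (M : lmodType T) : GF M -> eps_exact M.
Proof.
move=> [Y [n [flatY [[exY tenY] isoM]]]]; apply: iso_eps_exact isoM _.
apply: cocycle_eps_exact => //; first by move=> k; exact: flat_eps_exact.
exact/tenY/row_mod_injective.
Qed.

Lemma PGF_eps_exact (M : lmodType T) : PGF M -> eps_exact M.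
Proof.
move=> [Y [n [projY [[exY tenY] isoM]]]]; apply: iso_eps_exact isoM _.
apply: cocycle_eps_exact => //; first by move=> k; exact: projective_eps_exact.
exact/tenY/row_mod_injective.
Qed.

End NotGorensteinFlat.

(** * Acyclic complexes of projectives over a power of F_2 *)

Section CountableSplitting.
Variables (X : Type) (A : pzRingType) (d : X -> A).
Hypotheses (dF : fibred d) (d2 : forall x a, d x * a = 0 \/ d x * a = d x).
Variables (N : lmodType A) (p : {linear frm A nat -> N}).
Hypothesis Nsep : forall n : N, (forall x, d x *: n = 0) -> n = 0.

Let fvec := @fvec A nat.
(** Linear algebra over F_2 is carried out at all points of X simultaneously: over
    x, the reduced vectors are those that avoid the generators depending there on
    earlier ones.  Each vector is congruent to exactly one reduced vector modulo the
    kernel of p. *)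
Let dep j x := exists c : nat -> A, d x *: p (fvec j) = d x *: \sum_(i < j) c i *: p (fvec i).
Let red (y : frm A nat) := forall j x, dep j x -> d x * (y j : A) = 0.

Let redD y z : red y -> red z -> red (y + z).
Proof. by move=> ry rz j x jx; rewrite [_ * _]mulrDr ry // rz // addr0. Qed.

Let redZ a y : red y -> red (a *: y).
Proof.
move=> ry j x jx; rewrite -[X in _ * X]/(a * (y j : A)).
by rewrite mulrA (fib_C dF) -mulrA ry // mulr0.
Qed.

Let red0 : red 0.
Proof. by move=> j x _; exact: mulr0. Qed.

Let red_uniq0 y : red y -> p y = 0 -> y = 0.
Proof.
move=> ry py.
have supp n : (forall l, (n <= l)%N -> y l = 0) -> y = 0.
  elim: n => [|n IHn] yn; first by apply: dsumP => l; exact: yn.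
  apply: IHn => l; rewrite leq_eqVlt => /orP[/eqP<-{l}|/yn//].
  apply: (fib_sep dF) => x; have [//|yx] := d2 x (y n).
  apply: ry; exists (fun i => - y i : A).
  have ey : y = \sum_(i < n.+1) (y i : A) *: fvec i.
    rewrite -(big_mkord xpredT (fun i => (y i : A) *: fvec i)).
    apply: fr_sum; first exact: iota_uniq.
    move=> l; apply: contraNT; rewrite mem_index_iota /= -leqNgt => nl.
    by rewrite yn.
  have : d x *: p (\sum_(i < n.+1) (y i : A) *: fvec i) = 0 by rewrite -ey py scaler0.
  rewrite linear_sum big_ord_recr /= linearZ_LR scalerDr scalerA yx => /eqP; rewrite addrC addr_eq0 => /eqP ->.
  rewrite -scalerN -sumrN; congr (_ *: _); apply: eq_bigr => i _.
  by rewrite linearZ_LR; apply/esym; exact: scaleNr.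
have [s us ys] := dsum_supp y.
apply: (supp (\max_(l <- s) l).+1) => l; rewrite ltnNge => ls.
apply/eqP; apply: contraNT ls; rewrite ys => sl.
exact: (@leq_bigmax_seq _ s xpredT id).
Qed.

Let red_ex y : exists2 z, red z & p z = p y.
Proof.
elim/frm_ind: y => [|y z [y' ry py] [z' rz pz]|a n]; first by exists 0.
  by exists (y' + z'); [exact: redD | rewrite !linearD py pz].
elim/ltn_ind: n a => n IHn a.
(* e is the indicator of the points where the generator n is independent. *)
have [e eP] := fib_glue dF (fun x => if `[< dep n x >] then 0 else 1).
have /choice[cc ccP] x : exists c : nat -> A, dep n x ->
    d x *: p (fvec n) = d x *: \sum_(i < n) c i *: p (fvec i).
  have [[c cP]|nd] := pselect (dep n x); first by exists c.
  by exists (fun _ => 0) => /nd.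
have /choice[c cP] i : exists c : A, forall x, d x * c =
    d x * (if `[< dep n x >] then cc x i else 0).
  exact: (fib_glue dF).
have vn : p (fvec n) = e *: p (fvec n) + \sum_(i < n) c i *: p (fvec i).
  apply/eqP; rewrite -subr_eq0; apply/eqP/Nsep => x.
  rewrite scalerBr scalerDr !scalerA eP scaler_sumr.
  under eq_bigr => i _ do rewrite scalerA cP.
  case: asboolP => [/ccP ->|_].
    rewrite mulr0 scale0r add0r scaler_sumr.
    by apply/eqP; rewrite subr_eq0; apply/eqP/eq_bigr => i _; rewrite scalerA.
  rewrite mulr1; under eq_bigr => i _ do rewrite mulr0 scale0r.
  by rewrite sumr_const mul0rn addr0 subrr.
have IH (s : seq 'I_n) : exists2 z, red z &
    p z = \sum_(i <- s) (a * c i) *: p (fvec i).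
  elim: s => [|i s [z rz pz]]; first by exists 0 => //; rewrite big_nil linear0.
  have [z' rz' pz'] := IHn i (ltn_ord i) (a * c i).
  exists (z' + z); first exact: redD.
  by rewrite linearD pz' pz big_cons linearZ_LR.
have [z rz pz] := IH (index_enum _).
exists ((a * e) *: fvec n + z).
  apply: redD => // j x jx; rewrite -[X in d x * X]/((a * e) * fvec n j) fvecE.
  case: eqVneq => [nj|_]; last by rewrite !mulr0.
  rewrite mulr1 mulrA (fib_C dF) -mulrA eP.
  by case: asboolP => [_|]; [rewrite !mulr0 | rewrite nj].
rewrite linearD linearZ_LR pz linearZ_LR [X in _ = a *: X]vn scalerDr scalerA; congr (_ + _).
by rewrite scaler_sumr; apply: eq_bigr => i _; rewrite scalerA.
Qed.

(** The image of p, being countably generated, is projective: [t] is p followed by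
    a section. *)
Lemma countable_splitting : exists t : {linear frm A nat -> frm A nat},
  (forall y, p (t y) = p y) /\ (forall y, p y = 0 -> t y = 0).
Proof.
have /choice[t tP] y : exists z, red z /\ p z = p y.
  by have [z rz pz] := red_ex y; exists z.
have tu y z : red z -> p z = p y -> t y = z.
  move=> rz pz; have [rt pt] := tP y.
  apply/eqP; rewrite -subr_eq0; apply/eqP/red_uniq0; last first.
    by rewrite linearB pt pz subrr.
  by rewrite -scaleN1r; apply: redD => //; exact: redZ.
have tl : linear t.
  move=> a y z; have [ry py] := tP y; have [rz pz] := tP z.
  by apply: tu; [apply: redD => //; exact: redZ | rewrite !linearP py pz].
exists (mklin tl); split=> [y|y py /=]; first by case: (tP y).
by apply: tu; rewrite ?linear0 ?py.
Qed.

End CountableSplitting.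

Section Supports.
Variables (A : pzRingType) (L : choiceType).
Local Notation M := (frm A L).
Local Notation ebas := (@fvec A L).

Definition supp_in (S : set L) (y : M) : Prop := forall l, y l != 0 -> S l.

Lemma supp_in0 S : supp_in S 0.
Proof. by move=> l; rewrite dsum0E eqxx. Qed.

Lemma supp_inD S y z : supp_in S y -> supp_in S z -> supp_in S (y + z).
Proof.
move=> Sy Sz l; rewrite dsumDE; have [-> |/Sy //] := eqVneq (y l) 0.
by rewrite add0r; exact: Sz.
Qed.

Lemma supp_inZ S a y : supp_in S y -> supp_in S (a *: y).
Proof.
move=> Sy l; rewrite dsumZE => ay; apply: Sy; apply: contraNneq ay => ->.
by rewrite scaler0.
Qed.

Lemma supp_inN S y : supp_in S y -> supp_in S (- y).
Proof. by rewrite -scaleN1r; exact: supp_inZ. Qed.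

Lemma supp_inB S y z : supp_in S y -> supp_in S z -> supp_in S (y - z).
Proof. by move=> Sy Sz; apply: supp_inD => //; exact: supp_inN. Qed.

Lemma supp_in_sub (S S' : set L) y : (S `<=` S')%classic -> supp_in S y -> supp_in S' y.
Proof. by move=> SS' Sy l /Sy /SS'. Qed.

Lemma supp_in_fvec (S : set L) l : S l -> supp_in S (ebas l).
Proof. by move=> Sl m; rewrite fvecE; case: (eqVneq l m) => [<-//|_]; rewrite eqxx. Qed.

Lemma supp_in_lift (L' : choiceType) (S : set L) (f : {linear frm A L' -> M}) :
  (forall l, supp_in S (f (fvec A l))) -> forall u, supp_in S (f u).
Proof.
move=> Sf; elim/frm_ind => [|y z|a l]; first by rewrite linear0; exact: supp_in0.
  by rewrite linearD; exact: supp_inD.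
by rewrite linearZ_LR; exact: supp_inZ.
Qed.

Lemma supp_in_ind (S : set L) (P : M -> Prop) : P 0 ->
  (forall x y, P x -> P y -> P (x + y)) -> (forall a l, S l -> P (a *: ebas l)) ->
  forall y, supp_in S y -> P y.
Proof.
move=> P0 PD Pb y Sy; have [s us ys] := dsum_supp y.
have -> : y = \sum_(l <- s) (y l : A) *: ebas l by apply: fr_sum => // l; rewrite ys.
rewrite big_seq; apply: (big_ind P) => // l; rewrite -ys => /Sy; exact: Pb.
Qed.

Lemma fr_lift_on (Q : lmodType A) (S : set L) (k k' : L -> Q) :
  (forall l, S l -> k l = k' l) -> forall y, supp_in S y -> fr_lift k y = fr_lift k' y.
Proof.
move=> kk'; apply: supp_in_ind => [|x y ex ey|a l Sl]; first by rewrite !linear0.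
  by rewrite !linearD ex ey.
by rewrite !linearZ_LR /= !fr_lift_fvec kk'.
Qed.

(** The projection to the quotient by the span of S, realised inside the module
    as the coordinates outside S. *)
Definition cut (S : set L) : {linear M -> M} :=
  fr_lift (fun l => if `[< S l >] then 0 else ebas l).

Lemma cut_on S y : supp_in S y -> cut S y = 0.
Proof.
move: y; apply: supp_in_ind => [|x y ex ey|a l Sl]; first by rewrite linear0.
  by rewrite linearD ex ey addr0.
by rewrite linearZ_LR /= fr_lift_fvec; case: asboolP => //; rewrite scaler0.
Qed.

Lemma cut_sub S y : supp_in S (y - cut S y).
Proof.
elim/frm_ind: y => [|x y ex ey|a l]; first by rewrite linear0 subr0; exact: supp_in0.
  by rewrite linearD opprD addrACA; exact: supp_inD.
rewrite linearZ_LR -scalerBr /= fr_lift_fvec; apply: supp_inZ.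
by case: asboolP => Sl; [rewrite subr0; exact: supp_in_fvec | rewrite subrr; exact: supp_in0].
Qed.

Lemma cut_eq0 S y : cut S y = 0 -> supp_in S y.
Proof. by move=> y0; have := @cut_sub S y; rewrite y0 subr0. Qed.

(** The part of D outside S, enumerated by natural numbers. *)
Lemma countable_coordinates (S D : set L) : countable D ->
  exists (E : {linear frm A nat -> M}) (C : {linear M -> frm A nat}),
  [/\ forall u, supp_in D (E u), forall y, supp_in S y -> C y = 0 &
      forall y, supp_in (S `|` D)%classic y -> E (C y) = cut S y].
Proof.
move=> /countable_injP[f f_inj].
have /choice[e eP] n : exists y : M, supp_in D y /\
    forall l, D l -> f l = n -> y = ebas l.
  have [[l [Dl fl]]|nl] := pselect (exists l, D l /\ f l = n); last first.
    by exists 0; split=> [|l Dl fl]; [exact: supp_in0 | case: nl; exists l].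
  exists (ebas l); split=> [|m Dm fm]; first exact: supp_in_fvec.
  by congr ebas; apply: f_inj; rewrite ?inE // fl.
exists (fr_lift e), (fr_lift (fun l => if `[< S l >] then 0 else fvec A (f l))); split.
- by apply: supp_in_lift => n; rewrite fr_lift_fvec; case: (eP n).
- apply: supp_in_ind => [|x y ex ey|a l Sl]; first by rewrite linear0.
    by rewrite linearD ex ey addr0.
  by rewrite linearZ_LR /= fr_lift_fvec; case: asboolP => //; rewrite scaler0.
- apply: supp_in_ind => [|x y ex ey|a l SDl]; first by rewrite !linear0.
    by rewrite !linearD ex ey.
  rewrite !linearZ_LR /= !fr_lift_fvec; case: asboolP => Sl; first by rewrite linear0.
  by case: SDl => // Dl; rewrite fr_lift_fvec (proj2 (eP _) l).
Qed.

Lemma supp_finite (y : M) : finite_set [set l | y l != 0]%classic.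
Proof. exact: dsum_finite. Qed.

End Supports.
Arguments cut {A L} S.

Section PeriodicFree.
Variables (X : Type) (A : pzRingType) (d : X -> A).
Hypotheses (dF : fibred d) (d2 : forall x a, d x * a = 0 \/ d x * a = d x).
Variable L : choiceType.
Local Notation M := (frm A L).
Local Notation ebas := (@fvec A L).
(** A 2-periodic complex of free modules, indexed by parity. *)
Variable al : bool -> {linear M -> M}.
Hypothesis al_exact : forall b y, al b y = 0 <-> exists z, al (~~ b) z = y.

(** The span of S is a subcomplex, and it is exact. *)
Definition stable_exact (S : set L) :=
  (forall b y, supp_in S y -> supp_in S (al b y)) /\
  (forall b y, supp_in S y -> al b y = 0 -> exists2 z, supp_in S z & al (~~ b) z = y).

Lemma al_al b y : al b (al (~~ b) y) = 0.
Proof. by apply/al_exact; exists y. Qed.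

Lemma frm_sep (y : M) : (forall x, d x *: y = 0) -> y = 0.
Proof.
move=> y0; apply: dsumP => l; apply: (fib_sep dF) => x.
by have := congr1 (dsum_proj (fun _ : L => A^o : lmodType A) l) (y0 x).
Qed.

(** In the quotient by the span of S, the image under [al b] of the countable set
    of basis vectors reached by E is countably generated, hence projective. *)
Lemma quotient_splitting (S : set L) (E : {linear frm A nat -> M}) :
  exists t : bool -> {linear frm A nat -> frm A nat}, forall b,
    (forall u, cut S (al b (E (t b u))) = cut S (al b (E u))) /\
    (forall u, cut S (al b (E u)) = 0 -> t b u = 0).
Proof.
have /choice[t tP] b := countable_splitting dF d2 (cut S \o al b \o E) frm_sep.
by exists t.
Qed.

(** The delicate point is that exactness concerns uncountably many cycles y.  By
    [quotient_splitting] the cycles modulo S form a direct summand, so they are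
    generated by the countably many elements j - t j.  Each of these is corrected
    by some w supported in S to a true cycle, and D' contains the support of a
    preimage z of that cycle. *)
Lemma countable_stage (S D : set L) : stable_exact S -> countable D -> exists D' : set L,
  [/\ countable D', (D `<=` D')%classic,
    forall b y, supp_in (S `|` D)%classic y -> supp_in (S `|` D')%classic (al b y) &
    forall b y, supp_in (S `|` D)%classic y -> al b y = 0 ->
      exists2 z, supp_in (S `|` D')%classic z & al (~~ b) z = y].
Proof.
move=> [Sal Sex] cD; have [E [C [ED CS EC]]] := countable_coordinates A S cD.
have [t tP] := quotient_splitting S E.
have /choice[w wP] (bj : bool * nat) : exists w : M * M, supp_in S w.1 /\
    al (~~ bj.1) w.2 = E (fvec A bj.2 - t bj.1 (fvec A bj.2)) - w.1.
  case: bj => b j /=; set k := E _.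
  have Sk : supp_in S (al b k).
    by apply: cut_eq0; rewrite /k !linearB (tP b).1 subrr.
  have kk : al (~~ b) (al b k) = 0 by rewrite -{2}[b]negbK al_al.
  have [w Sw wk] := Sex _ _ Sk kk; rewrite negbK in wk.
  have /al_exact[z zk] : al b (k - w) = 0 by rewrite linearB wk subrr.
  by exists (w, z).
pose D' := (D `|` \bigcup_(bj in [set: bool * nat])
  ([set l | al bj.1 (E (fvec A bj.2)) l != 0] `|` [set l | (w bj).2 l != 0]))%classic.
exists D'; split.
- have cU (B C' : set L) : countable B -> countable C' -> countable (B `|` C')%classic.
    move=> cB cC; apply: (@sub_countable _ _ _
        (\bigcup_(c in [set: bool]) if c then B else C')%classic).
      by apply: subset_card_le => l [Bl|Cl]; [exists true | exists false].
    by apply: bigcup_countable => // -[].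
  apply: (cU _ _) => //; apply: bigcup_countable => // bj _.
  by apply: (cU _ _); apply: finite_set_countable; exact: supp_finite.
- by move=> l; left.
- move=> b y SDy; rewrite -[y](subrK (cut S y)) -(EC y) // linearD; apply: supp_inD.
    apply: (@supp_in_sub _ _ S); first by move=> l; left.
    by apply: Sal; rewrite (EC y) //; exact: cut_sub.
  apply: (supp_in_lift (f := al b \o E)) => j l yl; right; right.
  by exists (b, j) => //; left.
- move=> b y SDy aly; pose u := C y.
  have Sy := @cut_sub _ _ S y.
  have tu : t b u = 0.
    apply: (tP b).2; rewrite (EC y) //; apply: cut_on.
    have -> : al b (cut S y) = - al b (y - cut S y).
      by rewrite linearB aly sub0r opprK.
    by apply: supp_inN; exact: Sal.
  pose W := fr_lift (fun j => (w (b, j)).1); pose Z := fr_lift (fun j => (w (b, j)).2).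
  have ZE v : al (~~ b) (Z v) = E (v - t b v) - W v.
    apply: (frm_ext (f := al (~~ b) \o Z) (g := (E \o (idfun \- t b)) \- W)) => j.
    by rewrite /= /Z /W !fr_lift_fvec (proj2 (wP (b, j))).
  have SW : supp_in S (W u) by apply: supp_in_lift => j; rewrite fr_lift_fvec; case: (wP (b, j)).
  have yE : y = (y - cut S y) + W u + al (~~ b) (Z u).
    by rewrite ZE tu subr0 -(EC y) // -addrA subrKC subrK.
  have Syw : supp_in S (y - cut S y + W u) by exact: supp_inD.
  have [|z Sz zE] := Sex b _ Syw.
    have -> : y - cut S y + W u = y - al (~~ b) (Z u) by rewrite {3}yE addrK.
    by rewrite linearB aly al_al subrr.
  exists (z + Z u); last by rewrite linearD zE -yE.
  apply: supp_inD; first by apply: supp_in_sub Sz => l; left.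
  apply: supp_in_lift => j l; rewrite fr_lift_fvec => zl; right; right.
  by exists (b, j) => //; right.
Qed.

(** Iterate [countable_stage] and take the union: each element of the span, having
    finite support, already appears at a finite stage. *)
Lemma stable_exact_extend (S : set L) l0 : stable_exact S -> exists D : set L,
  [/\ countable D, D l0 & stable_exact (S `|` D)%classic].
Proof.
move=> gS.
have countable_stage' (D : {D : set L | countable D}) : exists D' : {D : set L | countable D},
  [/\ (sval D `<=` sval D')%classic,
    forall b y, supp_in (S `|` sval D)%classic y -> supp_in (S `|` sval D')%classic (al b y) &
    forall b y, supp_in (S `|` sval D)%classic y -> al b y = 0 ->
      exists2 z, supp_in (S `|` sval D')%classic z & al (~~ b) z = y].
  have [D' [cD' *]] := countable_stage gS (svalP D); by exists (exist _ D' cD').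
have [next nextP] := choice countable_stage'.
pose D n := iter n next
  (exist (fun B : set L => is_true (countable B)) [set l0]%classic (countable1 l0)).
pose U := (\bigcup_(n in [set: nat]) sval (D n))%classic.
have Dmono m n : (m <= n)%N -> (sval (D m) `<=` sval (D n))%classic.
  move=> /subnK <-; elim: (n - m)%N => [|k IHk] //.
  apply: subset_trans IHk _; rewrite addSn.
  by have [] := nextP (D (k + m)%N).
have onU : forall y : M, supp_in (S `|` U)%classic y -> exists n, supp_in (S `|` sval (D n))%classic y.
  apply: (supp_in_ind (P := fun y : M => exists n, supp_in (S `|` sval (D n))%classic y))
    => [|x z [m mx] [n nz]|a l]; first by exists 0%N; exact: supp_in0.
    exists (maxn m n); apply: supp_inD; [apply: supp_in_sub mx | apply: supp_in_sub nz];
      by apply: setUS; apply: Dmono; rewrite ?leq_maxl ?leq_maxr.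
  move=> [Sl|[n _ Dl]]; [exists 0%N | exists n]; apply: supp_inZ; apply: supp_in_fvec.
    by left.
  by right.
have DU n : (S `|` sval (D n) `<=` S `|` U)%classic.
  by apply: setUS => l Dl; exists n.
exists U; split.
- by apply: bigcup_countable => // n _; case: (D n).
- by exists 0%N.
- split=> b y /onU[n ny].
    by have [_ H _] := nextP (D n); apply: (supp_in_sub (S := (S `|` sval (D n.+1))%classic) (@DU n.+1)); exact: H.
  have [_ _ H] := nextP (D n) => /(H _ _ ny)[z nz zy]; exists z => //.
  exact: (supp_in_sub (S := (S `|` sval (D n.+1))%classic) (@DU n.+1)).
Qed.

Variables (b : bool) (Q : lmodType A) (h : {linear M -> Q}).
Hypothesis h_al : forall y, h (al (~~ b) y) = 0.

Definition solves (S : set L) (k : L -> Q) : Prop :=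
  forall y, supp_in S y -> fr_lift k (al b y) = h y.

(** Extend k by zero to k0.  The error h - k0 al b vanishes on S and on
    boundaries, so it lives on the countable quotient, where [al b] is split onto
    its image by [t b]; the correction is the error precomposed with that
    splitting, applied to the component of y in the image. *)
Lemma solves_extend (S D : set L) (k : L -> Q) : stable_exact S -> countable D ->
  stable_exact (S `|` D)%classic -> solves S k ->
  exists k' : L -> Q, (forall l, S l -> k' l = k l) /\ solves (S `|` D)%classic k'.
Proof.
move=> [Sal Sex] cD [SDal SDex] Sk.
have [E [C [ED CS EC]]] := countable_coordinates A S cD.
have [t tP] := quotient_splitting S E.
have SSD : (S `<=` S `|` D)%classic by move=> l; left.
have DSD : (D `<=` S `|` D)%classic by move=> l; right.
pose k0 : {linear M -> Q} := fr_lift k \o (idfun \- cut S).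
have k0E y : k0 y = fr_lift k (y - cut S y) by [].
pose hb : {linear M -> Q} := h \- (k0 \o al b).
have hbE y : hb y = h y - k0 (al b y) by [].
have hbS y : supp_in S y -> hb y = 0.
  by move=> Sy; rewrite hbE k0E cut_on ?subr0 ?Sk ?subrr //; exact: Sal.
have hb_al y : hb (al (~~ b) y) = 0 by rewrite hbE h_al al_al linear0 subrr.
(* Exactness passes to the quotient of the complex on S + D by the one on S. *)
have cyc c u : cut S (al c (E u)) = 0 -> exists v, cut S (al (~~ c) (E v)) = cut S (E u).
  move=> /cut_eq0 Sau.
  have au : al (~~ c) (al c (E u)) = 0 by rewrite -{2}[c]negbK al_al.
  have [w Sw wE] := Sex _ _ Sau au; rewrite negbK in wE.
  have SDuw : supp_in (S `|` D)%classic (E u - w).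
    by apply: supp_inB; [apply: supp_in_sub (ED u) | apply: supp_in_sub Sw].
  have [|z SDz zE] := SDex c _ SDuw; first by rewrite linearB wE subrr.
  exists (C z); rewrite EC //.
  rewrite -[cut S (E u)]subr0 -(cut_on Sw) -linearB -zE.
  apply/eqP; rewrite eq_sym -subr_eq0 -!linearB; apply/eqP/cut_on/Sal.
  exact: cut_sub.
have /choice[psi psiP] u : exists v,
    cut S (al b (E v)) = cut S (E (u - t (~~ b) u)).
  have [|v] := cyc (~~ b) (u - t (~~ b) u).
    by rewrite !linearB (tP (~~ b)).1 subrr.
  by rewrite negbK; exists v.
have psil : linear (fun u => t b (psi u)).
  pose p : {linear frm A nat -> M} := cut S \o al b \o E.
  pose g : {linear frm A nat -> M} := cut S \o E \o (idfun \- t (~~ b)).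
  have pg u : p (psi u) = g u by exact: psiP.
  have pt u : p u = 0 -> t b u = 0 by exact: (tP b).2.
  move=> a u v; apply/eqP; rewrite -subr_eq0 -linearP -linearB; apply/eqP/pt.
  by rewrite linearB linearP !pg linearP subrr.
pose kt : {linear frm A nat -> Q} := hb \o E \o mklin psil.
have ktE u : kt u = hb (E (t b (psi u))) by [].
pose k' l := k0 (ebas l) + kt (C (ebas l)).
have k'E y : fr_lift k' y = k0 y + kt (C y).
  by apply: (frm_ext (f := fr_lift k') (g := k0 \+ (kt \o C))) => l; rewrite fr_lift_fvec.
exists k'; split.
  move=> l Sl; rewrite /k' (CS _ (supp_in_fvec Sl)) linear0 addr0 k0E.
  by rewrite cut_on ?subr0 ?fr_lift_fvec //; exact: supp_in_fvec.
move=> y SDy; rewrite k'E; apply/eqP; rewrite addrC eq_sym -subr_eq -hbE; apply/eqP.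
pose u := C y; have Ey : E u = cut S y by exact: EC.
have hby : hb y = hb (E u).
  rewrite Ey -[y in LHS](subrK (cut S y)) linearD hbS ?add0r //.
  exact: cut_sub.
have cuty : cut S (al b y) = cut S (al b (E u)).
  apply/eqP; rewrite -subr_eq0 -!linearB Ey; apply/eqP/cut_on/Sal; exact: cut_sub.
set u1 := C (al b y).
have Eu1 : E u1 = cut S (al b y) by apply: EC; exact: SDal.
have tu1 : t (~~ b) u1 = 0.
  apply: (tP (~~ b)).2; rewrite Eu1 cuty; apply: cut_on.
  have -> : al (~~ b) (cut S (al b (E u))) =
      - al (~~ b) (al b (E u) - cut S (al b (E u))).
    rewrite linearB; have -> : al (~~ b) (al b (E u)) = 0.
      by rewrite -{2}[b]negbK al_al.
    by rewrite sub0r opprK.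
  by apply: supp_inN; apply: Sal; exact: cut_sub.
have cutK z : cut S (cut S z) = cut S z.
  apply/eqP; rewrite eq_sym -subr_eq0 -linearB; apply/eqP/cut_on; exact: cut_sub.
have tpsi : t b (psi u1) = t b u.
  apply/eqP; rewrite -subr_eq0 -linearB; apply/eqP/(tP b).2.
  by rewrite !linearB psiP tu1 subr0 Eu1 cutK cuty subrr.
rewrite ktE tpsi hby; apply/eqP; rewrite -subr_eq0 -!linearB.
have Sc : supp_in S (al b (E (u - t b u))).
  by apply: cut_eq0; rewrite !linearB (tP b).1 subrr.
have kk : al (~~ b) (al b (E (u - t b u))) = 0 by rewrite -{2}[b]negbK al_al.
have [w Sw wE] := Sex _ _ Sc kk; rewrite negbK in wE.
have /al_exact[z zE] : al b (E (u - t b u) - w) = 0 by rewrite linearB wE subrr.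
by rewrite -[E _](subrK w) -zE linearD hb_al hbS // addr0.
Qed.

(** Zorn's lemma for partial functions from the basis to Q, encoded as graphs,
    that are defined on a [stable_exact] set and solve the equation there. *)
Lemma solution_ex : exists k : {linear M -> Q}, forall y, k (al b y) = h y.
Proof.
pose dom (G : set (L * Q)) : set L := [set l | exists q, G (l, q)]%classic.
pose agrees (k : L -> Q) (G : set (L * Q)) := forall l q, G (l, q) -> k l = q.
pose P (G : set (L * Q)) := [/\ stable_exact (dom G), exists k, agrees k G &
  forall k, agrees k G -> solves (dom G) k].
have P0 : P set0.
  have nd l : ~ dom set0 l by move=> [q].
  have on00 y : supp_in (dom set0) y -> y = 0.
    by move=> y0; apply: dsumP => l; apply/eqP; apply: contra_notT (@nd l) => /y0.
  split.
  - split=> c y /on00 ->; first by rewrite linear0; exact: supp_in0.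
    by move=> _; exists 0; [exact: supp_in0 | rewrite linear0].
  - by exists (fun _ => 0) => l q.
  - by move=> k _ y /on00 ->; rewrite !linear0.
have [G [PG Gmax]] : exists G, P G /\ forall H, (G `<` H)%classic -> ~ P H.
  apply: Zorn_bigcup => C CP Ctot.
  set U := (\bigcup_(G in C) G)%classic.
  have onU : forall y : M, supp_in (dom U) y ->
      exists G, [/\ P G, (G `<=` U)%classic & supp_in (dom G) y].
    pose C' : set (set (L * Q)) := (C `|` [set set0])%classic.
    have C'P G : C' G -> P G /\ (G `<=` U)%classic.
      by move=> [CG|->]; split=> //; [exact: CP | exact: bigcup_sup].
    have C'tot G H : C' G -> C' H -> (G `<=` H \/ H `<=` G)%classic.
      move=> [CG|->]; last by left.
      by move=> [CH|->]; [exact: Ctot | right].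
    have dom_sub (G H : set (L * Q)) : (G `<=` H -> dom G `<=` dom H)%classic.
      by move=> GH l [q Glq]; exists q; exact: GH.
    move=> y /(@supp_in_ind _ _ _ (fun y : M => exists2 G, C' G & supp_in (dom G) y))[].
    - by exists set0; [right | exact: supp_in0].
    - move=> u v [G CG uG] [H CH vH]; have [GH|HG] := C'tot _ _ CG CH.
        by exists H => //; apply: supp_inD vH; apply: supp_in_sub uG; exact: dom_sub.
      by exists G => //; apply: supp_inD uG _; apply: supp_in_sub vH; exact: dom_sub.
    - move=> a l [q [G CG Glq]]; exists G; first by left.
      by apply: supp_inZ; apply: supp_in_fvec; exists q.
    by move=> G /C'P[PG GU] yG; exists G.
  have domU (G : set (L * Q)) : (G `<=` U -> dom G `<=` dom U)%classic.
    by move=> GU l [q Glq]; exists q; exact: GU.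
  have agU k (G : set (L * Q)) : (G `<=` U)%classic -> agrees k U -> agrees k G.
    by move=> GU kU l q /GU /kU.
  split.
  - split=> c y /onU[G [[[Gal Gex] _ _] GU yG]].
      by apply: (supp_in_sub (domU _ GU)); exact: Gal.
    by move=> /(Gex _ _ yG)[z zG zE]; exists z => //; exact: supp_in_sub (domU _ GU) zG.
  - have /choice[k kP] l : exists q, forall q', U (l, q') -> q = q'.
      have [[q Ulq]|nq] := pselect (exists q, U (l, q)); last first.
        by exists 0 => q' Uq'; case: nq; exists q'.
      exists q => q' [H CH Hlq']; have [G CG Glq] := Ulq.
      have [GH|HG] := Ctot _ _ CG CH.
        have [_ [k kH] _] := CP _ CH.
        by rewrite -(kH _ _ (GH _ Glq)) -(kH _ _ Hlq').
      have [_ [k kG] _] := CP _ CG.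
      by rewrite -(kG _ _ (HG _ Hlq')) -(kG _ _ Glq).
    by exists k => l q; exact: kP.
  - move=> k kU y /onU[G [[_ _ Gs] GU yG]].
    by apply: Gs yG; exact: agU kU.
have [gG [k kG] Gs] := PG; have kS := Gs k kG.
have [all|/existsNP[l0 nl0]] := pselect (forall l, dom G l).
  by exists (fr_lift k) => y; apply: kS => l _; exact: all.
exfalso; have [D [cD Dl0 gSD]] := stable_exact_extend l0 gG.
have [k' [k'k k's]] := solves_extend gG cD gSD kS.
pose H := [set lq : L * Q | (dom G `|` D)%classic lq.1 /\ lq.2 = k' lq.1]%classic.
have domH : dom H = (dom G `|` D)%classic.
  by apply/seteqP; split=> l; [move=> [q []] | exists (k' l)].
apply: (Gmax H).
  split=> [[l q] Glq|].
    have Sl : dom G l by exists q.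
    by split; [left | rewrite /= k'k // (kG _ _ Glq)].
  move=> /(_ (l0, k' l0)) HG; apply: nl0; exists (k' l0); apply: HG.
  by split=> //; right.
split; rewrite ?domH //.
  by exists k' => l q [].
move=> k'' k''H y Sy; rewrite -k's //.
apply: (fr_lift_on (S := (dom G `|` D)%classic)); last by apply: (proj1 gSD).
by move=> l Sl; apply: k''H.
Qed.

End PeriodicFree.

Section PeriodicProjective.
Variables (X : Type) (A : pzRingType) (d : X -> A).
Hypotheses (dF : fibred d) (d2 : forall x a, d x * a = 0 \/ d x * a = d x).

(** Embed P as a retract of a free module, i r being the projection.  The image
    of each of the maps i s r and i s r + (1 - i r) is the kernel of the other, so
    the free case applies although P is only projective. *)
Lemma periodic_hom_exact (P : lmodType A) (s : {linear P -> P}) (Q : lmodType A)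
    (h : {linear P -> Q}) :
  is_projective P -> (forall x, s x = 0 <-> exists y, s y = x) ->
  (forall x, h (s x) = 0) -> exists k : {linear P -> Q}, forall x, k (s x) = h x.
Proof.
move=> /projective_retract[i [r ri]] sE hs.
have ss x : s (s x) = 0 by apply/sE; exists x.
pose alt : {linear frm A P -> frm A P} := i \o s \o r.
pose alf : {linear frm A P -> frm A P} := (i \o s \o r) \+ (idfun \- (i \o r)).
pose al b := if b then alt else alf.
have alT y : al true y = i (s (r y)) by [].
have alF y : al false y = i (s (r y)) + (y - i (r y)) by [].
have r1 y : r (y - i (r y)) = 0 by rewrite linearB ri subrr.
have al_exact b y : al b y = 0 <-> exists z, al (~~ b) z = y.
  case: b; split.
  - rewrite alT => /(congr1 r); rewrite ri linear0 => /sE[z sz].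
    exists (i z + (y - i (r y))).
    by rewrite [LHS]alF linearD r1 addr0 ri sz addDB [LHS]subrKC.
  - move=> [z <-]; rewrite [al (~~ true) z]alF alT linearD r1 addr0 ri ss.
    by rewrite linear0.
  - rewrite alF => y0; have := congr1 r y0; rewrite linearD r1 addr0 ri linear0.
    move=> /[dup] sr /sE[z sz]; exists (i z); rewrite [LHS]alT ri sz.
    by move: y0; rewrite sr linear0 add0r => /subr0_eq.
  - by move=> [z <-]; rewrite [al (~~ false) z]alT alF ri ss linear0 subrr addr0.
have [k kP] := solution_ex dF d2 al_exact (b := false) (h := h \o r)
  (fun y => etrans (congr1 h (ri _)) (hs _)).
exists (k \o i) => x /=; rewrite -[RHS](congr1 h (ri x)) -[RHS]kP alF ri subrr.
by rewrite addr0.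
Qed.

Variable Y : complex A.
Local Notation D := (dsum (cobj Y)).

(** The differential of the total module; [eq_rect] transports from degree
    m - 1 + 1 to degree m. *)
Definition shift_fun (y : D) (m : int) : Y m :=
  eq_rect (m - 1 + 1) (fun j => Y j) (cdiff Y (m - 1) (y (m - 1))) m (subrK 1 m).

Lemma shift_funE y n : shift_fun y (n + 1) = cdiff Y n (y n).
Proof.
rewrite /shift_fun; move: (subrK 1 (n + 1)); have : n + 1 - 1 = n by rewrite addrK.
move: (n + 1 - 1) => m mn; rewrite {}mn => e.
by rewrite (Prop_irrelevance e erefl).
Qed.

Lemma int_succ_ind (P : int -> Prop) : (forall n, P (n + 1)) -> forall m, P m.
Proof. by move=> H m; rewrite -(subrK 1 m). Qed.

Let shift_fin (y : D) : finite_set [set m | shift_fun y m != 0]%classic.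
Proof.
apply: (@sub_finite_set _ _ ((fun n => n + 1) @` [set n | y n != 0])%classic).
  apply: int_succ_ind => n /=; rewrite shift_funE => yn.
  by exists n => //=; apply: contraNneq yn => ->; rewrite linear0.
exact/finite_image/dsum_finite.
Qed.

Let shift_linear : linear (fun y => Dsum (shift_fin y)).
Proof.
move=> a x y; apply: dsumP; apply: int_succ_ind => n.
rewrite [RHS]/(a *: shift_fun x (n + 1) + shift_fun y (n + 1)).
by rewrite [LHS]shift_funE !shift_funE linearP.
Qed.

Definition shift : {linear D -> D} := mklin shift_linear.

Lemma shiftE y n : shift y (n + 1) = cdiff Y n (y n).
Proof. exact: shift_funE. Qed.

Lemma shift_in n (x : Y n) : shift (dsum_in _ n x) = dsum_in _ (n + 1) (cdiff Y n x).
Proof.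
apply: dsumP; apply: int_succ_ind => j; rewrite shiftE.
have [<-|nj] := eqVneq n j; first by rewrite !dsum_in_in.
rewrite !dsum_in_out ?linear0 //.
by apply: contraNneq nj => /addIr ->.
Qed.

Lemma shift_exact : acyclic Y -> forall y, shift y = 0 <-> exists z, shift z = y.
Proof.
move=> exY y; split=> [y0|[z <-]]; last first.
  apply: dsumP; apply: int_succ_ind => n; rewrite shiftE dsum0E; move: n.
  by apply: int_succ_ind => n; rewrite shiftE cdiffK.
have dy n : cdiff Y n (y n) = 0 by rewrite -shiftE y0.
have uex n : exists u : Y n, cdiff Y n u = y (n + 1) /\
    (y (n + 1) = 0 -> u = 0).
  have [->|yn] := eqVneq (y (n + 1)) 0; first by exists 0; rewrite linear0.
  have /exY[u du] := dy (n + 1); exists u; split=> // y1.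
  by rewrite y1 eqxx in yn.
pose u n := projT1 (cid (uex n)); have uP n := projT2 (cid (uex n)).
have u_fin : finite_set [set n | u n != 0]%classic.
  apply: (@sub_finite_set _ _ ((fun m => m - 1) @` [set m | y m != 0])%classic).
    move=> n /= un; exists (n + 1); last by rewrite addrK.
    by apply: contraNneq un => y1; apply/eqP; exact: (proj2 (uP n)).
  exact/finite_image/dsum_finite.
exists (Dsum u_fin); apply: dsumP; apply: int_succ_ind => n.
by rewrite shiftE; case: (uP n).
Qed.

(** Collect the complex into the single module that is the sum of all its terms. *)
Lemma complex_hom_exact : (forall n, is_projective (Y n)) -> acyclic Y ->
  forall (Q : lmodType A) n (h : {linear Y (n + 1) -> Q}),
  (forall x, h (cdiff Y n x) = 0) ->
  exists k : {linear Y (n + 1 + 1) -> Q}, forall x, k (cdiff Y (n + 1) x) = h x.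
Proof.
move=> projY /shift_exact exY Q n h hd.
have [|k kP] := periodic_hom_exact (h := h \o dsum_proj (cobj Y) (n + 1))
  (dsum_projective projY) exY.
  by move=> y; exact: etrans (congr1 h (shiftE y n)) (hd _).
exists (k \o dsum_in _ (n + 1 + 1)) => x.
transitivity (k (shift (dsum_in _ (n + 1) x))); first by rewrite shift_in.
rewrite kP; have e := @dsum_in_in _ _ (cobj Y) (n + 1) x.
by apply: (congr1 h e).
Qed.

End PeriodicProjective.

(** * Reduction modulo the radical of T *)

Section RadicalReduction.
Variable R : comNzRingType.
Local Notation B := (dual R).
Local Notation T := (tri (aug_bimod R)).
Local Notation aug := (@dual_aug R).
Local Notation co1 := (@dual_co1 R).
Local Notation cst := (@dual_const R).
Local Notation eA := (tri_eA R).
Local Notation eB := (tri_eB R).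
Local Notation tm := (tri_m R).
Local Notation teps := (tri_eps R).
Let iota := [the {rmorphism (R * R)%type -> T} of @tri_diag R].
Let rho := [the {rmorphism T -> (R * R)%type} of @tri_top R].

Lemma rhoK c : rho (iota c) = c.
Proof. by case: c => a c; rewrite /= /tri_top /= dual_aug_const. Qed.

Lemma rho_rad : rho tm = 0 /\ rho teps = 0.
Proof. by split; rewrite /= /tri_top /= ?raddf0 ?dual_aug_eps. Qed.

(** J is generated by m and eps as a right ideal, with explicit coefficients. *)
Lemma tri_rad_decomp (t : T) :
  t - iota (rho t) = tm * mk_tri t.1.2 0 0 + teps * mk_tri 0 0 (cst (co1 t.2)).
Proof.
elim/tri_ind: t => a m c; rewrite !mk_triM mk_triD [LHS]mk_triB /=.
apply: mk_tri_eq; rewrite ?mul0r ?addr0 ?subrr ?subr0 ?mulr0 ?addr0 ?mul1r //.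
by rewrite add0r [X in X - _](dual_decomp c) addDB mulrC.
Qed.

Lemma rad_mul0 : [/\ tm * tm = 0, tm * teps = 0, teps * tm = 0 & teps * teps = 0].
Proof.
split; rewrite mk_triM; apply: mk_tri_eq;
  by rewrite ?mul0r ?mulr0 ?addr0 ?raddf0 ?dual_aug_eps ?mul0r ?addr0 ?eps2.
Qed.

Definition rad_zero (Q : lmodType T) : Prop :=
  forall q : Q, tm *: q = 0 /\ teps *: q = 0.

Lemma rad_zero_scale (Q : lmodType T) (t : T) (q : Q) : rad_zero Q ->
  t *: q = iota (rho t) *: q.
Proof.
move=> Q0; apply/eqP; rewrite -subr_eq0 -scalerBl tri_rad_decomp scalerDl -!scalerA.
by rewrite (Q0 _).1 (Q0 _).2 addr0.
Qed.

Lemma quot_rad_zero (Q : lmodType T) : rad_zero (quotmod (rad_submod Q)).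
Proof.
move=> q; have [y <-] := pi_lin_surj q.
by split; rewrite -linearZ_LR; apply/pi_lin_eq0/rad_predP;
  [exists y, 0 | exists 0, y]; rewrite scaler0 ?addr0 ?add0r.
Qed.

Lemma sub_rad_zero (Q : lmodType T) : rad_zero (submod (rad_submod Q)).
Proof.
have [mm me em ee] := rad_mul0.
move=> [q rq]; have /rad_predP[u [s qs]] := rq.
split; apply: val_inj.
  by transitivity (tm *: q) => //; rewrite qs scalerDr !scalerA mm me !scale0r addr0.
by transitivity (teps *: q) => //; rewrite qs scalerDr !scalerA em ee !scale0r addr0.
Qed.

Lemma rad_zero_kills (M Q : lmodType T) (h : {linear M -> Q}) x : rad_zero Q ->
  pi_lin (rad_submod M) x = 0 -> h x = 0.
Proof.
move=> Q0 /pi_lin_eq0/rad_predP[u [s ->]].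
by rewrite linearD !linearZ_LR /= (Q0 _).1 (Q0 _).2 addr0.
Qed.

(** M / J M as a module over R x R = T/J, acting through the diagonal matrices. *)
Definition bar (M : lmodType T) : lmodType (R * R)%type :=
  resmod (quotmod (rad_submod M)) iota.

Definition bar_pi (M : lmodType T) (x : M) : bar M := pi_lin (rad_submod M) x.

Lemma bar_pi_surj (M : lmodType T) : is_surj (@bar_pi M).
Proof. exact: pi_lin_surj. Qed.

Lemma bar_piD (M : lmodType T) (x y : M) : bar_pi (x + y) = bar_pi x + bar_pi y.
Proof. exact: raddfD. Qed.

Lemma bar_piZ (M : lmodType T) t (x : M) : bar_pi (t *: x) = rho t *: bar_pi x.
Proof.
apply: etrans (linearZ_LR _ _ _) _; rewrite [RHS]resZ.
exact/rad_zero_scale/quot_rad_zero.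
Qed.

Lemma bar_pi_eq0 (M : lmodType T) (x : M) : bar_pi x = 0 <->
  exists u s, x = tm *: u + teps *: s.
Proof. by split=> [/pi_lin_eq0/rad_predP|us] //; apply/pi_lin_eq0/rad_predP. Qed.

(** T -> R x R is onto with kernel J, so maps from M / J M are the maps from M
    that are semilinear for it. *)
Lemma bar_factor (M : lmodType T) (N : lmodType (R * R)%type)
    (f : {additive M -> N}) : (forall t x, f (t *: x) = rho t *: f x) ->
  exists g : {linear bar M -> N}, forall x, g (bar_pi x) = f x.
Proof.
move=> fZ; have fl : linear (f : M -> resmod N rho).
  by move=> t x y; rewrite raddfD fZ.
have N0 : rad_zero (resmod N rho).
  by move=> q; rewrite !resZ rho_rad.1 rho_rad.2 scale0r.
have [g gE] := lin_factor (h := mklin fl) (@pi_lin_surj _ _ (rad_submod M))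
  (fun x => @rad_zero_kills _ _ (mklin fl) x N0).
have gl : linear (g : bar M -> N).
  move=> c x y; rewrite raddfD /=; congr (_ + _).
  by rewrite resZ [LHS]linearZ_LR resZ rhoK.
by exists (mklin gl).
Qed.

Lemma bar_map_ex (M N : lmodType T) (f : {linear M -> N}) :
  exists g : {linear bar M -> bar N}, forall x, g (bar_pi x) = bar_pi (f x).
Proof.
have fB : zmod_morphism (fun x => bar_pi (f x)).
  by move=> x y; rewrite -[bar_pi _]/(pi_lin _ _) !raddfB.
pose f' : {additive M -> bar N} := HB.pack (fun x => bar_pi (f x))
  (GRing.isZmodMorphism.Build _ _ (fun x => bar_pi (f x)) fB).
by apply: (bar_factor (f := f')) => t x; rewrite /= linearZ_LR bar_piZ.
Qed.

Definition bar_map (M N : lmodType T) (f : {linear M -> N}) :=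
  projT1 (cid (bar_map_ex f)).

Lemma bar_mapE (M N : lmodType T) (f : {linear M -> N}) x :
  bar_map f (bar_pi x) = bar_pi (f x).
Proof. exact: (projT2 (cid (bar_map_ex f))). Qed.

Lemma bar_projective (P : lmodType T) : is_projective P -> is_projective (bar P).
Proof.
move=> projP M N p f ps.
have pl : linear (p : resmod M rho -> resmod N rho) by move=> t x y; exact: linearP.
have fl : linear (fun x => f (bar_pi x) : resmod N rho).
  by move=> t x y; rewrite bar_piD bar_piZ linearP.
have [g gE] := projP (resmod M rho) (resmod N rho) (mklin pl) (mklin fl) ps.
have gB : zmod_morphism (g : P -> M) by move=> x y; exact: raddfB.
pose g' : {additive P -> M} := HB.pack (g : P -> M)
  (GRing.isZmodMorphism.Build _ _ (g : P -> M) gB).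
have [k kE] := bar_factor (f := g') (fun t x => linearZ_LR g t x).
exists k => y; have [x <-] := bar_pi_surj y.
by rewrite kE; exact: gE.
Qed.

Variable Y : complex T.

Lemma bar_cdiffK n (x : bar (Y n)) :
  bar_map (cdiff Y (n + 1)) (bar_map (cdiff Y n) x) = 0.
Proof.
have [y <-] := bar_pi_surj x; rewrite !bar_mapE cdiffK.
exact: (raddf0 (pi_lin _)).
Qed.

Definition bar_complex : complex (R * R)%type := Complex bar_cdiffK.

Hypotheses (projY : forall n, is_projective (Y n)) (exY : acyclic Y).
Hypothesis tenY : tensor_acyclic (row_mod R : lmodType T^c) Y.

Lemma eAB_sum (V : lmodType T) (v : V) : v = eA *: v + eB *: v.
Proof.
rewrite -scalerDl mk_triD !addr0 !add0r; apply/esym; exact: scale1r.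
Qed.

Lemma tm_eA : tm = tm * eA.
Proof. by rewrite mk_triM; apply: mk_tri_eq; rewrite ?mulr0 ?mul0r ?mulr1 ?addr0. Qed.

Lemma eB_tm : eB * tm = tm.
Proof.
rewrite mk_triM; apply: mk_tri_eq; rewrite ?mulr0 ?mul0r //.
by rewrite rmorph1 mulr1 add0r.
Qed.

Lemma eB_eps : eB * teps = teps.
Proof. by rewrite mk_triM; apply: mk_tri_eq; rewrite ?mulr0 ?mul0r ?mul1r ?addr0. Qed.

(** If d v = m u + eps t, the component e_A v is a cocycle, hence a boundary.
    Projectivity of the terms makes e_A u a cocycle too, e_A u = d w2, and
    subtracting m w2 from e_B v leaves a cycle modulo eps, which is a boundary
    modulo eps by exactness of (R, R) (x) Y. *)
Lemma bar_acyclic : acyclic bar_complex.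
Proof.
move=> n x; split=> [dx|[y <-]]; last exact: bar_cdiffK.
have [v vx] := bar_pi_surj x; move: dx; rewrite -vx [LHS]bar_mapE.
move=> /bar_pi_eq0[u [t dv]].
have [|w1 w1E] := (exY (eA *: v)).1.
  rewrite linearZ_LR dv scalerDr !scalerA.
  have -> : eA * tm = 0.
    by rewrite mk_triM; apply: mk_tri_eq; rewrite ?mulr0 ?mul0r ?raddf0 ?mul0r ?addr0.
  have -> : eA * teps = 0.
    by rewrite mk_triM; apply: mk_tri_eq; rewrite ?mulr0 ?mul0r ?addr0.
  by rewrite !scale0r addr0.
have du : eA *: cdiff Y (n + 1 + 1) u = 0.
  apply: (@projective_m_eps R _ _ (- cdiff Y (n + 1 + 1) t) (@projY _)).
  apply/eqP; rewrite scalerN -subr_eq0 opprK -!linearZ_LR -linearD -dv.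
  by rewrite cdiffK.
have [|w2 w2E] := (exY (eA *: u)).1; first by rewrite linearZ_LR du.
have dv' : cdiff Y (n + 1) (eB *: v - tm *: w2) = teps *: t.
  have e1 : cdiff Y (n + 1) (tm *: w2) = tm *: u.
    by rewrite linearZ_LR w2E /= scalerA -tm_eA.
  have e2 : cdiff Y (n + 1) (eB *: v) = tm *: u + teps *: t.
    by rewrite linearZ_LR dv scalerDr !scalerA eB_tm eB_eps.
  by rewrite linearB e1 e2 addDB.
have [w3 [s ws]] := row_tensor_acyclic_eps tenY dv'.
have vE : v = cdiff Y n (w1 + w3) + (tm *: w2 + teps *: s).
  rewrite {1}(eAB_sum v) linearD -w1E -addrA; congr (_ + _).
  rewrite addrCA -ws scalerBr !scalerA eB_tm subrKC.
  by rewrite mk_triM; congr (_ *: _); apply: mk_tri_eq;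
    rewrite ?mulr0 ?mul0r ?mul1r ?addr0.
exists (bar_pi (w1 + w3)); rewrite [LHS]bar_mapE [in RHS]vE bar_piD.
suff -> : bar_pi (tm *: w2 + teps *: s) = 0 by rewrite addr0.
by apply/bar_pi_eq0; exists w2, s.
Qed.

(** Here R is arbitrary; for a power of F_2 this is [complex_hom_exact]. *)
Hypothesis RR_hom_exact : forall (V : complex (R * R)%type),
  (forall n, is_projective (V n)) -> acyclic V ->
  forall (Q : lmodType (R * R)%type) n (h : {linear V (n + 1) -> Q}),
  (forall x, h (cdiff V n x) = 0) ->
  exists k : {linear V (n + 1 + 1) -> Q}, forall x, k (cdiff V (n + 1) x) = h x.

Lemma rad_zero_hom_exact (Q : lmodType T) n (h : {linear Y (n + 1) -> Q}) :
  rad_zero Q -> (forall x, h (cdiff Y n x) = 0) ->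
  exists k : {linear Y (n + 1 + 1) -> Q}, forall x, k (cdiff Y (n + 1) x) = h x.
Proof.
move=> Q0 hd.
have [h1 h1E] := lin_factor (h := h) (@pi_lin_surj _ _ (rad_submod (Y (n + 1))))
  (fun x => @rad_zero_kills _ _ h x Q0).
have h1l : linear (h1 : bar (Y (n + 1)) -> resmod Q iota).
  move=> c x y; rewrite raddfD /=; congr (_ + _).
  by rewrite resZ [LHS]linearZ_LR.
have h1d x : mklin h1l (cdiff bar_complex n x) = 0.
  have [y <-] := bar_pi_surj x; rewrite [cdiff _ _ _]bar_mapE.
  exact: etrans (h1E _) (hd y).
have [k kE] := @RR_hom_exact bar_complex (fun m => @bar_projective _ (@projY m)) bar_acyclic
  _ _ _ h1d.
have kl : linear (fun x => k (bar_pi x) : Q).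
  move=> t x y; rewrite bar_piD bar_piZ linearP; congr (_ + _).
  by rewrite resZ -rad_zero_scale.
exists (mklin kl) => x.
transitivity (k (cdiff bar_complex (n + 1) (bar_pi x))).
  by congr (k _); apply/esym; exact: bar_mapE.
by rewrite kE; exact: h1E.
Qed.

(** Solve first with values in Q / J Q and lift the solution, which is possible
    because the terms are projective; the remaining error takes values in J Q,
    which is killed by J as well. *)
Lemma radical_hom_exact (Q : lmodType T) n (h : {linear Y (n + 1) -> Q}) :
  (forall x, h (cdiff Y n x) = 0) ->
  exists k : {linear Y (n + 1 + 1) -> Q}, forall x, k (cdiff Y (n + 1) x) = h x.
Proof.
move=> hd; pose p := pi_lin (rad_submod Q).
have [|k1 k1E] := @rad_zero_hom_exact _ n (p \o h) (@quot_rad_zero Q).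
  by move=> x; exact: etrans (congr1 p (hd x)) (linear0 p).
have [k kE] := @projY _ _ _ (pi_lin (rad_submod Q)) k1 (@pi_lin_surj _ _ (rad_submod Q)).
have [h2 h2E] : exists h2 : {linear Y (n + 1) -> submod (rad_submod Q)},
    forall x, val (h2 x) = h x - k (cdiff Y (n + 1) x).
  apply: (@sub_lift _ _ _ _ (h \- (k \o cdiff Y (n + 1)))) => x.
  by apply/pi_lin_eq0; rewrite linearB kE k1E subrr.
have [|k2 k2E] := @rad_zero_hom_exact _ n h2 (@sub_rad_zero Q).
  by move=> x; apply: val_inj; rewrite h2E hd cdiffK linear0 subrr.
exists (k \+ (sub_lin _ \o k2)) => x /=.
by rewrite k2E [submod_val _]h2E subrKC.
Qed.

End RadicalReduction.

Section PGFinGP.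
Variable X : pointedType.
Local Notation T := (ringT X).

Lemma PGF_GP (M : lmodType T) : PGF M -> GP M.
Proof.
move=> [Y [n [projY [[exY tenY] isoM]]]]; exists Y, n; split=> //.
split=> //; split=> // Q _ m h; split=> [hd|[k kh] x]; last first.
  by rewrite -kh cdiffK linear0.
apply: (radical_hom_exact projY exY) hd; first exact/tenY/row_mod_injective.
exact: complex_hom_exact (@dirac2_fibred X) (@dirac2_two X).
Qed.

End PGFinGP.

Theorem theorem4p10 (X : pointedType) (hLUH : LUH X)
    (U : set_system X) (hU : UltraFilter U) (hU_np : nonprincipal U)
    (hU_complete : kappa_complete X U)
    (F : free_resolution (modS hU)) :
  let T := ringT X in
  let G : lmodType T := modG F in
  (left_coherent T /\ right_coherent T) /\
  (strongly_GP G /\ ~ GF G) /\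
  (GP G /\ ~ GF G) /\
  ~ PGF G /\
  ((forall M : lmodType T, PGF M -> GP M) /\
   (exists M : lmodType T, GP M /\ ~ PGF M)).
Proof.
move=> T G.
have [Z [W [N [hW W1 Nnull Ncover]]]] := null_cover hU hU_np hU_complete (proj2 hLUH).
have FT_Delta_hom (Q : lmodType T) (h : {linear FT_term F -> Q}) :=
  @FT_Delta_hom_projective _ _ _ F _ _ _ hW W1 Nnull Ncover Q h.
have sG : strongly_GP G by exact: modG_strongly_GP.
have gG : GP G by exact: modG_GP.
have nGF : ~ GF G by move=> /GF_eps_exact/modG_not_eps_exact.
have nPGF : ~ PGF G by move=> /PGF_eps_exact/modG_not_eps_exact.
split; first exact: ringT_coherent.
do 3 split=> //.
by split; [exact: PGF_GP | exists G].
Qed.
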